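(* Let $f,g:\mathbb R^d\to\mathbb R$, $\mathcal B=\{x\in\mathbb R^d:\|x\|\le 1\}$ and $\mathcal C=\{x\in\mathbb R^d:g(x)\le 0\}$. Assume: (i) $\mathcal C$ is nonempty, closed and contained in $\mathcal B$, and a point $x_0\in\mathcal C$ is supplied. (ii) On an open convex neighborhood $U$ of $\mathcal B$, $f$ is $\ell$-weakly convex and $G_f$-Lipschitz, with $\ell,G_f>0$. There is a stochastic oracle $\widetilde v(x;\xi)$, queried with fresh randomness $\xi$ at each call, such that for every query point $x$ measurable with respect to the past history $\mathcal F$, $\mathbb E[\widetilde v(x;\xi)\mid\mathcal F]=v(x)\in\partial f(x)$ and $\|\widetilde v(x;\xi)\|\le G_f$ almost surely. (iii) $g$ is convex and continuously differentiable on $U$, and for constants $G_g,\sigma>0$, $\|\nabla g(x)\|\le G_g$ for all $x\in\mathcal B$ and $\|\nabla g(z)\|\ge\sigma$ for all $z\in\mathcal B$ with $g(z)=0$. Values $g(x)$ and gradients $\nabla g(x)$ can be evaluated exactly. Let $\Delta_f=f(x_0)-\min_{x\in\mathcal B}f(x)$ and let $0<\epsilon\le 1$. Run the Penalized Proximal Subgradient Method with One Projection (described in the context) with penalty $p=p_\gamma$, $p_\gamma(u)=\gamma\log(1+\exp(\lambda_0u/\gamma))$, $\lambda_0=2(G_f+4\ell)/\sigma$, $\gamma=1/K$, $\beta=2\ell$, $m=\ell$, and index set $\mathcal I=\{1,\dots,T\}$. Choose $$T=\max\Big\{2,\Big\lceil\frac{1000\,\ell\Delta_f}{\epsilon^2}\Big\rceil\Big\},$$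 and $K\ge2$ an integer with $e_K(1/(6T))\le e_*$, where $e_K(\cdot)$ and $e_*$ are defined in the context. Then $T=O(1+\ell\Delta_f/\epsilon^2)$, $K$ can be chosen with $K=\widetilde O(\epsilon^{-2})$ for fixed problem parameters, and with these choices the output $\hat x$ satisfies $$\hat x\in\mathcal C,\qquad \Pr\{\mathcal S_\ell(\hat x)\le\epsilon\}\ge\tfrac23,$$ where $\mathcal S_\ell(x)=\|\nabla\Phi_\ell(x)\|=2\ell\|x-Q_\ell(x)\|$, $\Phi_\ell(x)=\min_{y\in\mathcal C}\{f(y)+\ell\|y-x\|^2\}$ and $Q_\ell(x)=\operatorname{argmin}_{y\in\mathcal C}\{f(y)+\ell\|y-x\|^2\}$ (a unique point). For fixed problem parameters, the algorithm uses $TK=\widetilde O(\epsilon^{-4})$ stochastic subgradient calls and exactly one projection onto $\mathcal C$.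
   Context: All norms are Euclidean; $[u]_+=\max\{u,0\}$; $\mathcal P_D(x)=\operatorname{argmin}_{y\in D}\|y-x\|$. $\partial$ denotes the limiting subdifferential. A function is $\ell$-weakly convex if adding $\frac{\ell}{2}\|\cdot\|^2$ makes it convex. $\widetilde O$ hides polylogarithmic factors in $1/\epsilon$; ''fixed problem parameters'' means $\ell,G_f,G_g,\sigma,\Delta_f$ are held fixed. Algorithm (Penalized Proximal Subgradient Method with One Projection). Inputs: $x_0\in\mathcal B$, integers $T,K\ge2$, penalty $p$, index set $\mathcal I$, and $\beta,m>0$ such that each $H_t$ below is $m$-strongly convex on $\mathcal B$. For $t=0,\dots,T-1$: form $H_t(z)=f(z)+p(g(z))+\frac{\beta}{2}\|z-x_t\|^2$ and set $x_{t+1}=\mathrm{PSM}(H_t,x_t)$. Then sample $J$ uniformly from $\mathcal I$ (independently of everything else) and return $\hat x\in\mathcal P_{\mathcal C}(x_J)$. Subroutine $\mathrm{PSM}(H_t,x_t)$: set $z_1=x_t$. For $s=1,\dots,K$: set $\eta_s=2/[m(s+1)]$, query $\widetilde v(z_s;\xi_s)$ with fresh $\xi_s$, set $h_s=\widetilde v(z_s;\xi_s)+\beta(z_s-x_t)+\nabla(p\circ g)(z_s)$, and $z_{s+1}=\mathcal P_{\mathcal B}(z_s-\eta_sh_s)$. Return $K^{-1}\sum_{s=1}^Kz_s$. Constants: $G_F=G_f+4\ell$, $G_H=G_F+\lambda_0G_g$, $$U_K(m,G,\delta)=\frac{m+(G^2/m)\{\log(K+1)+2\log(1/\delta)\}}{K},\qquad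 e_K(\delta)=U_K(\ell,G_H,\delta)+\frac{\log 2}{K},$$ $$e_*=\min\Big\{\frac{\epsilon^2}{4000\,\ell},\ \frac{G_F\epsilon}{60\,\ell}\Big\}.$$ *)

(* Defs.v *)
(* The ambient space R^d is 'rV[R]_d, whose library norm is
   the sup norm: the topology is the usual one, but all norms and inner
   products below are the Euclidean ones, [enorm] and [dot]. *)
From HB Require Import structures.
From mathcomp Require Import all_boot all_order all_algebra.
From mathcomp Require Import all_classical all_reals all_analysis.

Set Implicit Arguments.
Unset Strict Implicit.
Unset Printing Implicit Defensive.

Import Order.TTheory GRing.Theory Num.Theory.
Import numFieldNormedType.Exports.

Local Open Scope classical_set_scope.
Local Open Scope ring_scope.

Section EuclideanSpace.
Context {R : realType} {d : nat}.
Local Notation V := 'rV[R]_d.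
Implicit Types (f h : V -> R) (D S : set V) (x y v : V).

Definition dot x y : R := \sum_(i < d) x 0 i * y 0 i.

Definition enorm x : R := Num.sqrt (dot x x).

Definition unit_ball : set V := [set x | enorm x <= 1].

Definition argmin D h : set V :=
  [set y | D y /\ forall y', D y' -> h y <= h y'].

(* The set-valued projection $\mathcal P_D(x)$. *)
Definition proj_set D x : set V := argmin D (fun y => enorm (y - x)).

(* On the unit ball the projection is unique. *)
Definition proj_ball x : V := xget 0 (proj_set unit_ball x).

(* The infimum of [h] on [D]; it is only used where the minimum is attained. *)
Definition min_on D h : R := inf (h @` D).

Definition elipschitz_on S (L : R) f :=
  forall x y, S x -> S y -> `|f x - f y| <= L * enorm (x - y).

Definition weakly_convex_on S (l : R) f :=
  convex_function (E := V) S (fun x => f x + l / 2 * enorm x ^+ 2).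

Definition strongly_convex_on S (m : R) f :=
  convex_function (E := V) S (fun x => f x - m / 2 * enorm x ^+ 2).

Definition grad f x : V := \row_(i < d) 'D_(delta_mx 0 i) (f : V -> R^o) x.

Definition C1_on S f := forall x, S x ->
  differentiable (f : V -> R^o) x /\ {for x, continuous (grad f)}.

(* $\liminf_{y \to x} (f(y) - f(x) - \langle v, y - x\rangle)/\|y - x\| \ge 0$,
   with the denominator cleared. *)
Definition frechet_subdiff f x : set V :=
  [set v | forall e : R, 0 < e ->
     \forall y \near x, f x + dot v (y - x) - e * enorm (y - x) <= f y].

Definition limiting_subdiff f x : set V :=
  [set v | exists xs vs : nat -> V,
     [/\ forall k, frechet_subdiff f (xs k) (vs k),
         xs @ \oo --> x,
         (f \o xs) @ \oo --> f x
       & vs @ \oo --> v]].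

End EuclideanSpace.

Section Stationarity.
Context {R : realType} {d : nat}.
Local Notation V := 'rV[R]_d.
Variables (C : set V) (f : V -> R) (l : R).

Definition Phi (x : V) : R := min_on C (fun y => f y + l * enorm (y - x) ^+ 2).

Definition Qset (x : V) : set V := argmin C (fun y => f y + l * enorm (y - x) ^+ 2).

(* The unique point of [Qset x] when there is one. *)
Definition Q (x : V) : V := xget 0 (Qset x).

Definition stationarity (x : V) : R := enorm (grad Phi x).

End Stationarity.

Section Oracle.
Context {R : realType} {d : nat} {dOm dXi : measure_display}.
Context {Om : measurableType dOm} {Xi : measurableType dXi}.
Local Notation V := 'rV[R]_d.
Variable P : probability Om R.

(* The past before the n-th oracle call (calls are numbered from 0):
   $\sigma(\xi_0, \dots, \xi_{n-1})$. *)
Definition history (xi : nat -> Om -> Xi) (n : nat) : set (set Om) :=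
  <<s \bigcup_(k in `I_n) preimage_set_system setT (xi k) measurable >>.

Definition all_randomness (xi : nat -> Om -> Xi) : set (set Om) :=
  <<s \bigcup_k preimage_set_system setT (xi k) measurable >>.

Definition measurable_wrt (F : set (set Om)) (X : Om -> V) :=
  forall (i : 'I_d) (S : set R), measurable S -> F ((fun w => X w 0 i) @^-1` S).

(* [Y] is a version of the (coordinatewise) conditional expectation E[Z | F]. *)
Definition is_cond_exp (F : set (set Om)) (Z Y : Om -> V) :=
  measurable_wrt F Y /\
  forall i : 'I_d,
    [/\ P.-integrable setT (fun w => (Z w 0 i)%:E),
        P.-integrable setT (fun w => (Y w 0 i)%:E)
      & forall A, F A ->
          (\int[P]_(w in A) (Y w 0 i)%:E = \int[P]_(w in A) (Z w 0 i)%:E)%E].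

(* The n-th call, at the point x, answers [vt x (xi n w)].  The first conclusion
   on [Y], that the answer belongs to the next history, is automatic when [vt]
   is jointly measurable. *)
Definition stochastic_oracle (f : V -> R) (Gf : R) (xi : nat -> Om -> Xi)
    (vt : V -> Xi -> V) (v : V -> V) :=
  (forall x, unit_ball x -> limiting_subdiff f x (v x)) /\
  forall (n : nat) (X : Om -> V),
    measurable_wrt (history xi n) X -> (forall w, unit_ball (X w)) ->
    let Y w := vt (X w) (xi n w) in
    [/\ measurable_wrt (history xi n.+1) Y,
        is_cond_exp (history xi n) Y (v \o X)
      & {ae P, forall w, enorm (Y w) <= Gf}].

(* [I] is meant to be duplicate-free. *)
Definition uniform_on (J : Om -> nat) (I : seq nat) :=
  forall j, j \in I -> P (J @^-1` [set j]) = ((size I)%:R^-1)%:E.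

Definition independent_of (J : Om -> nat) (F : set (set Om)) :=
  forall (j : nat) (A : set Om), F A ->
    P (J @^-1` [set j] `&` A) = (P (J @^-1` [set j]) * P A)%E.

End Oracle.

(* Programs thread the numbers of oracle calls and of projections onto C made so
   far; the former is also the index of the randomness used by the next call. *)
Record cost := Cost { oracle_calls : nat; projections : nat }.

Definition prog (A : Type) := cost -> A * cost.

Definition ret A (a : A) : prog A := fun c => (a, c).

Definition bind A B (m : prog A) (k : A -> prog B) : prog B :=
  fun c => let: (a, c') := m c in k a c'.

Notation "'let!' x := m 'in' k" := (bind m (fun x => k))
  (at level 200, x name, m at level 200, k at level 200,
   format "'[v' 'let!'  x  :=  m  'in' '/' k ']'").

Section Algorithm.
Context {R : realType} {d : nat}.
Local Notation V := 'rV[R]_d.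
Variables (f g : V -> R) (p : R -> R) (beta m : R) (K T : nat).
(* [answer n z]: answer to the n-th oracle call, made at z;
   [projC]: the selection of $\mathcal P_C$ that is used. *)
Variables (answer : nat -> V -> V) (projC : V -> V).

Definition prox_objective (xt z : V) : R :=
  f z + p (g z) + beta / 2 * enorm (z - xt) ^+ 2.

Definition query (z : V) : prog V := fun c =>
  (answer (oracle_calls c) z, Cost (oracle_calls c).+1 (projections c)).

Definition project_C (x : V) : prog V := fun c =>
  (projC x, Cost (oracle_calls c) (projections c).+1).

(* The sequence $z_1, \dots, z_{s+1}$; the step after z_s is the s-th one. *)
Fixpoint psm_iterates (xt : V) (s : nat) : prog (seq V) :=
  if s is s'.+1 then
    let! zs := psm_iterates xt s' in
    let z := last xt zs in
    let! v := query z in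
    let eta := 2 / (m * s.+1%:R) in
    let h := v + beta *: (z - xt) + grad (p \o g) z in
    ret (rcons zs (proj_ball (z - eta *: h)))
  else ret [:: xt].

Definition PSM (xt : V) : prog V :=
  let! zs := psm_iterates xt K in
  ret (K%:R^-1 *: \sum_(1 <= s < K.+1) zs`_s.-1).

(* The sequence $x_0, \dots, x_t$. *)
Fixpoint outer_iterates (x0 : V) (t : nat) : prog (seq V) :=
  if t is t'.+1 then
    let! xs := outer_iterates x0 t' in
    let! x := PSM (last x0 xs) in
    ret (rcons xs x)
  else ret [:: x0].

Definition penalized_psm (x0 : V) (j : nat) : prog V :=
  let! xs := outer_iterates x0 T in
  project_C xs`_j.

End Algorithm.

Section Constants.
Context {R : realType}.
Implicit Types l Gf Gg sigma eps delta : R.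

Definition softplus (lambda0 gamma u : R) : R :=
  gamma * ln (1 + expR (lambda0 * u / gamma)).

Definition lambda_0 l Gf sigma : R := 2 * (Gf + 4 * l) / sigma.

Definition G_F l Gf : R := Gf + 4 * l.

Definition G_H l Gf Gg sigma : R := G_F l Gf + lambda_0 l Gf sigma * Gg.

Definition U_K (K : nat) (m G delta : R) : R :=
  (m + G ^+ 2 / m * (ln K.+1%:R + 2 * ln (1 / delta))) / K%:R.

Definition e_K l Gf Gg sigma (K : nat) delta : R :=
  U_K K l (G_H l Gf Gg sigma) delta + ln 2 / K%:R.

Definition e_star l Gf eps : R :=
  Num.min (eps ^+ 2 / (4000 * l)) (G_F l Gf * eps / (60 * l)).

Definition num_outer l Delta eps : nat :=
  maxn 2 `|Num.ceil (1000 * l * Delta / eps ^+ 2)|%N.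

Definition inner_ok l Gf Gg sigma Delta eps (K : nat) :=
  (2 <= K)%N /\
  e_K l Gf Gg sigma K (1 / (6 * (num_outer l Delta eps)%:R)) <= e_star l Gf eps.

(* $\widetilde O(\epsilon^{-k})$ with constant c and logarithmic exponent a. *)
Definition soft_bound (c : R) (a k : nat) eps : R :=
  c * eps ^- k * (1 + ln (1 / eps)) ^+ a.

End Constants.

(* Main.v *)
Require Import Defs.
From HB Require Import structures.
From mathcomp Require Import all_boot all_order all_algebra.
From mathcomp Require Import all_classical all_reals all_analysis.
From mathcomp Require Import ring lra.
From mathcomp Require Import measurable_realfun.

Set Implicit Arguments.
Unset Strict Implicit.
Unset Printing Implicit Defensive.

Import Order.TTheory GRing.Theory Num.Theory.
Import numFieldNormedType.Exports.

Local Open Scope classical_set_scope.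
Local Open Scope ring_scope.

(** Why the statement holds.

    Exact penalty. Constraint qualification on the boundary [g = 0] and
    convexity give the error bound [sigma * dist(z, C) <= max 0 (g z)] on the
    unit ball ([error_bound]). Leaving [C] gains at most [Gf + 4 l] per unit of
    distance in the prox objective, while the penalty slope [lambda_0] charges
    twice as much; hence the stationary point [Q x] also minimizes
    [f + lambda_0 * max 0 g + l |. - x|^2] over the ball ([exact_penalty]), and
    this function grows like [l / 2 |. - Q x|^2] around it. The softplus penalty
    differs from the exact one by at most [gamma * ln 2].

    Inner loop. The prox objective is [l]-strongly convex. In the regret of the
    projected subgradient method with steps [2 / (l (s + 1))]
    ([psm_regret]), half of the strong convexity telescopes the weighted
    distances and the other half, [l / 4 |z_s - z*|^2], is kept. The noise terms
    [<y_s - v(z_s), z* - z_s>] are martingale increments of size [O(Gf |z_s - z*|)];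
    by Hoeffding's lemma, the exponential of the sum over [s] of
    [t * noise - (t Gf |z_s - z*|)^2 / 2] is a supermartingale, and for [t = l / (2 Gf^2)] the compensator is exactly the
    part of strong convexity that was kept. Markov's inequality then gives
    [psm_high_probability]: accuracy [U_K] with probability [1 - delta], with
    only a logarithm of [1 / delta].

    Outer loop. When each of the [T] prox problems is solved to accuracy [e], the
    values of the exact penalty telescope ([outer_telescope]), so that
    [l / 2 * sum |x_t - Q x_t|^2 <= Delta + T e]. With the prescribed [T] and [K]
    this makes [|x_t - Q x_t|] small except for at most a sixth of the indices
    [t], and [x_{t+1}] is always close to [Q x_t]. Projections are nonexpansive and
    [Q] is 2-Lipschitz, so that the projection of [x_{t+1}] then has small
    stationarity measure ([stationarity_output_le]), which is
    [2 l |x - Q x|] by differentiability of Moreau envelopes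
    ([envelope_differentiable]). The index is independent of the failure event, of
    probability at most 1/6, and of the bad indices, so that the output is good
    with probability at least [5/6 * 5/6] ([uniform_index_success]).

    Measurability. The iterates are continuous functions of earlier answers, hence
    measurable for the past; conditional means are only known tested against
    events of the past, and are transferred to products with bounded
    past-measurable variables by [orthogonal_of_null_integrals]. *)

(** * Euclidean geometry of row vectors *)

Section Euclid.
Context {R : realType} {d : nat}.
Local Notation V := 'rV[R]_d.
Implicit Types (x y z u : V) (a b t : R).

Lemma dotC x y : dot x y = dot y x.
Proof. by apply: eq_bigr => i _; rewrite mulrC. Qed.

Lemma dotDl x y z : dot (x + y) z = dot x z + dot y z.
Proof. by rewrite -big_split; apply: eq_bigr => i _; rewrite mxE mulrDl. Qed.

Lemma dotZl a x y : dot (a *: x) y = a * dot x y.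
Proof. by rewrite /dot big_distrr; apply: eq_bigr => i _ /=; rewrite mxE mulrA. Qed.

Lemma dotNl x y : dot (- x) y = - dot x y.
Proof. by rewrite -scaleN1r dotZl mulN1r. Qed.

Lemma dotDr x y z : dot z (x + y) = dot z x + dot z y.
Proof. by rewrite dotC dotDl !(dotC z). Qed.

Lemma dotZr a x y : dot y (a *: x) = a * dot y x.
Proof. by rewrite dotC dotZl dotC. Qed.

Lemma dotNr x y : dot y (- x) = - dot y x.
Proof. by rewrite dotC dotNl dotC. Qed.

Lemma dot0l x : dot 0 x = 0.
Proof. by rewrite -(scale0r x) dotZl mul0r. Qed.

Lemma dot0r x : dot x 0 = 0.
Proof. by rewrite dotC dot0l. Qed.

Definition dotE := (dotDl, dotDr, dotNl, dotNr, dotZl, dotZr, dot0l, dot0r).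

Lemma dot_delta x (i : 'I_d) : dot x (delta_mx 0 i) = x 0 i.
Proof.
rewrite /dot (bigD1 i)//= mxE !eqxx mulr1 big1 ?addr0// => j ji.
by rewrite mxE (negbTE ji) andbF mulr0.
Qed.

Lemma dotxx_ge0 x : 0 <= dot x x.
Proof. by apply: sumr_ge0 => i _; rewrite -expr2 sqr_ge0. Qed.

Lemma dotxx_eq0 x : dot x x = 0 -> x = 0.
Proof.
move=> /eqP; rewrite psumr_eq0 => [/allP xx0|i _]; last by rewrite -expr2 sqr_ge0.
apply/rowP => i; rewrite mxE.
by have := xx0 i (mem_index_enum i); rewrite /= -expr2 sqrf_eq0 => /eqP.
Qed.

Lemma enorm_ge0 x : 0 <= enorm x.
Proof. exact: sqrtr_ge0. Qed.
Hint Resolve enorm_ge0 : core.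

Lemma enorm_sqr x : enorm x ^+ 2 = dot x x.
Proof. by rewrite sqr_sqrtr// dotxx_ge0. Qed.

Lemma enorm_eq0 x : enorm x = 0 -> x = 0.
Proof. by move=> x0; apply: dotxx_eq0; rewrite -enorm_sqr x0 expr0n. Qed.

Lemma enorm0 : enorm (0 : V) = 0.
Proof. by rewrite /enorm dot0l sqrtr0. Qed.

Lemma enorm_gt0 x : x != 0 -> 0 < enorm x.
Proof. by move=> x0; rewrite lt_def enorm_ge0 andbT; apply: contra_neq x0 => /enorm_eq0. Qed.

Lemma enormZ a x : enorm (a *: x) = `|a| * enorm x.
Proof. by rewrite /enorm !dotE mulrA -expr2 sqrtrM ?sqr_ge0// sqrtr_sqr. Qed.

Lemma enormN x : enorm (- x) = enorm x.
Proof. by rewrite /enorm !dotE opprK. Qed.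

Lemma enormBC x y : enorm (x - y) = enorm (y - x).
Proof. by rewrite -enormN opprB. Qed.

Lemma dot_le_enorm x y : dot x y <= enorm x * enorm y.
Proof.
have [->|/enorm_gt0 x0] := eqVneq x 0; first by rewrite dot0l enorm0 mul0r.
have [->|/enorm_gt0 y0] := eqVneq y 0; first by rewrite dot0r enorm0 mulr0.
have := dotxx_ge0 (enorm y *: x - enorm x *: y).
rewrite !dotE -!enorm_sqr (dotC y x) -subr_ge0 => H.
rewrite -subr_ge0 -(pmulr_rge0 _ (mulr_gt0 x0 y0)); nra.
Qed.

Lemma normr_dot_le x y : `|dot x y| <= enorm x * enorm y.
Proof.
by rewrite ler_norml dot_le_enorm andbT lerNl -dotNl -(enormN x) dot_le_enorm.
Qed.

Lemma enorm_sqrD x y : enorm (x + y) ^+ 2 = enorm x ^+ 2 + 2 * dot x y + enorm y ^+ 2.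
Proof. rewrite !enorm_sqr !dotE (dotC y x); ring. Qed.

Lemma enorm_sqrB x y : enorm (x - y) ^+ 2 = enorm x ^+ 2 - 2 * dot x y + enorm y ^+ 2.
Proof. rewrite !enorm_sqr !dotE (dotC y x); ring. Qed.

Lemma enorm_triangle x y : enorm (x + y) <= enorm x + enorm y.
Proof.
rewrite -(@ler_pXn2r _ 2)// ?nnegrE ?addr_ge0//.
rewrite enorm_sqrD; have := dot_le_enorm x y; nra.
Qed.

Lemma enorm_triangleB x y z : enorm (x - z) <= enorm (x - y) + enorm (y - z).
Proof. by rewrite -[x - z](subrKA y) enorm_triangle. Qed.

Lemma enormB_le x y : enorm (x - y) <= enorm x + enorm y.
Proof. by rewrite -(enormN y) enorm_triangle. Qed.

Lemma enorm_conv t x y : 0 <= t -> t <= 1 ->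
  enorm (t *: x + (1 - t) *: y) <= t * enorm x + (1 - t) * enorm y.
Proof.
move=> t0 t1; apply: le_trans (enorm_triangle _ _) _.
by rewrite !enormZ !ger0_norm ?subr_ge0.
Qed.

Lemma coord_le_enorm x (i : 'I_d) : `|x 0 i| <= enorm x.
Proof.
rewrite -(@ler_pXn2r _ 2)// ?nnegrE// real_normK ?num_real// enorm_sqr /dot.
rewrite (bigD1 i)//= -expr2 lerDl; apply: sumr_ge0 => j _.
by rewrite -expr2 sqr_ge0.
Qed.

Lemma mx_norm_le_enorm x : `|x| <= enorm x.
Proof.
rewrite [leLHS]mx_normrE; apply/bigmax_leP; split => // -[i j] _ /=.
by rewrite (ord1 i) coord_le_enorm.
Qed.

Lemma coord_le_mx_norm x (i : 'I_d) : `|x 0 i| <= `|x|.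
Proof.
rewrite [leRHS]mx_normrE.
by apply: (@le_bigmax _ _ _ _ (fun ij => `|x ij.1 ij.2|) (0, i)).
Qed.

Lemma enorm_le_mx_norm x : enorm x <= d.+1%:R * `|x|.
Proof.
rewrite -(@ler_pXn2r _ 2)// ?nnegrE ?mulr_ge0// enorm_sqr.
apply: (@le_trans _ _ (\sum_(i < d) `|x| ^+ 2)).
  apply: ler_sum => i _; rewrite -expr2 -[leLHS]real_normK ?num_real//.
  by rewrite ler_pXn2r ?nnegrE// coord_le_mx_norm.
rewrite big_const_ord iter_addr_0 -[_ *+ d]mulr_natl exprMn.
apply: ler_wpM2r; first exact: sqr_ge0.
by rewrite -natrX ler_nat; apply: leq_trans (leqnSn d) _; rewrite leq_pmulr.
Qed.

(** ** Topology of the Euclidean norm *)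

Lemma nbhs_enorm (x : V) (A : set V) :
  nbhs x A <-> exists2 e : R, 0 < e & forall y, enorm (y - x) < e -> A y.
Proof.
split=> [/nbhs_normP[e /= e0 eA]|[e e0 eA]].
  exists e => // y yx; apply: eA => /=.
  by rewrite -normrN opprB (le_lt_trans (mx_norm_le_enorm _)).
apply/(@nbhs_normP R V); exists (e / d.+1%:R) => /=; first by rewrite divr_gt0.
move=> y /=; rewrite -normrN opprB ltr_pdivlMr// mulrC => yx.
by apply: eA; rewrite (le_lt_trans (enorm_le_mx_norm _)).
Qed.

Lemma continuous_enorm_lip (h : V -> R) (L : R) x :
  (\forall y \near x, `|h y - h x| <= L * enorm (y - x)) -> {for x, continuous h}.
Proof.
move=> /nbhs_enorm[r r0 hr].
have L1 : 0 < `|L| + 1 by rewrite ltr_wpDl.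
have FF : Filter (nbhs (x : V)) by exact: nbhs_filter.
apply/(@cvgrPdist_lt _ R^o _ _ FF) => e e0; apply/nbhs_enorm.
exists (Num.min r (e / (`|L| + 1))); first by rewrite lt_min r0 divr_gt0.
move=> y; rewrite lt_min ltr_pdivlMr// => /andP[/hr hy ye].
rewrite distrC (le_lt_trans hy)// (le_lt_trans _ ye)// mulrC ler_wpM2l//.
by rewrite (le_trans (ler_norm _))// lerDl.
Qed.

Lemma continuous_enormB y : continuous (fun x => enorm (x - y)).
Proof.
move=> x; apply: (@continuous_enorm_lip _ 1); near=> z; rewrite mul1r.
rewrite ler_norml lerBlDr lerNl opprB lerBlDr.
by rewrite (enormBC z x) enorm_triangleB (enormBC x z) enorm_triangleB.
Unshelve. all: by end_near. Qed.

Lemma continuous_enorm : continuous (@enorm R d).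
Proof.
by move=> x; have := @continuous_enormB 0 x; under eq_fun do rewrite subr0.
Qed.

Lemma continuous_dot y : continuous (fun x => dot y x).
Proof.
move=> x; apply: (@continuous_enorm_lip _ (enorm y)); near=> z.
by rewrite -dotNr -dotDr normr_dot_le.
Unshelve. all: by end_near. Qed.

(** ** The unit ball *)

Lemma compact_enorm_closed (D : set V) : closed D -> D `<=` unit_ball -> compact D.
Proof.
move=> clD DB; apply: bounded_closed_compact => //.
exists 1; split; first exact: num_real.
move=> M M1 x /DB/= x1; apply: le_trans (ltW M1).
exact: le_trans (mx_norm_le_enorm _) _.
Qed.

Lemma closed_unit_ball : closed (@unit_ball R d).
Proof.
have -> : @unit_ball R d = enorm @^-1` [set r | r <= 1] by [].
apply: preimage_closed; last exact: closed_le.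
by move=> x _; exact: continuous_enorm.
Qed.

Lemma compact_unit_ball : compact (@unit_ball R d).
Proof. exact: compact_enorm_closed closed_unit_ball _. Qed.

Lemma unit_ball0 : unit_ball (0 : V).
Proof. by rewrite /unit_ball/= enorm0. Qed.

Lemma unit_ball_diam x y : unit_ball x -> unit_ball y -> enorm (x - y) <= 2.
Proof. by move=> x1 y1; rewrite (le_trans (enormB_le x y))// (_ : 2 = 1 + 1)// lerD. Qed.

End Euclid.
#[global] Hint Resolve enorm_ge0 : core.

(** * Weak and strong convexity *)

Section Convexity.
Context {R : realType} {d : nat}.
Local Notation V := 'rV[R]_d.
Implicit Types (D S : set V) (f h k H : V -> R) (x y z u v w : V) (a b c m t : R).

Lemma convex_setP S : convex_set (M := V) S <->
  forall t x y, 0 <= t -> t <= 1 -> S x -> S y -> S (t *: x + (1 - t) *: y).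
Proof.
split=> [cS t x y t0 t1 Sx Sy|cS x y t /set_mem Sx /set_mem Sy].
  have := cS x y (Itv01 t0 t1) (mem_set Sx) (mem_set Sy).
  by move=> /set_mem.
by apply/mem_set; exact: cS.
Qed.

Lemma convex_functionP S h : convex_function (E := V) S h <->
  forall t x y, 0 <= t -> t <= 1 -> S x -> S y ->
    h (t *: x + (1 - t) *: y) <= t * h x + (1 - t) * h y.
Proof.
split=> [ch t x y t0 t1 Sx Sy|ch t x y /set_mem Sx /set_mem Sy].
  exact: (ch (Itv01 t0 t1) x y (mem_set Sx) (mem_set Sy)).
exact: (ch t%:num x y).
Qed.

Lemma enorm_sqr_conv t x y : enorm (t *: x + (1 - t) *: y) ^+ 2 =
  t * enorm x ^+ 2 + (1 - t) * enorm y ^+ 2 - t * (1 - t) * enorm (x - y) ^+ 2.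
Proof. rewrite !enorm_sqr !dotE (dotC y x); ring. Qed.

(** Convexity of the regularized function, read back on the function itself:
    the defect of convexity is at most the defect of the square norm. *)
Lemma weakly_convexP S a h : weakly_convex_on S a h <->
  forall t x y, 0 <= t -> t <= 1 -> S x -> S y ->
    h (t *: x + (1 - t) *: y) <=
    t * h x + (1 - t) * h y + a / 2 * (t * (1 - t)) * enorm (x - y) ^+ 2.
Proof.
rewrite /weakly_convex_on convex_functionP.
split=> ch t x y t0 t1 Sx Sy; have := ch t x y t0 t1 Sx Sy;
  rewrite enorm_sqr_conv; set X := enorm x ^+ 2; set Y := enorm y ^+ 2;
  set Z := enorm _ ^+ 2; lra.
Qed.

Lemma strongly_weakly_convex S m h :
  strongly_convex_on S m h <-> weakly_convex_on S (- m) h.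
Proof.
rewrite /strongly_convex_on /weakly_convex_on.
by under eq_fun do rewrite -mulNr -mulNr.
Qed.

Lemma convex_weakly_convex0 S h :
  convex_function (E := V) S h -> weakly_convex_on S 0 h.
Proof.
move=> /convex_functionP ch; apply/weakly_convexP => t x y t0 t1 Sx Sy.
by rewrite !mul0r addr0 ch.
Qed.

Lemma weakly_convexD S a b h k : weakly_convex_on S a h ->
  weakly_convex_on S b k -> weakly_convex_on S (a + b) (fun x => h x + k x).
Proof.
move=> /weakly_convexP ch /weakly_convexP ck; apply/weakly_convexP => t x y t0 t1 Sx Sy.
have := ch t x y t0 t1 Sx Sy; have := ck t x y t0 t1 Sx Sy.
set Z := enorm _ ^+ 2; lra.
Qed.

Lemma weakly_convex_sqr S c x :
  weakly_convex_on S (- (2 * c)) (fun y => c * enorm (y - x) ^+ 2).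
Proof.
apply/weakly_convexP => t y z t0 t1 _ _.
have -> : t *: y + (1 - t) *: z - x = t *: (y - x) + (1 - t) *: (z - x).
  by rewrite !scalerBr addrACA -opprD -scalerDl [t + _]addrC subrK scale1r.
rewrite enorm_sqr_conv (_ : y - x - (z - x) = y - z); last first.
  by rewrite opprB addrA subrK.
by set X := enorm _ ^+ 2; set Y := enorm _ ^+ 2; set Z := enorm _ ^+ 2; lra.
Qed.

Lemma weakly_convex_sub S D a h : S `<=` D ->
  weakly_convex_on D a h -> weakly_convex_on S a h.
Proof.
move=> SD /weakly_convexP ch; apply/weakly_convexP => t x y t0 t1 Sx Sy.
by apply: ch => //; exact: SD.
Qed.

Lemma convex_unit_ball : convex_set (M := V) unit_ball.
Proof.
apply/convex_setP => t x y t0 t1 x1 y1; rewrite /unit_ball/=.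
apply: le_trans (enorm_conv _ _ t0 t1) _.
by move: x1 y1; rewrite /unit_ball/= => x1 y1; nra.
Qed.

(* Removes the interpolation parameter after division by it. *)
Lemma le_of_forall_onem (a b : R) :
  (forall t, 0 < t -> t < 1 -> (1 - t) * b <= a) -> b <= a.
Proof.
move=> H; apply/ler_addgt0Pr => e e0.
have [b0|b0] := leP b 0.
  have /H : (0 : R) < 1 / 2 by lra.
  by move=> /(_ ltac:(lra)); lra.
pose t := Num.min (1 / 2) (e / b).
have t0 : 0 < t by rewrite lt_min; apply/andP; split; [lra|rewrite divr_gt0].
have t1 : t <= 1 / 2 by rewrite ge_min lexx.
have tb : t * b <= e by rewrite -ler_pdivlMr// ge_min lexx orbT.
by have := H t t0 ltac:(lra); lra.
Qed.

(** A strongly convex function grows quadratically away from its minimizer: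
    divide the inequality along the segment by its parameter, let it tend to 0. *)
Lemma argmin_growth D m H z y : convex_set (M := V) D ->
  weakly_convex_on D (- m) H -> argmin D H z -> D y ->
  H z + m / 2 * enorm (y - z) ^+ 2 <= H y.
Proof.
move=> /convex_setP cD /weakly_convexP cH [Dz zmin] Dy.
rewrite -lerBrDl; apply: le_of_forall_onem => t t0 t1.
have := cH t y z (ltW t0) (ltW t1) Dy Dz.
have := zmin _ (cD t y z (ltW t0) (ltW t1) Dy Dz).
move=> le1 le2; have := le_trans le1 le2; set E := enorm _ ^+ 2 => le3.
rewrite -(ler_pM2l t0); lra.
Qed.

Lemma min_on_argmin D H z : argmin D H z -> min_on D H = H z.
Proof.
move=> [Dz zmin]; apply/eqP; rewrite eq_le; apply/andP; split.
  apply: ge_inf; last by exists z.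
  by exists (H z) => _ [y Dy <-]; exact: zmin.
by apply: lb_le_inf; [exists (H z), z|move=> _ [y Dy <-]; exact: zmin].
Qed.

Lemma argmin_exists D H : compact D -> D !=set0 ->
  (forall x, D x -> {for x, continuous H}) -> argmin D H !=set0.
Proof.
move=> cD D0 ctH.
have [|c /set_mem Dc cmin] := @compact_EVT_min V R H D D0 cD.
  by apply: continuous_in_subspaceT => x /set_mem; exact: ctH.
by exists c; split=> // y Dy; exact/cmin/mem_set.
Qed.

End Convexity.

(** * Proximal points and Moreau envelopes *)

Section Prox.
Context {R : realType} {d : nat}.
Local Notation V := 'rV[R]_d.
(** The standing assumptions under which minimizing [h + c |. - x|^2] over [D] is
    a well-posed strongly convex problem, of modulus [2 c - a], for every [x]. *)
Record prox_problem (D : set V) (h : V -> R) (a c : R) : Prop := ProxProblem {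
  prox_convex_set : convex_set (M := V) D;
  prox_compact : compact D;
  prox_nonempty : D !=set0;
  prox_weakly_convex : weakly_convex_on D a h;
  prox_continuous : forall x, D x -> {for x, continuous h};
  prox_coef_ge0 : 0 <= c;
  prox_coef_gt : a < 2 * c
}.

Variables (D : set V) (h : V -> R) (a c : R).
Hypothesis pp : prox_problem D h a c.

Definition prox_obj (x y : V) : R := h y + c * enorm (y - x) ^+ 2.

Lemma prox_obj_weakly_convex x : weakly_convex_on D (- (2 * c - a)) (prox_obj x).
Proof.
rewrite opprB; apply: weakly_convexD; first exact: prox_weakly_convex pp.
exact: weakly_convex_sqr.
Qed.

Lemma prox_growth x y z : argmin D (prox_obj x) z -> D y ->
  prox_obj x z + (2 * c - a) / 2 * enorm (y - z) ^+ 2 <= prox_obj x y.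
Proof.
by apply: argmin_growth; [exact: prox_convex_set pp|exact: prox_obj_weakly_convex].
Qed.

Lemma prox_exists x : argmin D (prox_obj x) !=set0.
Proof.
apply: argmin_exists; [exact: prox_compact pp|exact: prox_nonempty pp|move=> y Dy].
apply: (@continuousD R R^o V); first exact: prox_continuous pp _ Dy.
apply: (@continuousM R V); first exact: cst_continuous.
rewrite /continuous_at; apply: (@cvg_comp _ _ _ _ (fun r : R => r ^+ 2)).
  exact: continuous_enormB.
exact: exprn_continuous.
Qed.

Definition prox x : V := xget 0 (argmin D (prox_obj x)).

Lemma proxP x : argmin D (prox_obj x) (prox x).
Proof. by have [z /= zP] := prox_exists x; rewrite /prox; case: xgetP => [? _ //|/(_ z)]. Qed.

Lemma prox_in x : D (prox x).
Proof. by have [] := proxP x. Qed.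

(** The two growth inequalities at the two proximal points, each tested at the
    other point, add up to a bound in which only a scalar product survives. *)
Lemma prox_lipschitz_argmin x x' z z' :
  argmin D (prox_obj x) z -> argmin D (prox_obj x') z' ->
  (2 * c - a) * enorm (z - z') <= 2 * c * enorm (x - x').
Proof.
move=> zP z'P.
have := prox_growth zP (proj1 z'P); have := prox_growth z'P (proj1 zP).
rewrite (enormBC z' z) /prox_obj.
set E := enorm (z - z').
have -> : enorm (z - x') ^+ 2 = enorm (z' - x') ^+ 2 - enorm (z' - x) ^+ 2
    + enorm (z - x) ^+ 2 + 2 * dot (z - z') (x - x').
  rewrite !enorm_sqrB !dotE; ring.
move=> le1 le2.
have le3 : (2 * c - a) * E ^+ 2 <= 2 * c * dot (z - z') (x - x') by lra.
have [E0|E0] := eqVneq E 0.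
  rewrite E0 mulr0; apply: mulr_ge0; last exact: enorm_ge0.
  by rewrite mulr_ge0// (prox_coef_ge0 pp).
have {}E0 : 0 < E by rewrite lt_def E0 /E enorm_ge0.
rewrite -(ler_pM2r E0) -[leLHS]mulrA -expr2 (le_trans le3)//.
rewrite -[leRHS]mulrA [_ * E]mulrC; apply: ler_wpM2l; last exact: dot_le_enorm.
by rewrite mulr_ge0// (prox_coef_ge0 pp).
Qed.

Lemma prox_lipschitz x x' :
  (2 * c - a) * enorm (prox x - prox x') <= 2 * c * enorm (x - x').
Proof. exact: prox_lipschitz_argmin (proxP x) (proxP x'). Qed.

Lemma prox_unique x z : argmin D (prox_obj x) z -> z = prox x.
Proof.
move=> zP; have := prox_lipschitz_argmin zP (proxP x).
rewrite subrr enorm0 mulr0 pmulr_rle0 ?subr_gt0 ?(prox_coef_gt pp)// => le0.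
by apply/eqP; rewrite -subr_eq0; apply/eqP/enorm_eq0/le_anti; rewrite le0 enorm_ge0.
Qed.

Lemma argmin_prox_obj x : argmin D (prox_obj x) = [set prox x].
Proof.
by apply/seteqP; split=> [z /prox_unique//|z ->]; exact: proxP.
Qed.

Lemma prox_is_continuous : continuous prox.
Proof.
move=> x; have ca : 0 < 2 * c - a by rewrite subr_gt0 (prox_coef_gt pp).
pose L := 2 * c / (2 * c - a).
have L0 : 0 <= L.
  by apply: divr_ge0; [apply: mulr_ge0 => //; exact: prox_coef_ge0 pp|exact: ltW].
have L1 : 0 < L + 1 by rewrite ltr_wpDl.
move=> A /nbhs_enorm[e e0 eA]; apply/nbhs_enorm.
exists (e / (L + 1)); first by rewrite divr_gt0.
move=> y; rewrite ltr_pdivlMr// => ye; apply: eA; apply: le_lt_trans ye.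
apply: (@le_trans _ _ (L * enorm (y - x))).
  by rewrite mulrAC ler_pdivlMr// mulrC; exact: prox_lipschitz.
by rewrite mulrC; apply: ler_wpM2l; [exact: enorm_ge0|lra].
Qed.

End Prox.

(** ** Differentiability from a quadratic remainder *)

Section Gradient.
Context {R : realType} {d : nat}.
Local Notation V := 'rV[R]_d.
Implicit Types (x y v : V).

Definition dotl v : V -> R^o := dot v.

Lemma dotl_is_linear v : linear (dotl v).
Proof. by move=> k x y; rewrite /dotl !dotE. Qed.

HB.instance Definition _ v :=
  GRing.isLinear.Build R V R^o _ (dotl v) (dotl_is_linear v).

Lemma diff_dot_grad (F : V -> R) x v : differentiable (F : V -> R^o) x ->
  'd (F : V -> R^o) x v = dot (grad F x) v.
Proof.
move=> dF; rewrite [in LHS](row_sum_delta v) linear_sum.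
apply: eq_bigr => i _; rewrite linearZ /= mulrC; congr (_ * _).
by rewrite mxE deriveE.
Qed.

Lemma dot_grad_inj v v' : (forall u, dot v u = dot v' u) -> v = v' :> V.
Proof. by move=> vv'; apply/rowP => i; rewrite -!dot_delta vv'. Qed.

Lemma quadratic_remainder_differentiable (F : V -> R) x v (M : R) :
  (forall y, `|F y - F x - dot v (y - x)| <= M * enorm (y - x) ^+ 2) ->
  differentiable (F : V -> R^o) x /\ grad F x = v.
Proof.
move=> HF.
have ctl : continuous (dotl v) by exact: continuous_dot.
have Fo : (F : V -> R^o) \o shift x = cst (F x : R^o) + dotl v +o_ (0 : V) id.
  apply/eqaddoP => e e0.
  have M1 : 0 < `|M| + 1 by rewrite ltr_wpDl.
  pose D1 : R := d.+1%:R.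
  have D10 : 0 < D1 by rewrite ltr0n.
  apply/(@nbhs_normP R V); exists (e / ((`|M| + 1) * (D1 * D1))).
    by rewrite /= divr_gt0// !mulr_gt0.
  move=> y /=; rewrite sub0r normrN ltr_pdivlMr ?mulr_gt0// => ye.
  have := HF (y + x); rewrite addrK => HFy.
  rewrite !fctE /= opprD addrA.
  apply: le_trans HFy _.
  have yn := enorm_le_mx_norm y; rewrite -/D1 in yn.
  have := enorm_ge0 y; have := normr_ge0 y; have := ler_norm M.
  set N := `|y| in yn ye *; set E := enorm y in yn *; move=> hM hN hE.
  have hE2 : E ^+ 2 <= (D1 * N) ^+ 2 by rewrite ler_pXn2r ?nnegrE// mulr_ge0// ltW.
  apply: (@le_trans _ _ ((`|M| + 1) * (D1 * N) ^+ 2)).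
    apply: (@le_trans _ _ ((`|M| + 1) * E ^+ 2)).
      by apply: ler_wpM2r; [exact: sqr_ge0|lra].
    by apply: ler_wpM2l; [lra|].
  rewrite exprMn !expr2 !mulrA ler_wpM2r//.
  by move: ye; rewrite !mulrA; lra.
have dFv := diff_unique ctl Fo.
have dF : differentiable (F : V -> R^o) x.
  by apply/diff_locallyP; rewrite dFv.
split=> //; apply: dot_grad_inj => u.
by rewrite -diff_dot_grad// dFv.
Qed.

End Gradient.

Section Envelope.
Context {R : realType} {d : nat}.
Local Notation V := 'rV[R]_d.
Variables (D : set V) (h : V -> R) (a c : R).
Hypothesis pp : prox_problem D h a c.

Let P := prox D h c.
Let env x := min_on D (prox_obj h c x).

Lemma envelopeE x : env x = h (P x) + c * enorm (P x - x) ^+ 2.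
Proof. by rewrite /env (min_on_argmin (proxP pp x)). Qed.

(** Testing the proximal point of [x] in the problem at [y], and conversely,
    sandwiches the increment of the envelope between two affine functions whose
    slopes differ by a Lipschitz term. *)
Lemma envelope_differentiable x :
  differentiable (env : V -> R^o) x /\ grad env x = (2 * c) *: (x - P x).
Proof.
have ca : 0 < 2 * c - a by rewrite subr_gt0 (prox_coef_gt pp).
pose L := 2 * c / (2 * c - a).
apply: (@quadratic_remainder_differentiable _ _ _ _ _ (c + 2 * c * L)) => y.
have Px := proxP pp x; have Py := proxP pp y.
have c_ge0 := prox_coef_ge0 pp.
have up := proj2 Py _ (proj1 Px); have lo := proj2 Px _ (proj1 Py).
rewrite !envelopeE; rewrite /prox_obj -/P in up lo.
have lip : enorm (P y - P x) <= L * enorm (y - x).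
  by rewrite mulrAC ler_pdivlMr// mulrC; exact: prox_lipschitz pp _ _.
move: (P x) (P y) up lo lip {Px Py} => p q up lo lip.
have := normr_dot_le (q - p) (y - x).
have := ler_wpM2r (enorm_ge0 (y - x)) lip.
rewrite -[L * _ * _]mulrA -expr2.
have eqx : enorm (p - y) ^+ 2 = enorm (p - x) ^+ 2 + enorm (y - x) ^+ 2
   + 2 * dot (x - p) (y - x).
  rewrite !enorm_sqrB !enorm_sqr !dotE (dotC y x); ring.
have eqy : enorm (q - x) ^+ 2 = enorm (q - y) ^+ 2 - enorm (y - x) ^+ 2
   - 2 * dot (x - q) (y - x).
  rewrite !enorm_sqrB !enorm_sqr !dotE (dotC y x); ring.
have eqd : dot (x - q) (y - x) = dot (x - p) (y - x) - dot (q - p) (y - x).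
  by rewrite -dotNl -dotDl opprB subrKA.
rewrite dotZl; rewrite {}eqd in eqy; rewrite eqx in up; rewrite eqy in lo.
move: up lo; set E := enorm (y - x) ^+ 2; set dd := dot (q - p) _.
set e := dot _ _; set A := enorm _ ^+ 2; set B := enorm _ ^+ 2.
set LE := enorm _ * _.
move=> up lo h1 h2; have {h2} h3 := le_trans h2 h1.
have E0 : 0 <= E by exact: sqr_ge0.
have := ler_wpM2l c_ge0 h3; have := mulr_ge0 c_ge0 E0.
move: h3; rewrite ler_norml => /andP[h3 h4].
have := ler_wpM2l c_ge0 h4; have := ler_wpM2l c_ge0 h3.
by move=> h5 h6 h7 h8; rewrite ler_norml; apply/andP; split; lra.
Qed.

End Envelope.

(** * Subgradients *)

Section Subgradient.
Context {R : realType} {d : nat}.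
Local Notation V := 'rV[R]_d.
Implicit Types (U : set V) (f h : V -> R) (x y z u v w : V) (a e t : R).

Lemma cvg_enorm_sqr (xs : nat -> V) x :
  xs @ \oo --> x -> enorm (xs k) ^+ 2 @[k --> \oo] --> enorm x ^+ 2.
Proof.
move=> cx.
have ce : enorm (xs k) @[k --> \oo] --> enorm x.
  by apply: continuous_cvg => //; exact: continuous_enorm.
rewrite expr2; under eq_fun do rewrite expr2.
exact: cvgM.
Qed.

Lemma cvg_dot (xs ys : nat -> V) x y :
  xs @ \oo --> x -> ys @ \oo --> y -> dot (xs k) (ys k) @[k --> \oo] --> dot x y.
Proof.
move=> cx cy.
have polar u v : dot u v = (enorm (u + v) ^+ 2 - enorm (u - v) ^+ 2) / 4.
  by rewrite enorm_sqrD enorm_sqrB; field.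
under eq_fun do rewrite polar.
rewrite polar.
apply: cvgMr_tmp; apply: cvgB; apply: cvg_enorm_sqr; [exact: cvgD|exact: cvgB].
Qed.

(** Along the segment from [x] to [y], the local minorant given by the
    subgradient is compared with the chord; dividing by the parameter and letting
    it vanish makes the local minorant global. *)
Lemma frechet_subdiff_minorant U f a x y v : weakly_convex_on U a f ->
  U x -> U y -> frechet_subdiff f x v ->
  f x + dot v (y - x) - a / 2 * enorm (y - x) ^+ 2 <= f y.
Proof.
move=> /weakly_convexP cf Ux Uy fv.
set N := enorm (y - x); have N0 : 0 <= N by exact: enorm_ge0.
apply/ler_addgt0Pr => e' e'0.
pose e := e' / (N + 1).
have e0 : 0 < e by rewrite divr_gt0// ltr_wpDl.
have eN : e * N + e = e' by rewrite -[X in _ + X]mulr1 -mulrDr divfK// gt_eqF// ltr_wpDl.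
have /nbhs_enorm[r r0 fr] := fv e e0.
pose t := Num.min (1 / 2) (Num.min (r / (N + 1)) (e / (`|a| * N ^+ 2 + 1))).
have aN : 0 < `|a| * N ^+ 2 + 1 by rewrite ltr_wpDl// mulr_ge0// sqr_ge0.
have t0 : 0 < t by rewrite !lt_min !divr_gt0// ltr_wpDl.
have t2 : t <= 1 / 2 by rewrite ge_min lexx.
have tr : t * (N + 1) <= r.
  by rewrite -ler_pdivlMr ?ltr_wpDl// !ge_min lexx orbT.
have te : t * (`|a| * N ^+ 2 + 1) <= e.
  by rewrite -ler_pdivlMr// !ge_min lexx !orbT.
have segE : t *: y + (1 - t) *: x = x + t *: (y - x).
  by rewrite scalerBl scale1r scalerBr addrCA.
have := fr (t *: y + (1 - t) *: x).
rewrite segE [x + _]addrC addrK enormZ (gtr0_norm t0) -/N dotZr => /(_ _) H.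
have {}H := H ltac:(lra).
have := cf t y x (ltW t0) ltac:(lra) Uy Ux; rewrite segE [x + _]addrC -/N => H2.
have aabs : a * N ^+ 2 <= `|a| * N ^+ 2 by rewrite ler_wpM2r ?sqr_ge0// ler_norm.
have aabs' : - (a * N ^+ 2) <= `|a| * N ^+ 2.
  by rewrite -mulNr ler_wpM2r ?sqr_ge0// -normrN ler_norm.
have {H2}H := le_trans H H2.
have {}H : t * (dot v (y - x) - e * N + f x) <= t * (f y + a / 2 * (1 - t) * N ^+ 2) by lra.
rewrite ler_pM2l// in H.
have ta : - (t * (a * N ^+ 2)) <= e.
  have := ler_wpM2l (ltW t0) aabs'; lra.
move: H ta; set A := a * N ^+ 2; rewrite (_ : a / 2 * (1 - t) * N ^+ 2 = A / 2 - t * A / 2); last by rewrite /A; field.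
rewrite (_ : a / 2 * N ^+ 2 = A / 2); last by rewrite /A; field.
lra.
Qed.

Lemma limiting_subdiff_minorant U f a x y v : open U -> weakly_convex_on U a f ->
  U x -> U y -> limiting_subdiff f x v ->
  f x + dot v (y - x) - a / 2 * enorm (y - x) ^+ 2 <= f y.
Proof.
move=> oU cf Ux Uy [xs [vs [fv cx cfx cv]]].
have cyx : (y - xs k) @[k --> \oo] --> y - x by apply: cvgB => //; exact: cvg_cst.
have cl : f (xs k) + dot (vs k) (y - xs k) - a / 2 * enorm (y - xs k) ^+ 2
    @[k --> \oo] --> f x + dot v (y - x) - a / 2 * enorm (y - x) ^+ 2.
  apply: cvgB; first by apply: cvgD => //; exact: cvg_dot.
  by apply: cvgMl_tmp; exact: cvg_enorm_sqr.
apply: (cvgr_to_le cl).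
have : \forall k \near \oo, U (xs k) by apply: cx; exact: open_nbhs_nbhs.
apply: filterS => k Uk; exact: frechet_subdiff_minorant (fv k).
Qed.

Lemma differentiable_linear_approx f x e : differentiable (f : V -> R^o) x -> 0 < e ->
  \forall y \near x, `|f y - f x - dot (grad f x) (y - x)| <= e * enorm (y - x).
Proof.
move=> df e0; have /diff_locally/eqaddoP/(_ e e0) := df.
move=> /(@nbhs_normP R V)[r /= r0 fr].
apply/(@nbhs_normP R V); exists r => //= y yx.
have := fr (y - x); rewrite /= sub0r normrN -normrN opprB => /(_ yx).
rewrite !fctE /= subrK diff_dot_grad// opprD addrA => le1.
by apply: le_trans le1 _; rewrite ler_pM2l// -normrN opprB mx_norm_le_enorm.
Qed.

Lemma grad_frechet_subdiff f x : differentiable (f : V -> R^o) x ->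
  frechet_subdiff f x (grad f x).
Proof.
move=> df e e0; apply: filterS (differentiable_linear_approx df e0) => y.
by rewrite ler_norml => /andP[H _]; lra.
Qed.

Lemma convex_grad_minorant U f x y : convex_function (E := V) U f ->
  U x -> U y -> differentiable (f : V -> R^o) x ->
  f x + dot (grad f x) (y - x) <= f y.
Proof.
move=> /convex_weakly_convex0 cf Ux Uy /grad_frechet_subdiff fv.
by have := frechet_subdiff_minorant cf Ux Uy fv; rewrite !mul0r subr0.
Qed.

(** A Lipschitz bound is tested along the direction of the subgradient. *)
Lemma frechet_subdiff_norm_le U f (L : R) x v : open U -> 0 <= L ->
  elipschitz_on U L f -> U x -> frechet_subdiff f x v -> enorm v <= L.
Proof.
move=> oU L0 lf Ux fv; apply/ler_addgt0Pr => e e0.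
have [->|/enorm_gt0 v0] := eqVneq v 0; first by rewrite enorm0 addr_ge0// ltW.
have : \forall y \near x, U y /\ f x + dot v (y - x) - e * enorm (y - x) <= f y.
  near=> y; split; near: y; first by apply: open_nbhs_nbhs.
  exact: fv.
move=> /nbhs_enorm[r r0 rU].
pose t := r / 2 / enorm v.
have t0 : 0 < t by rewrite !divr_gt0.
have tv : t * enorm v = r / 2 by rewrite /t divfK// gt_eqF.
have := rU (t *: v + x); rewrite addrK enormZ (gtr0_norm t0) tv => /(_ ltac:(lra)).
rewrite dotZr -enorm_sqr => -[Uy H].
have := lf _ _ Uy Ux; rewrite addrK enormZ (gtr0_norm t0) tv ler_norml => /andP[_ H2].
have H3 : t * enorm v ^+ 2 <= (L + e) * (t * enorm v) by rewrite tv; lra.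
rewrite -(ler_pM2l t0) -(ler_pM2r v0); move: H3; rewrite expr2; lra.
Unshelve. all: by end_near. Qed.

Lemma limiting_subdiff_norm_le U f (L : R) x v : open U -> 0 <= L ->
  elipschitz_on U L f -> U x -> limiting_subdiff f x v -> enorm v <= L.
Proof.
move=> oU L0 lf Ux [xs [vs [fv cx _ cv]]].
have ce : enorm (vs k) @[k --> \oo] --> enorm v.
  by apply: continuous_cvg => //; exact: continuous_enorm.
apply: (cvgr_to_le ce).
have : \forall k \near \oo, U (xs k) by apply: cx; exact: open_nbhs_nbhs.
by apply: filterS => k Uk; exact: frechet_subdiff_norm_le oU L0 lf Uk (fv k).
Qed.

End Subgradient.

(** * Euclidean projections *)

Section Projection.
Context {R : realType} {d : nat}.
Local Notation V := 'rV[R]_d.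
Implicit Types (D : set V) (x y z u : V).

Definition proj_problem D := prox_problem D (fun=> 0 : R) 0 1.

Lemma proj_problemP D : convex_set (M := V) D -> compact D -> D !=set0 ->
  proj_problem D.
Proof.
move=> cD kD D0; split=> //.
- by apply/weakly_convexP => *; rewrite !mulr0 !mul0r !addr0.
- by move=> x _; exact: cst_continuous.
Qed.

Lemma proj_setE D x : proj_set D x = argmin D (prox_obj (fun=> 0) 1 x).
Proof.
rewrite /proj_set /argmin /prox_obj; apply/seteqP; split=> y /= [Dy H]; split=> // z Dz.
  by rewrite !add0r !mul1r ler_pXn2r ?nnegrE ?enorm_ge0//; exact: H.
by have := H z Dz; rewrite !add0r !mul1r ler_pXn2r ?nnegrE ?enorm_ge0.
Qed.

Lemma proj_nonexpansive D x x' y y' : proj_problem D ->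
  proj_set D x y -> proj_set D x' y' -> enorm (y - y') <= enorm (x - x').
Proof.
move=> pD; rewrite !proj_setE => yP y'P.
have := prox_lipschitz_argmin pD yP y'P; lra.
Qed.

Lemma proj_fixed D x y : proj_set D x y -> D x -> y = x.
Proof.
move=> [_ ymin] Dx; apply/eqP; rewrite -subr_eq0; apply/eqP/enorm_eq0/le_anti.
by rewrite enorm_ge0 andbT -[leRHS](@enorm0 R d) -(subrr x) ymin.
Qed.

Lemma proj_in_fixed D x : D x -> proj_set D x x.
Proof. by move=> Dx; split=> // y Dy; rewrite subrr enorm0 enorm_ge0. Qed.

Lemma proj_variational D x y u : proj_problem D ->
  proj_set D x y -> D u -> dot (x - y) (u - y) <= 0.
Proof.
move=> pD; rewrite proj_setE => yP Du; have := prox_growth pD yP Du.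
rewrite /prox_obj (_ : u - x = (y - x) + (u - y)); last by rewrite [RHS]addrC subrKA.
by rewrite (enorm_sqrD (y - x)) -(opprB x y) dotNl enormN; lra.
Qed.

Lemma ball_proj_problem : proj_problem (@unit_ball R d).
Proof.
apply: proj_problemP; first exact: convex_unit_ball.
  exact: compact_unit_ball.
by exists 0; exact: unit_ball0.
Qed.

Lemma proj_ballE x : proj_ball x = prox unit_ball (fun=> 0) 1 x.
Proof. by rewrite /proj_ball proj_setE. Qed.

Lemma proj_ballP x : proj_set unit_ball x (proj_ball x).
Proof. by rewrite proj_setE proj_ballE; exact: proxP ball_proj_problem x. Qed.

Lemma proj_ball_in x : unit_ball (proj_ball x).
Proof. by have [] := proj_ballP x. Qed.

End Projection.

(** * The softplus penalty *)

Section Softplus.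
Context {R : realType}.
Implicit Types (lam gam u v a b t : R).

Definition sigmoid t : R := expR t / (1 + expR t).

Lemma onep_expR_gt0 t : 0 < 1 + expR t :> R.
Proof. by rewrite ltr_wpDr ?expR_ge0. Qed.

Lemma sigmoid_ge0 t : 0 <= sigmoid t.
Proof. by rewrite divr_ge0 ?expR_ge0 ?ltW ?onep_expR_gt0. Qed.

Lemma sigmoid_le1 t : sigmoid t <= 1.
Proof. by rewrite ler_pdivrMr ?onep_expR_gt0// mul1r lerDr. Qed.

(** The ratio of the two arguments is an average of exponentials, and each of
    them lies above the tangent of the exponential at the averaged exponent. *)
Lemma ln_onep_expR_tangent a b :
  ln (1 + expR b) + sigmoid b * (a - b) <= ln (1 + expR a).
Proof.
set s := sigmoid b; set m := s * (a - b).
have s1 : 1 - s = (1 + expR b)^-1.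
  by rewrite /s /sigmoid; field; exact: lt0r_neq0 (onep_expR_gt0 b).
suff H : (1 + expR b) * expR m <= 1 + expR a.
  rewrite -ler_expR expRD !lnK ?posrE ?onep_expR_gt0//.
have key : 1 <= (1 - s) * expR (- m) + s * expR (a - b - m).
  have h1 := expR_ge1Dx (- m); have h2 := expR_ge1Dx (a - b - m).
  have s0 := sigmoid_ge0 b; have s2 := sigmoid_le1 b; rewrite -/s in s0 s2.
  have h3 := ler_wpM2l s0 h2; have h4 : (1 - s) * (1 - m) <= (1 - s) * expR (- m).
    by apply: ler_wpM2l => //; lra.
  by apply: le_trans (lerD h4 h3); rewrite /m; lra.
have e0 := expR_gt0 m.
have := ler_wpM2r (ltW e0) key; rewrite mul1r mulrDl -!mulrA -!expRD addNr expR0 mulr1 subrK.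
move=> H; rewrite mulrC -ler_pdivlMr ?onep_expR_gt0//.
apply: le_trans H _; rewrite s1 /s /sigmoid expRB.
have be0 := expR_gt0 b; have b1 := onep_expR_gt0 b.
by rewrite le_eqVlt; apply/orP; left; apply/eqP; field; rewrite !lt0r_neq0.
Qed.

Lemma softplus_is_derive lam gam u : 0 < gam ->
  is_derive u 1 (softplus lam gam) (lam * sigmoid (lam * u / gam)).
Proof.
move=> g0; have P0 := onep_expR_gt0 (lam * u / gam).
have d1 : is_derive u (1 : R) (fun r : R => lam * r / gam) (lam / gam).
  have -> : (fun r : R => lam * r / gam) = (lam / gam) \*o id.
    by apply/funext => r; rewrite /= mulrAC.
  by apply: is_derive_eq; rewrite scaler1.
have d2 : is_derive u (1 : R) (fun r : R => 1 + expR (lam * r / gam))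
    (expR (lam * u / gam) * (lam / gam)).
  have d3 : is_derive u (1 : R) (expR \o (fun r : R => lam * r / gam))
    (expR (lam * u / gam) * (lam / gam)).
    exact: is_derive1_comp.
  by apply: is_derive_eq; rewrite /= add0r mul1r.
have d3' : is_derive u (1 : R) (fun r : R => ln (1 + expR (lam * r / gam)))
    ((expR (lam * u / gam) * (lam / gam)) * (1 + expR (lam * u / gam))^-1).
  have := is_derive1_ln P0 => d4.
  by rewrite mulrC; exact: (@is_derive1_comp R (@ln R) (fun r : R => 1 + expR (lam * r / gam))).
rewrite (_ : softplus lam gam = gam \*o (fun r : R => ln (1 + expR (lam * r / gam))))//.
apply: is_derive_eq; rewrite /sigmoid.
rewrite /GRing.scale/=; field; rewrite !lt0r_neq0//.
Qed.

Lemma softplus_tangent lam gam u v : 0 < gam ->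
  softplus lam gam v + lam * sigmoid (lam * v / gam) * (u - v) <= softplus lam gam u.
Proof.
move=> g0; have := ln_onep_expR_tangent (lam * u / gam) (lam * v / gam).
move=> /(ler_wpM2l (ltW g0)); rewrite mulrDr; apply: le_trans.
rewrite lerD2l le_eqVlt; apply/orP; left; apply/eqP.
rewrite (_ : lam * u / gam - lam * v / gam = lam * (u - v) / gam); last by field; rewrite lt0r_neq0.
by field; rewrite lt0r_neq0.
Qed.

Lemma softplus_ge lam gam u : 0 < gam -> 0 <= lam ->
  lam * Num.max 0 u <= softplus lam gam u.
Proof.
move=> g0 l0; rewrite /softplus.
have [u0|u0] := leP 0 u.
  rewrite -ler_pdivrMl// mulrC -[leLHS]expRK ler_ln ?posrE ?expR_gt0 ?onep_expR_gt0//.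
  by rewrite lerDr.
by rewrite mulr0 mulr_ge0// ?ltW// ln_gt0// ltrDl expR_gt0.
Qed.

Lemma softplus_le lam gam u : 0 < gam -> 0 <= lam ->
  softplus lam gam u <= lam * Num.max 0 u + gam * ln 2.
Proof.
move=> g0 l0; rewrite /softplus; set m := Num.max 0 u.
have m0 : 0 <= m by rewrite le_max lexx.
have um : u <= m by rewrite le_max lexx orbT.
have e1 : 1 <= expR (lam * m / gam).
  by rewrite -expR0 ler_expR divr_ge0 ?mulr_ge0// ltW.
have e2 : expR (lam * u / gam) <= expR (lam * m / gam).
  by rewrite ler_expR ler_pM2r ?invr_gt0// ler_wpM2l.
have e3 : 1 + expR (lam * u / gam) <= 2 * expR (lam * m / gam) by lra.
have : ln (1 + expR (lam * u / gam)) <= ln (2 * expR (lam * m / gam)).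
  by rewrite ler_ln ?posrE ?onep_expR_gt0 ?mulr_gt0 ?expR_gt0.
rewrite lnM ?posrE ?expR_gt0// expRK => /(ler_wpM2l (ltW g0)) /le_trans; apply.
by rewrite mulrDr addrC lerD2r le_eqVlt; apply/orP; left; apply/eqP; field; rewrite lt0r_neq0.
Qed.

End Softplus.

(** * The penalized problem *)

Section Penalty.
Context {R : realType} {d : nat}.
Local Notation V := 'rV[R]_d.

(** The deterministic part of the assumptions on the problem. *)
Record constrained_problem (f g : V -> R) (U : set V) (l Gf Gg sigma : R) : Prop :=
  ConstrainedProblem {
  cp_nonempty : [set x | g x <= 0] !=set0;
  cp_closed : closed [set x | g x <= 0];
  cp_sub_ball : [set x | g x <= 0] `<=` unit_ball;
  cp_open : open U;
  cp_convex : convex_set (M := V) U;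
  cp_ball_sub : unit_ball `<=` U;
  cp_l : 0 < l;
  cp_Gf : 0 < Gf;
  cp_f_weakly_convex : weakly_convex_on U l f;
  cp_f_lipschitz : elipschitz_on U Gf f;
  cp_Gg : 0 < Gg;
  cp_sigma : 0 < sigma;
  cp_g_convex : convex_function (E := V) U g;
  cp_g_C1 : C1_on U g;
  cp_grad_le : forall x, unit_ball x -> enorm (grad g x) <= Gg;
  cp_grad_ge : forall z, unit_ball z -> g z = 0 -> sigma <= enorm (grad g z)
}.

Variables (f g : V -> R) (U : set V) (l Gf Gg sigma : R).
Hypothesis cp : constrained_problem f g U l Gf Gg sigma.
Implicit Types (x y z u v w : V) (lam gam : R).

Let C : set V := [set x | g x <= 0].

Lemma sublevel_subU : C `<=` U.
Proof. by move=> x /(cp_sub_ball cp); exact: cp_ball_sub cp x. Qed.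

Lemma f_continuous x : U x -> {for x, continuous f}.
Proof.
move=> Ux; apply: (@continuous_enorm_lip _ _ _ Gf).
have : \forall y \near x, U y by apply: open_nbhs_nbhs; split=> //; exact: cp_open cp.
by apply: filterS => y Uy; exact: cp_f_lipschitz cp _ _ Uy Ux.
Qed.

Lemma g_differentiable x : U x -> differentiable (g : V -> R^o) x.
Proof. by move=> /(cp_g_C1 cp)[]. Qed.

Lemma g_continuous x : U x -> {for x, continuous g}.
Proof. by move=> /g_differentiable/(@differentiable_continuous R V R^o). Qed.

Lemma sublevel_convex : convex_set (M := V) C.
Proof.
apply/convex_setP => t x y t0 t1 Cx Cy.
have /convex_functionP cg := cp_g_convex cp.
have := cg t x y t0 t1 (sublevel_subU Cx) (sublevel_subU Cy).
by move: Cx Cy; rewrite /C/= => Cx Cy; nra.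
Qed.

Lemma sublevel_compact : compact C.
Proof. exact: compact_enorm_closed (cp_closed cp) (cp_sub_ball cp). Qed.

Lemma sublevel_proj_problem : proj_problem C.
Proof. exact: proj_problemP sublevel_convex sublevel_compact (cp_nonempty cp). Qed.

Lemma stationarity_prox_problem : prox_problem C f l l.
Proof.
have l0 := cp_l cp; split; try lra.
- exact: sublevel_convex.
- exact: sublevel_compact.
- exact: cp_nonempty cp.
- exact: weakly_convex_sub sublevel_subU (cp_f_weakly_convex cp).
- by move=> x /sublevel_subU; exact: f_continuous.
Qed.

(** ** The error bound *)

(* Directions along which [g] decreases to first order enter the sublevel set. *)
Lemma sublevel_descent y u : C y -> g y < 0 \/ dot (grad g y) u < 0 ->
  exists2 t : R, 0 < t & C (y + t *: u).
Proof.
move=> Cy; have Uy := sublevel_subU Cy.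
suff near_segment (A : set V) : nbhs y A -> exists2 t : R, 0 < t & A (y + t *: u).
  case=> [gy|gu].
    have /near_segment[t t0 gt] : \forall z \near y, g z < 0.
      exact: (g_continuous Uy) (lt_nbhsl gy).
    by exists t => //; exact: ltW.
  pose e := - dot (grad g y) u / (enorm u + 1).
  have u1 : 0 < enorm u + 1 by rewrite ltr_wpDl ?enorm_ge0.
  have e0 : 0 < e by rewrite divr_gt0// oppr_gt0.
  have /near_segment[t t0] := differentiable_linear_approx (g_differentiable Uy) e0.
  rewrite [y + _]addrC addrK enormZ dotZr (gtr0_norm t0) ler_norml => /andP[_ H].
  exists t => //; rewrite /C/= addrC.
  have eu : e * (t * (enorm u + 1)) = t * - dot (grad g y) u.
    by rewrite /e; field; rewrite lt0r_neq0.
  have et : 0 <= e * t by rewrite mulr_ge0// ltW.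
  by move: Cy; rewrite /C/=; lra.
move=> /nbhs_enorm[r r0 rA]; exists (r / (enorm u + 1)).
  by rewrite divr_gt0// ltr_wpDl ?enorm_ge0.
apply: rA; rewrite [y + _]addrC addrK enormZ ger0_norm; last first.
  by rewrite divr_ge0 ?ltW// ltr_wpDl ?enorm_ge0.
by rewrite mulrAC ltr_pdivrMr ?ltr_wpDl ?enorm_ge0// ltr_pM2l// ltrDl.
Qed.

(** At the projection [y] of [z], the displacement [w = z - y] makes a
    nonpositive product with every direction of decrease of [g], which forces [w]
    to be a positive multiple of the gradient at [y]: otherwise
    [w / |w| - grad / |grad|] would be a direction of decrease making a positive
    product with [w]. Convexity of [g] then gives [g z >= |grad g y| |w|]. *)
Lemma error_bound z y : unit_ball z -> proj_set C z y ->
  sigma * enorm (z - y) <= Num.max 0 (g z).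
Proof.
move=> Bz Py; have [Cy _] := Py.
set w := z - y; set n := grad g y.
have [w0|/enorm_gt0 w0] := eqVneq w 0; first by rewrite w0 enorm0 mulr0 le_max lexx.
have key u : g y < 0 \/ dot n u < 0 -> dot w u <= 0.
  move=> /(sublevel_descent Cy)[t t0 Ct].
  have := proj_variational sublevel_proj_problem Py Ct.
  by rewrite [y + _]addrC addrK dotZr pmulr_rle0.
have gy : g y = 0.
  apply/eqP; rewrite eq_le Cy/= leNgt; apply/negP => gy.
  have := key w (or_introl gy); rewrite -enorm_sqr leNgt.
  by rewrite exprn_gt0.
have sn : sigma <= enorm n := cp_grad_ge cp (cp_sub_ball cp Cy) gy.
have n0 : 0 < enorm n := lt_le_trans (cp_sigma cp) sn.
have nw : enorm n * enorm w <= dot n w.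
  rewrite leNgt; apply/negP => lt.
  pose u := (enorm w)^-1 *: w - (enorm n)^-1 *: n.
  have : dot w u <= 0.
    apply: key; right; rewrite dotDr dotNr !dotZr -enorm_sqr expr2 mulKf ?gt_eqF//.
    by rewrite subr_lt0 ltr_pdivrMl// mulrC.
  rewrite leNgt => /negP; apply; rewrite dotDr dotNr !dotZr -enorm_sqr expr2 mulKf ?gt_eqF//.
  by rewrite subr_gt0 ltr_pdivrMl// (dotC w).
have Uz : U z by exact: cp_ball_sub cp z Bz.
have := convex_grad_minorant (cp_g_convex cp) (sublevel_subU Cy) Uz
  (g_differentiable (sublevel_subU Cy)).
rewrite gy add0r -/n -/w => gz.
rewrite le_max; apply/orP; right; apply: le_trans (le_trans nw gz).
by rewrite ler_wpM2r// ltW.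
Qed.

(** Exact penalization: leaving the constraint set gains at most [Gf + 4 l] per
    unit of distance, and the penalty charges more than that. *)
Lemma exact_penalty x z lam : unit_ball x -> unit_ball z ->
  Gf + 4 * l <= lam * sigma ->
  prox_obj f l x (Q C f l x) <= f z + lam * Num.max 0 (g z) + l * enorm (z - x) ^+ 2.
Proof.
move=> Bx Bz lams; have l0 := cp_l cp; have s0 := cp_sigma cp; have Gf0 := cp_Gf cp.
have lam0 : 0 <= lam by rewrite -(pmulr_lge0 _ s0); lra.
have [y] := prox_exists sublevel_proj_problem z; rewrite -proj_setE => Py.
have [Cy _] := Py.
have [_ /(_ y Cy) le1] := proxP stationarity_prox_problem x.
apply: le_trans le1 _; rewrite /prox_obj.
have eb := error_bound Bz Py.
have By := cp_sub_ball cp Cy.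
have := cp_f_lipschitz cp (sublevel_subU Cy) (cp_ball_sub cp Bz).
rewrite (enormBC y z) ler_norml => /andP[_ flip].
have e0 := enorm_ge0 (z - y).
have eqn : enorm (y - x) ^+ 2 - enorm (z - x) ^+ 2 = dot (y - z) ((y - x) + (z - x)).
  rewrite !enorm_sqr !dotE (dotC x y) (dotC z y) (dotC x z); ring.
have cs := dot_le_enorm (y - z) ((y - x) + (z - x)).
have d4 : enorm ((y - x) + (z - x)) <= 4.
  apply: le_trans (enorm_triangle _ _) _.
  have := unit_ball_diam By Bx; have := unit_ball_diam Bz Bx; lra.
rewrite (enormBC y z) in cs.
have c4 := le_trans cs (ler_wpM2l e0 d4).
have lc4 := ler_wpM2l (ltW l0) c4.
rewrite -eqn in lc4.
have h1 := ler_wpM2l lam0 eb; rewrite mulrA in h1.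
have h2 := ler_wpM2r e0 lams.
move: flip lc4 h1 h2; set e := enorm (z - y).
set A := enorm (y - x) ^+ 2; set B := enorm (z - x) ^+ 2; set m := Num.max _ _.
by move=> *; lra.
Qed.

(** ** The smoothed penalty *)

Variables (lam gam : R).
Hypotheses (lam_ge0 : 0 <= lam) (gam_gt0 : 0 < gam).
Let p := softplus lam gam.
Let dp (u : R) := lam * sigmoid (lam * u / gam).

Lemma softplus_slope_ge0 (u : R) : 0 <= dp u.
Proof. by rewrite mulr_ge0// sigmoid_ge0. Qed.

Lemma softplus_slope_le (u : R) : dp u <= lam.
Proof. by rewrite -[leRHS]mulr1 ler_wpM2l// sigmoid_le1. Qed.

Lemma grad_softplus_comp z : U z -> grad (p \o g) z = dp (g z) *: grad g z.
Proof.
move=> Uz; apply/rowP => i; rewrite !mxE.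
have dg := g_differentiable Uz.
have [dpz dpE] := softplus_is_derive lam (g z) gam_gt0.
have dpd : differentiable (p : R -> R^o) (g z) by apply/derivable1_diffP.
rewrite deriveE; last exact: (@differentiable_comp R V R^o R^o).
rewrite (@diff_comp R V R^o R^o g p)//= (diff1E dpd) derive1E dpE.
by rewrite [in RHS]deriveE// [RHS]mulrC.
Qed.

Lemma softplus_comp_minorant y z : U y -> U z ->
  p (g z) + dot (grad (p \o g) z) (y - z) <= p (g y).
Proof.
move=> Uy Uz; rewrite grad_softplus_comp// dotZl.
have h := convex_grad_minorant (cp_g_convex cp) Uz Uy (g_differentiable Uz).
have := softplus_tangent lam (g y) (g z) gam_gt0; rewrite -/p -/(dp _).
have : dp (g z) * dot (grad g z) (y - z) <= dp (g z) * (g y - g z).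
  by apply: ler_wpM2l; [exact: softplus_slope_ge0|lra].
lra.
Qed.

Lemma softplus_comp_weakly_convex : weakly_convex_on U 0 (p \o g).
Proof.
apply: convex_weakly_convex0; apply/convex_functionP => t x y t0 t1 Ux Uy.
have Uz : U (t *: x + (1 - t) *: y).
  have /convex_setP cU := cp_convex cp; exact: cU.
set z := _ + _ in Uz *.
have hx := softplus_comp_minorant Ux Uz; have hy := softplus_comp_minorant Uy Uz.
have E : t * dot (grad (p \o g) z) (x - z) + (1 - t) * dot (grad (p \o g) z) (y - z) = 0.
  by rewrite /z !dotE; ring.
have := ler_wpM2l t0 hx; have : (1 - t) * (p (g z) + dot (grad (p \o g) z) (y - z)) <= (1 - t) * p (g y).
  by apply: ler_wpM2l => //; lra.
rewrite /=; move: E; set A := dot _ _; set B := dot _ _; lra.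
Qed.

Lemma softplus_continuous : continuous p.
Proof.
move=> u; have [dpu _] := softplus_is_derive lam u gam_gt0.
by apply: (@differentiable_continuous R R R^o); apply/derivable1_diffP.
Qed.

Lemma softplus_comp_continuous x : U x -> {for x, continuous (p \o g)}.
Proof.
move=> Ux; apply: continuous_comp; first exact: g_continuous.
exact: softplus_continuous.
Qed.

Lemma sigmoid_continuous : continuous (@sigmoid R).
Proof.
move=> t; apply: continuousM; first exact: continuous_expR.
apply: continuousV; first exact: lt0r_neq0 (onep_expR_gt0 t).
by apply: continuousD; [exact: cst_continuous|exact: continuous_expR].
Qed.

Lemma grad_softplus_comp_continuous (i : 'I_d) x : U x ->
  {for x, continuous (fun z => grad (p \o g) z 0 i)}.
Proof.
move=> Ux.
have Unear : \forall z \near x, U z.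
  by apply: open_nbhs_nbhs; split=> //; exact: cp_open cp.
have E : \forall z \near x, dp (g z) * grad g z 0 i = grad (p \o g) z 0 i.
  by apply: filterS Unear => z Uz; rewrite grad_softplus_comp// [RHS]mxE.
apply: cvg_trans (near_eq_cvg E) _.
rewrite grad_softplus_comp// mxE; apply: cvgM.
  apply: cvgM; first exact: cvg_cst.
  apply: continuous_cvg; first exact: sigmoid_continuous.
  apply: cvgM; last exact: cvg_cst.
  by apply: cvgM; [exact: cvg_cst|exact: g_continuous].
have [_ cgrad] := cp_g_C1 cp Ux.
have : {for x, continuous ((fun M : V => M 0 i) \o grad g)}.
  by apply: continuous_comp => //; exact: coord_continuous.
exact.
Qed.

Lemma grad_softplus_comp_le z : unit_ball z -> enorm (grad (p \o g) z) <= lam * Gg.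
Proof.
move=> Bz; rewrite grad_softplus_comp ?enormZ; last exact: cp_ball_sub cp z Bz.
rewrite ger0_norm ?softplus_slope_ge0//.
by apply: ler_pM; rewrite ?softplus_slope_ge0 ?enorm_ge0 ?softplus_slope_le ?(cp_grad_le cp).
Qed.

Lemma penalized_prox_problem :
  prox_problem unit_ball (fun z => f z + p (g z)) l l.
Proof.
have l0 := cp_l cp; split; try lra.
- exact: convex_unit_ball.
- exact: compact_unit_ball.
- by exists 0; exact: unit_ball0.
- rewrite -[X in weakly_convex_on _ X _]addr0; apply: weakly_convexD.
    exact: weakly_convex_sub (cp_ball_sub cp) (cp_f_weakly_convex cp).
  exact: weakly_convex_sub (cp_ball_sub cp) softplus_comp_weakly_convex.
- move=> x /(cp_ball_sub cp) Ux; apply: (@continuousD R R^o V).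
    exact: f_continuous.
  exact: softplus_comp_continuous.
Qed.

Lemma prox_objectiveE xt z :
  prox_objective f g p (2 * l) xt z = prox_obj (fun z => f z + p (g z)) l xt z.
Proof. by rewrite /prox_objective /prox_obj [2 * l]mulrC mulfK. Qed.

Lemma prox_objective_strongly_convex xt :
  strongly_convex_on unit_ball l (prox_objective f g p (2 * l) xt).
Proof.
apply/strongly_weakly_convex.
rewrite (_ : prox_objective f g p (2 * l) xt = prox_obj (fun z => f z + p (g z)) l xt); last first.
  by apply/funext => z; rewrite prox_objectiveE.
have := prox_obj_weakly_convex penalized_prox_problem xt.
by rewrite (_ : 2 * l - l = l)//; lra.
Qed.

(** The exact direction used by the inner loop is a subgradient of the strongly
    convex prox objective. *)
Lemma prox_objective_minorant xt z y v : unit_ball z -> unit_ball y ->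
  limiting_subdiff f z v ->
  prox_objective f g p (2 * l) xt z
    + dot (v + (2 * l) *: (z - xt) + grad (p \o g) z) (y - z)
    + l / 2 * enorm (y - z) ^+ 2 <= prox_objective f g p (2 * l) xt y.
Proof.
move=> /(cp_ball_sub cp) Uz /(cp_ball_sub cp) Uy vf.
have h1 := limiting_subdiff_minorant (cp_open cp) (cp_f_weakly_convex cp) Uz Uy vf.
have h2 := softplus_comp_minorant Uy Uz.
rewrite !prox_objectiveE /prox_obj.
have -> : enorm (y - xt) ^+ 2 =
    enorm (z - xt) ^+ 2 + 2 * dot (z - xt) (y - z) + enorm (y - z) ^+ 2.
  by rewrite -enorm_sqrD [_ + (y - z)]addrC subrKA.
rewrite 2!(dotDl _ _ (y - z)) (dotZl _ _ (y - z)).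
move: h1 h2; set A := dot _ _; set B := dot _ _; set E := enorm (y - z) ^+ 2.
set Dd := dot (z - xt) _; set X := enorm _ ^+ 2; lra.
Qed.

End Penalty.

(** * Measurability of continuous functions of random vectors *)

Section VectorMeasurability.
Context {R : realType} {d : nat} {dT : measure_display} {T : measurableType dT}.
Local Notation V := 'rV[R]_d.
Implicit Types (X Y : T -> V) (h : V -> R).

(** Coordinatewise, as conditional means are; [measurable_preimage_open] recovers
    Borel measurability. *)
Definition mvect X := forall i : 'I_d, measurable_fun setT (fun w => X w 0 i).

(* The half-open cubes of side 1/(n+1) with corners on the grid of that side. *)
Let cube (kn : 'rV[int]_d * nat) : set V :=
  [set x | forall i : 'I_d, Num.floor (kn.2.+1%:R * x 0 i) = kn.1 0 i].

Let measurable_cube X kn : mvect X -> measurable (X @^-1` cube kn).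
Proof.
move=> mX.
rewrite (_ : X @^-1` cube kn = \bigcap_(i in [set: 'I_d])
    ((fun w => kn.2.+1%:R * X w 0 i) @^-1` `[(kn.1 0 i)%:~R, (kn.1 0 i + 1)%:~R[)).
  apply: fin_bigcap_measurable => // i _.
  rewrite -[X in measurable X]setTI.
  have : measurable_fun setT (fun w => kn.2.+1%:R * X w 0 i).
    by apply: measurable_funM => //; exact: mX.
  by move=> /(_ measurableT); apply; exact: measurable_itv.
apply/seteqP; split=> w /= H i.
  by move=> _; rewrite /= in_itv/= -floor_eq; apply/eqP; exact: H.
by have := H i I; rewrite /= in_itv/= -floor_eq => /eqP.
Qed.

(** An open set is a union of grid cubes, and there are countably many of them. *)
Lemma measurable_preimage_open X (O : set V) : mvect X -> open O ->
  measurable (X @^-1` O).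
Proof.
move=> mX oO.
pose F (kn : 'rV[int]_d * nat) := [set w | cube kn `<=` O /\ cube kn (X w)].
rewrite (_ : X @^-1` O = \bigcup_kn F kn).
  apply: countable_bigcupT_measurable => [|kn].
    exact: countableP.
  have [kO|kO] := pselect (cube kn `<=` O).
    rewrite (_ : F kn = X @^-1` cube kn); first exact: measurable_cube.
    by apply/seteqP; split=> w /=; [case|split].
  by rewrite (_ : F kn = set0)//; apply/seteqP; split=> w //= [].
apply/seteqP; split=> w; last by move=> [kn _ [kO /kO]].
move=> /= Ow.
have /(@nbhs_normP R V)[r /= r0 rO] : nbhs (X w) O by exact: open_nbhs_nbhs.
pose n := Num.truncn r^-1; pose N : R := n.+1%:R.
have N0 : 0 < N by rewrite ltr0n.
have nr : N^-1 < r.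
  rewrite invf_plt ?posrE//.
  have r1 : 0 <= r^-1 by rewrite invr_ge0 ltW.
  by have /andP[] := truncn_itv r1.
exists (\row_i Num.floor (N * X w 0 i), n) => //; split=> [y yc|i]; last by rewrite mxE.
apply: rO => /=; apply: le_lt_trans nr.
rewrite [leLHS]mx_normrE; apply/bigmax_leP; split=> [|[a i] _ /=].
  by rewrite invr_ge0 ltW.
rewrite (ord1 a) !mxE.
have := yc i; rewrite /= mxE -/N => yi.
have := floor_itv (N * y 0 i); have := floor_itv (N * X w 0 i); rewrite yi.
set k := (Num.floor _); rewrite intrD => /andP[h1 h2] /andP[h3 h4].
rewrite -[N^-1]mul1r ler_pdivlMr// -[X in _ * X](gtr0_norm N0) -normrM.
rewrite ler_norml; apply/andP; split; lra.
Qed.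

Lemma measurable_continuous_comp X h : mvect X -> continuous h ->
  measurable_fun setT (h \o X).
Proof.
move=> mX ch; apply: (measurability _ (RGenOInfty.measurableE R)) => /= _ [_ [x ->] <-].
rewrite setTI; apply: (@measurable_preimage_open X (h @^-1` `]x, +oo[)) => //.
by apply: open_comp => [y _|]; [exact: ch|exact: interval_open].
Qed.

Lemma mvectD X Y : mvect X -> mvect Y -> mvect (fun w => X w + Y w).
Proof.
move=> mX mY i; under eq_fun do rewrite mxE.
by apply: measurable_funD; [exact: mX|exact: mY].
Qed.

Lemma mvectZ (a : R) X : mvect X -> mvect (fun w => a *: X w).
Proof.
move=> mX i; under eq_fun do rewrite mxE.
by apply: measurable_funM => //; exact: mX.
Qed.

Lemma mvectB X Y : mvect X -> mvect Y -> mvect (fun w => X w - Y w).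
Proof.
move=> mX mY; rewrite (_ : (fun w => X w - Y w) = (fun w => X w + (-1) *: Y w)).
  by apply: mvectD => //; exact: mvectZ.
by apply/funext => w; rewrite scaleN1r.
Qed.

Lemma mvect_cst (x : V) : mvect (fun=> x).
Proof. by move=> i; exact: measurable_cst. Qed.

Lemma mvect_sum (I : Type) (r : seq I) (F : I -> T -> V) :
  (forall i, mvect (F i)) -> mvect (fun w => \sum_(i <- r) F i w).
Proof.
move=> mF; elim: r => [|i r IHr].
  by under eq_fun do rewrite big_nil; exact: mvect_cst.
by under eq_fun do rewrite big_cons; exact: mvectD.
Qed.

Lemma measurable_dot X Y : mvect X -> mvect Y ->
  measurable_fun setT (fun w => dot (X w) (Y w)).
Proof.
by move=> mX mY; apply: measurable_sum => i; apply: measurable_funM; [exact: mX|exact: mY].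
Qed.

Lemma measurable_enorm X : mvect X -> measurable_fun setT (fun w => enorm (X w)).
Proof. by move=> mX; apply: measurable_continuous_comp => //; exact: continuous_enorm. Qed.

Lemma measurable_inv_ge0 (q : T -> R) : measurable_fun setT q ->
  (forall w, 0 <= q w) -> measurable_fun setT (fun w => (q w)^-1).
Proof.
move=> mq q0; under eq_fun do rewrite -powR_inv1//.
exact: (measurableT_comp (measurable_powR _)).
Qed.

End VectorMeasurability.

(** * Expectations of bounded random variables *)

Section BoundedExpectation.
Context {R : realType} {dOm : measure_display} {Om : measurableType dOm}.
Variable P : probability Om R.
Implicit Types (X Y Z W : Om -> R) (A : set Om).

Definition bounded_rv X := measurable_fun setT X /\ exists B : R, forall w, `|X w| <= B.

Definition Ex X : R := \int[P]_w X w.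

Lemma bounded_rv_integrable X : bounded_rv X -> P.-integrable setT (EFin \o X).
Proof.
move=> [mX [B XB]]; apply: measurable_bounded_integrable => //.
  by rewrite (le_lt_trans (probability_le1 _ _))// ltry.
exists B; split; first exact: num_real.
by move=> M BM w _ /=; rewrite (le_trans (XB w))// ltW.
Qed.

Lemma bounded_rv_cst (c : R) : bounded_rv (fun=> c).
Proof. by split; [exact: measurable_cst|exists `|c|]. Qed.

Lemma bounded_rvD X Y : bounded_rv X -> bounded_rv Y -> bounded_rv (fun w => X w + Y w).
Proof.
move=> [mX [B XB]] [mY [D YD]]; split; first exact: measurable_funD.
by exists (B + D) => w; rewrite (le_trans (ler_normD _ _))// lerD.
Qed.

Lemma bounded_rvM X Y : bounded_rv X -> bounded_rv Y -> bounded_rv (fun w => X w * Y w).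
Proof.
move=> [mX [B XB]] [mY [D YD]]; split; first exact: measurable_funM.
by exists (B * D) => w; rewrite normrM ler_pM.
Qed.

Lemma bounded_rvZ (c : R) X : bounded_rv X -> bounded_rv (fun w => c * X w).
Proof. exact/bounded_rvM/bounded_rv_cst. Qed.

Lemma bounded_rvN X : bounded_rv X -> bounded_rv (fun w => - X w).
Proof.
by move=> /(bounded_rvZ (-1)); under eq_fun do rewrite mulN1r.
Qed.

Lemma bounded_rvB X Y : bounded_rv X -> bounded_rv Y -> bounded_rv (fun w => X w - Y w).
Proof. by move=> bX /bounded_rvN; exact: bounded_rvD. Qed.

Lemma bounded_rv_sum (I : Type) (r : seq I) (F : I -> Om -> R) :
  (forall i, bounded_rv (F i)) -> bounded_rv (fun w => \sum_(i <- r) F i w).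
Proof.
move=> bF; elim: r => [|i r IHr].
  by under eq_fun do rewrite big_nil; exact: bounded_rv_cst.
by under eq_fun do rewrite big_cons; exact: bounded_rvD.
Qed.

Lemma bounded_rv_indic A : measurable A -> bounded_rv \1_A.
Proof.
move=> mA; split; first exact: measurable_indic.
by exists 1 => w; rewrite indicE; case: (w \in A); rewrite ?normr1 ?normr0.
Qed.

Lemma ExD X Y : bounded_rv X -> bounded_rv Y -> Ex (fun w => X w + Y w) = Ex X + Ex Y.
Proof. by move=> bX bY; apply: RintegralD => //; exact: bounded_rv_integrable. Qed.

Lemma ExB X Y : bounded_rv X -> bounded_rv Y -> Ex (fun w => X w - Y w) = Ex X - Ex Y.
Proof. by move=> bX bY; apply: RintegralB => //; exact: bounded_rv_integrable. Qed.

Lemma ExZ (c : R) X : bounded_rv X -> Ex (fun w => c * X w) = c * Ex X.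
Proof. by move=> bX; apply: RintegralZl => //; exact: bounded_rv_integrable. Qed.

Lemma Ex_cst (c : R) : Ex (fun=> c) = c.
Proof. by rewrite /Ex Rintegral_cst//= [X in fine X](probability_setT P) mulr1. Qed.

Lemma Ex_sum (I : Type) (r : seq I) (F : I -> Om -> R) :
  (forall i, bounded_rv (F i)) ->
  Ex (fun w => \sum_(i <- r) F i w) = \sum_(i <- r) Ex (F i).
Proof.
move=> bF; elim: r => [|i r IHr].
  by under [in LHS]eq_fun do rewrite big_nil; rewrite big_nil Ex_cst.
under [in LHS]eq_fun do rewrite big_cons.
by rewrite big_cons ExD ?IHr//; exact: bounded_rv_sum.
Qed.

Lemma Ex_le X Y : bounded_rv X -> bounded_rv Y -> (forall w, X w <= Y w) -> Ex X <= Ex Y.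
Proof.
by move=> bX bY XY; apply: le_Rintegral => //; exact: bounded_rv_integrable.
Qed.

Lemma Ex_norm_le X (B : R) : bounded_rv X -> (forall w, `|X w| <= B) -> `|Ex X| <= B.
Proof.
move=> bX XB; rewrite ler_norml; apply/andP; split.
  rewrite -(Ex_cst (- B)); apply: Ex_le => // [|w]; first exact: bounded_rv_cst.
  by have := XB w; rewrite ler_norml => /andP[].
rewrite -[leRHS]Ex_cst; apply: Ex_le => // [|w]; first exact: bounded_rv_cst.
by have := XB w; rewrite ler_norml => /andP[].
Qed.

Lemma Ex_indic A : measurable A -> (Ex \1_A)%:E = P A.
Proof.
move=> mA; rewrite /Ex /Rintegral integral_indic// setIT fineK//.
exact: fin_num_measure.
Qed.

Lemma Ex_indicM A X : measurable A -> Ex (fun w => \1_A w * X w) = \int[P]_(w in A) X w.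
Proof.
move=> mA; rewrite Rintegral_mkcond; congr Rintegral; apply/funext => w.
by rewrite patchE indicE; case: (w \in A); rewrite ?mul1r ?mul0r.
Qed.

End BoundedExpectation.

(** * Hoeffding's inequality for a martingale difference *)

Section Hoeffding.
Context {R : realType}.
Implicit Types (a r q t x y : R).

Let mgf_gt0 r a : `|r| <= 1 -> 0 < (1 + r) * expR a + (1 - r) * expR (- a).
Proof.
rewrite ler_norml => /andP[r1 r2].
have e1 := expR_gt0 a; have e2 := expR_gt0 (- a).
by have [r0|r0] := leP 0 r; nra.
Qed.

Let is_derive_mgf (p q a : R) : is_derive a 1 (fun x : R => p * expR x + q * expR (- x))
  (p * expR a - q * expR (- a)).
Proof.
have d1 : is_derive a (1 : R) (fun x : R => expR (- x)) (expR (- a) * -1).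
  by apply: (@is_derive1_comp R expR -%R).
apply: is_derive_eq; rewrite /GRing.scale/=; ring.
Qed.

(** The logarithm of the moment generating function of a variable with values
    in [-1, 1] has second derivative at most 1: for the two-point law of mean
    [r], its derivative is [M / N] below, and [x + r - M x / N x] vanishes at 0
    and has derivative [(M x / N x) ^+ 2]. *)
Lemma hoeffding_two_point r a : `|r| <= 1 -> 0 <= a ->
  ((1 + r) * expR a + (1 - r) * expR (- a)) / 2 <= expR (a * r + a ^+ 2 / 2).
Proof.
move=> r1 a0.
pose N (x : R) := (1 + r) * expR x + (1 - r) * expR (- x).
have N0 x : 0 < N x by exact: mgf_gt0.
have dN x : is_derive x (1 : R) N ((1 + r) * expR x - (1 - r) * expR (- x)).
  exact: is_derive_mgf.
pose M (x : R) := (1 + r) * expR x - (1 - r) * expR (- x).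
have dM x : is_derive x (1 : R) M (N x).
  have := is_derive_mgf (1 + r) (- (1 - r)) x.
  rewrite (_ : (fun x => _) = M); last by apply/funext => y; rewrite /M mulNr.
  by rewrite mulNr opprK.
pose g (x : R) := x + r - M x / N x.
have dg x : is_derive x (1 : R) g ((M x / N x) ^+ 2).
  have dV : is_derive x (1 : R) (fun x => (N x)^-1) (- (N x)^-2 *: M x).
    by apply: is_deriveV; rewrite gt_eqF.
  rewrite /g; apply: is_derive_eq.
  by rewrite /GRing.scale/= addr0; field; rewrite gt_eqF.
have g0 x : 0 <= x -> 0 <= g x.
  move=> x0.
  have <- : g 0 = 0 by rewrite /g /M /N oppr0 expR0; field; apply/lt0r_neq0; lra.
  apply: (@ger0_derive1_ndecr R g 0 x) => //.
  - by move=> y _; rewrite derive1E; have [_ ->] := dg y; exact: sqr_ge0.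
  - apply: continuous_subspaceT => y.
    by apply: differentiable_continuous; apply/derivable1_diffP; have [] := dg y.
pose h (x : R) := x * r + x ^+ 2 / 2 - ln (N x).
have dh x : is_derive x (1 : R) h (g x).
  have dl : is_derive x (1 : R) (@ln R \o N) ((N x)^-1 * M x).
    by apply: is_derive1_comp; exact: is_derive1_ln.
  rewrite /h; apply: is_derive_eq.
  by rewrite !scaler0 /g /GRing.scale/=; field; rewrite gt_eqF.
have : h 0 <= h a.
  apply: (@ger0_derive1_ndecr R h 0 a) => //.
  - move=> y; rewrite in_itv/= => /andP[y0 _].
    by rewrite derive1E; have [_ ->] := dh y; apply: g0; exact: ltW.
  - apply: continuous_subspaceT => y.
    by apply: differentiable_continuous; apply/derivable1_diffP; have [] := dh y.
have -> : h 0 = - ln 2.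
  rewrite /h /N oppr0 expR0 mul0r expr0n mul0r addr0 sub0r !mulr1; congr (- ln _).
  by lra.
rewrite /h lerBrDr addrC => H.
rewrite ler_pdivrMr// -ler_ln ?posrE ?mulr_gt0 ?expR_gt0// ?N0//.
by rewrite lnM ?posrE ?expR_gt0// expRK; move: H; rewrite /N; lra.
Qed.

(** On [-q, q] the exponential lies below its chord. *)
Lemma expR_chord t q y : 0 < q -> `|y| <= q ->
  expR (t * y) <= (expR (t * q) + expR (- (t * q))) / 2
    + y * ((expR (t * q) - expR (- (t * q))) / 2 / q).
Proof.
move=> q0; rewrite ler_norml => /andP[y1 y2].
pose l := (1 + y / q) / 2.
have yq : y / q <= 1 by rewrite ler_pdivrMr// mul1r.
have yq' : -1 <= y / q by rewrite ler_pdivlMr// mulN1r.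
have l0 : 0 <= l by rewrite /l; lra.
have l1 : l <= 1 by rewrite /l; lra.
have := convex_expR (Itv01 l0 l1) (t * q) (- (t * q)).
rewrite !convRE /= => H.
have E : l * (t * q) + (1 - l) * - (t * q) = t * y.
  by rewrite /l; field; rewrite gt_eqF.
move: H; rewrite /unstable.onem E => /le_trans; apply.
by rewrite le_eqVlt; apply/orP; left; apply/eqP; rewrite /l; field; rewrite gt_eqF.
Qed.

End Hoeffding.

(** * Exponential supermartingales *)

Section Supermartingale.
Context {R : realType} {d : nat} {dOm : measure_display} {Om : measurableType dOm}.
Local Notation V := 'rV[R]_d.
Variables (P : probability Om R) (G : set (set Om)).
Hypothesis G_measurable : G `<=` measurable.

(* Measurability with respect to the generated sub-sigma-algebra. *)
Let TG := g_sigma_algebraType G.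

Lemma sub_sigma_measurable : <<s G >> `<=` @measurable _ Om.
Proof.
apply: smallest_sub => //; split; first exact: measurable0.
- by move=> A mA; rewrite setTD; exact: measurableC.
- by move=> A mA; exact: bigcupT_measurable.
Qed.

Lemma sub_measurable_fun (X : Om -> R) :
  measurable_fun setT (X : TG -> R) -> measurable_fun setT X.
Proof. by move=> mX _ S mS; apply: sub_sigma_measurable; exact: mX. Qed.

Lemma sub_mvect (X : Om -> V) : mvect (X : TG -> V) -> mvect X.
Proof. by move=> mX i; exact: sub_measurable_fun. Qed.

Lemma measurable_wrtP (X : Om -> V) : measurable_wrt <<s G >> X <-> mvect (X : TG -> V).
Proof.
split=> mX i; last by move=> S mS; rewrite -[X in <<s G >> X]setTI; exact: mX.
by move=> _ S mS; rewrite setTI; exact: mX.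
Qed.

Lemma preimage_sub_measurable (X : Om -> R) (S : set R) :
  measurable_fun setT (X : TG -> R) -> measurable S -> <<s G >> (X @^-1` S).
Proof. by move=> mX mS; rewrite -[X in <<s G >> X]setTI; exact: mX. Qed.

(** A bounded variable whose integral vanishes on every event of the
    sigma-algebra is orthogonal to the bounded variables measurable for it: the
    latter are uniform limits of combinations of indicators of such events,
    obtained by rounding down to a grid. *)
Lemma orthogonal_of_null_integrals (W Z : Om -> R) (B : R) :
  measurable_fun setT (W : TG -> R) -> (forall w, `|W w| <= B) ->
  bounded_rv Z -> (forall A, <<s G >> A -> Ex P (fun w => \1_A w * Z w) = 0) ->
  Ex P (fun w => W w * Z w) = 0.
Proof.
move=> mW WB bZ Z0; have [mZ [D ZD]] := bZ.
have mWO := sub_measurable_fun mW.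
have bW : bounded_rv W by split=> //; exists B.
pose W' w := W w + B.
have W'0 w : 0 <= W' w by have := WB w; rewrite ler_norml /W' => /andP[]; lra.
have W'B w : W' w <= 2 * B by have := WB w; rewrite ler_norml /W' => /andP[]; lra.
have bW' : bounded_rv W' by apply: bounded_rvD => //; exact: bounded_rv_cst.
have EZ : Ex P Z = 0.
  have := Z0 setT (@measurableT _ TG); congr (_ = _); congr Ex.
  by apply/funext => w; rewrite indicT mul1r.
suff E' : Ex P (fun w => W' w * Z w) = 0.
  have : Ex P (fun w => W' w * Z w - B * Z w) = 0.
    by rewrite ExB ?ExZ ?E' ?EZ ?mulr0 ?subrr//; [exact: bounded_rvM|exact: bounded_rvZ].
  by congr (_ = _); congr Ex; apply/funext => w; rewrite /W'; ring.
have D0 : 0 <= D by have := ZD point; apply: le_trans.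
have B0 : 0 <= B by have := WB point; apply: le_trans.
have key (n : nat) : `|Ex P (fun w => W' w * Z w)| <= n.+1%:R^-1 * D.
  set r : R := n.+1%:R; have r0 : 0 < r by rewrite ltr0n.
  pose N := (Num.truncn (2 * B * r)).+1.
  pose A (j : 'I_N) := W @^-1` `[j%:R / r - B, j.+1%:R / r - B[%classic.
  have AG j : <<s G >> (A j) by apply: preimage_sub_measurable => //; exact: measurable_itv.
  have mA j : measurable (A j) by exact: sub_sigma_measurable.
  have inA j w : (w \in A j) = (Num.truncn (r * W' w) == j).
    have -> : (w \in A j) = (W w \in `[j%:R / r - B, j.+1%:R / r - B[).
      by apply/idP/idP; rewrite inE.
    rewrite in_itv/= lerBlDr ltrBrDr -/(W' w) ler_pdivrMr// ltr_pdivlMr//.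
    by rewrite mulrC truncn_eq// mulr_ge0// ltW.
  pose S w := \sum_(j < N) (j%:R / r) * \1_(A j) w.
  have Strunc w : S w = (Num.truncn (r * W' w))%:R / r.
    have rW0 : 0 <= r * W' w by rewrite mulr_ge0// ltW.
    have kN : (Num.truncn (r * W' w) < N)%N.
      by rewrite /N ltnS; apply: le_truncn; rewrite mulrC ler_wpM2r ?W'B// ltW.
    rewrite /S (bigD1 (Ordinal kN))//= indicE inA eqxx mulr1 big1 ?addr0// => j jk.
    rewrite indicE inA; have -> : (Num.truncn (r * W' w) == j) = false.
      by apply/negbTE; apply: contra jk => /eqP E; apply/eqP/val_inj; rewrite /= E.
    by rewrite mulr0.
  have bS : bounded_rv S.
    by apply: bounded_rv_sum => j; apply: bounded_rvZ; exact: bounded_rv_indic.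
  have ES : Ex P (fun w => S w * Z w) = 0.
    have -> : (fun w => S w * Z w) = (fun w => \sum_(j < N) (j%:R / r) * (\1_(A j) w * Z w)).
      by apply/funext => w; rewrite big_distrl; apply: eq_bigr => j _; rewrite /= mulrA.
    have bAZ j : bounded_rv (fun w => \1_(A j) w * Z w).
      by apply: bounded_rvM => //; exact: bounded_rv_indic.
    rewrite Ex_sum; last by move=> j; exact: bounded_rvZ.
    by rewrite big1// => j _; rewrite ExZ// Z0 ?mulr0.
  have bWZ := bounded_rvM bW' bZ; have bSZ := bounded_rvM bS bZ.
  rewrite -[X in `|X|]subr0 -{1}ES -ExB//.
  apply: Ex_norm_le => [|w]; first exact: bounded_rvB.
  rewrite -mulrBl normrM; apply: ler_pM => //.
  rewrite Strunc; have rW0 : 0 <= r * W' w by rewrite mulr_ge0// ltW.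
  have /andP[t1 t2] := truncn_itv rW0.
  rewrite -natr1 in t2; rewrite -[leRHS]mul1r ler_pdivlMr// -[X in _ * X](gtr0_norm r0) -normrM.
  rewrite mulrBl divfK ?gt_eqF// ler_norml; move: t1 t2.
  by set x := _%:R => t1 t2; apply/andP; split; lra.
apply/eqP/negPn/negP => E0.
have e0 : 0 < `|Ex P (fun w => W' w * Z w)| by rewrite normr_gt0.
set e := `|_| in e0 key.
have [D00|D00] := eqVneq D 0.
  by have := key 0; rewrite D00 mulr0; lra.
have {}D0 : 0 < D by rewrite lt_def D00.
have eD : 0 <= D / e by rewrite divr_ge0// ltW.
have /andP[_ t] := truncn_itv eD; have := key (Num.truncn (D / e)).
rewrite ltr_pdivrMr// mulrC in t.
by rewrite ler_pdivlMl ?ltr0n// leNgt mulrC t.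
Qed.

Section Pointwise.
Implicit Types (t q y r : R).

(* The slope of the affine majorant of the tilted, normalized exponential. *)
Let slope t q r := expR (- (t * r) - (t * q) ^+ 2 / 2)
  * ((expR (t * q) - expR (- (t * q))) / 2 / q).

(** The chord bound, with Hoeffding's inequality for its value at [r]. *)
Lemma hoeffding_affine t q y r : 0 <= t -> 0 <= q -> `|y| <= q -> `|r| <= q ->
  expR (t * (y - r) - (t * q) ^+ 2 / 2) <= 1 + slope t q r * (y - r).
Proof.
move=> t0; rewrite le_eqVlt => /orP[/eqP <-|q0 yq rq].
  rewrite !normr_le0 => /eqP -> /eqP ->.
  by rewrite subrr !mulr0 expr0n mul0r subrr expR0 addr0.
rewrite /slope; set E := expR (- (t * r) - _).
have E0 : 0 < E by exact: expR_gt0.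
have -> : expR (t * (y - r) - (t * q) ^+ 2 / 2) = E * expR (t * y).
  by rewrite -expRD; congr expR; ring.
have h1 := ler_wpM2l (ltW E0) (expR_chord t q0 yq).
apply: le_trans h1 _.
have rq1 : `|r / q| <= 1.
  by rewrite normrM normfV (gtr0_norm q0) ler_pdivrMr// mul1r.
have h2 := ler_wpM2l (ltW E0) (hoeffding_two_point rq1 (mulr_ge0 t0 (ltW q0))).
have EE : E * expR (t * q * (r / q) + (t * q) ^+ 2 / 2) = 1.
  rewrite /E -expRD -[RHS]expR0; congr expR.
  by field; rewrite gt_eqF.
rewrite EE in h2; rewrite -subr_ge0; rewrite -subr_ge0 in h2.
apply: le_trans h2 _; rewrite le_eqVlt; apply/orP; left; apply/eqP.
by field; rewrite gt_eqF.
Qed.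

Lemma slope_ge0 t q r : 0 <= t -> 0 <= q -> 0 <= slope t q r.
Proof.
move=> t0 q0; rewrite mulr_ge0 ?expR_ge0// divr_ge0// divr_ge0// subr_ge0 ler_expR.
by have := mulr_ge0 t0 q0; lra.
Qed.

Lemma slope_mul_le t q r : 0 <= t -> 0 <= q -> `|r| <= q ->
  slope t q r * q <= expR (2 * (t * q)).
Proof.
move=> t0 q0 rq; have [->|qn0] := eqVneq q 0; first by rewrite mulr0 expR_ge0.
rewrite /slope -mulrA divfK//.
have tq0 := mulr_ge0 t0 q0.
have tr : - (t * r) <= t * q.
  by rewrite -mulrN ler_wpM2l// (le_trans _ rq)// -normrN ler_norm.
have -> : expR (2 * (t * q)) = expR (t * q) * expR (t * q) by rewrite -expRD; congr expR; ring.
have e1 := expR_gt0 (t * q); have e2 := expR_gt0 (- (t * q)).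
apply: ler_pM; rewrite ?expR_ge0//; last lra.
  by rewrite divr_ge0// subr_ge0 ler_expR; lra.
by rewrite ler_expR; have := sqr_ge0 (t * q); lra.
Qed.

Lemma measurable_slope t (q r : TG -> R) : measurable_fun setT q ->
  measurable_fun setT r -> (forall w, 0 <= q w) ->
  measurable_fun setT (fun w => slope t (q w) (r w)).
Proof.
move=> mq mr q0.
have mtq : measurable_fun setT (fun w => t * q w) by exact: measurable_funM.
have mexp (h : TG -> R) : measurable_fun setT h -> measurable_fun setT (fun w => expR (h w)).
  by move=> mh; apply: measurableT_comp => //; exact: measurable_expR.
apply: measurable_funM.
  apply: mexp; apply: measurable_funB.
    by apply: measurableT_comp => //; exact: measurable_funM.
  by apply: measurable_funM => //; exact: measurable_funX.
apply: measurable_funM; last exact: measurable_inv_ge0.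
apply: measurable_funM => //; apply: measurable_funB; first exact: mexp.
by apply: mexp; exact: measurableT_comp.
Qed.

End Pointwise.

(** One step of the exponential supermartingale. The affine majorant reduces the
    conditional exponential moment to conditional means, which cancel. *)
Lemma exp_supermartingale_step (M : Om -> R) (u Y m : Om -> V) (B D c t : R) :
  measurable_fun setT (M : TG -> R) -> (forall w, 0 <= M w <= B) ->
  mvect (u : TG -> V) -> (forall w, enorm (u w) <= D) ->
  mvect Y -> (forall w, enorm (Y w) <= c) ->
  mvect (m : TG -> V) -> (forall w, enorm (m w) <= c) ->
  0 < c -> 0 <= t ->
  (forall i A, <<s G >> A ->
     \int[P]_(w in A) Y w 0 i = \int[P]_(w in A) m w 0 i) ->
  Ex P (fun w => M w * expR (t * dot (Y w - m w) (u w)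
                            - (t * (c * enorm (u w))) ^+ 2 / 2)) <= Ex P M.
Proof.
move=> mM MB mu uD mY Yc mm mc c0 t0 Ym.
have M0 w : 0 <= M w by case/andP: (MB w).
have MB' w : M w <= B by case/andP: (MB w).
have mMO := sub_measurable_fun mM; have muO := sub_mvect mu; have mmO := sub_mvect mm.
have D0 : 0 <= D by apply: le_trans (enorm_ge0 (u point)) (uD point).
have B0 : 0 <= B by apply: le_trans (M0 point) (MB' point).
pose q w := c * enorm (u w); pose r w := dot (m w) (u w); pose y w := dot (Y w) (u w).
have q0 w : 0 <= q w by rewrite mulr_ge0 ?enorm_ge0 ?ltW.
have qD w : q w <= c * D by rewrite ler_wpM2l// ltW.
have yq w : `|y w| <= q w.
  by apply: le_trans (normr_dot_le _ _) _; rewrite ler_wpM2r ?enorm_ge0.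
have rq w : `|r w| <= q w.
  by apply: le_trans (normr_dot_le _ _) _; rewrite ler_wpM2r ?enorm_ge0.
have yr w : dot (Y w - m w) (u w) = y w - r w by rewrite dotDl dotNl.
pose k w := expR (- (t * r w) - (t * q w) ^+ 2 / 2)
  * ((expR (t * q w) - expR (- (t * q w))) / 2 / q w).
have mq : measurable_fun setT (q : TG -> R).
  by apply: measurable_funM => //; exact: (@measurable_enorm _ _ _ TG).
have mr : measurable_fun setT (r : TG -> R) by exact: (@measurable_dot _ _ _ TG).
have mk : measurable_fun setT (k : TG -> R) by exact: measurable_slope.
have k0 w : 0 <= k w by exact: slope_ge0.
pose K : R := expR (2 * (t * (c * D))).
have kq w : k w * q w <= K.
  apply: le_trans (slope_mul_le t0 (q0 w) (rq w)) _.
  by rewrite ler_expR ler_wpM2l// ler_wpM2l.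
have ku w (i : 'I_d) : `|k w * u w 0 i| <= K / c.
  rewrite normrM (ger0_norm (k0 w)) ler_pdivlMr//.
  apply: le_trans (kq w); rewrite -mulrA ler_wpM2l//.
  by rewrite /q mulrC ler_wpM2l ?coord_le_enorm// ltW.
pose W (i : 'I_d) w := M w * (k w * u w 0 i).
have mW i : measurable_fun setT (W i : TG -> R).
  by apply: measurable_funM => //; apply: measurable_funM => //; exact: mu.
have WB i w : `|W i w| <= B * (K / c).
  by rewrite normrM; apply: ler_pM => //; rewrite ger0_norm.
have bM : bounded_rv M by split=> //; exists B => w; rewrite ger0_norm.
have bvect (X : Om -> V) (b : R) : mvect X -> (forall w, enorm (X w) <= b) ->
    forall i, bounded_rv (fun w => X w 0 i).
  move=> mX Xb i; split; first exact: mX.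
  by exists b => w; rewrite (le_trans (coord_le_enorm _ _)).
have bZ i : bounded_rv (fun w => Y w 0 i - m w 0 i).
  by apply: bounded_rvB; exact: bvect.
have bW i : bounded_rv (W i).
  by split; [exact: sub_measurable_fun|exists (B * (K / c))].
have EWZ i : Ex P (fun w => W i w * (Y w 0 i - m w 0 i)) = 0.
  apply: (@orthogonal_of_null_integrals _ _ _ (mW i) (WB i) (bZ i)) => A GA.
  have mA := sub_sigma_measurable GA.
  have bA := bounded_rv_indic mA.
  have -> : (fun w => \1_A w * (Y w 0 i - m w 0 i)) =
      (fun w => \1_A w * Y w 0 i - \1_A w * m w 0 i).
    by apply/funext => w; rewrite mulrBr.
  rewrite ExB; [|by apply: bounded_rvM => //; exact: bvect..].
  by rewrite !Ex_indicM// Ym// subrr.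
have bS : bounded_rv (fun w => \sum_(i < d) W i w * (Y w 0 i - m w 0 i)).
  by apply: bounded_rv_sum => i; exact: bounded_rvM.
have -> : Ex P M = Ex P (fun w => M w + \sum_(i < d) W i w * (Y w 0 i - m w 0 i)).
  rewrite ExD// Ex_sum; last by move=> i; exact: bounded_rvM.
  by rewrite big1 ?addr0.
apply: Ex_le => [||w]; last first.
- rewrite yr -/(q w).
  have := ler_wpM2l (M0 w) (hoeffding_affine t0 (q0 w) (yq w) (rq w)).
  move/le_trans; apply; rewrite mulrDr mulr1 lerD2l -/(k w) -yr.
  rewrite /dot mulrA mulr_sumr le_eqVlt; apply/orP; left; apply/eqP.
  by apply: eq_bigr => i _; rewrite /W !mxE; ring.
- exact: bounded_rvD.
- apply: bounded_rvM => //; split.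
    apply: measurableT_comp; first exact: measurable_expR.
    apply: measurable_funB.
      apply: measurable_funM => //; apply: measurable_dot => //.
      exact: mvectB.
    apply: measurable_funM => //; apply: measurable_funX; apply: measurable_funM => //.
    exact: sub_measurable_fun.
  exists (expR (t * (2 * (c * D)))) => w; rewrite ger0_norm ?expR_ge0// ler_expR.
  rewrite -/(q w) yr; apply: (@le_trans _ _ (t * (y w - r w))).
    by rewrite gerBl divr_ge0// sqr_ge0.
  rewrite ler_wpM2l//; have := yq w; have := rq w; have := qD w.
  by rewrite !ler_norml => h /andP[h1 h2] /andP[h3 h4]; lra.
Qed.

End Supermartingale.

(** * The iterates computed by the program *)

Section Semantics.
Context {R : realType} {d : nat}.
Local Notation V := 'rV[R]_d.
Variables (g : V -> R) (p : R -> R) (beta m : R) (K : nat).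
Variables (answer : nat -> V -> V).

Definition psm_step (xt : V) (s : nat) (z v : V) : V :=
  proj_ball (z - (2 / (m * s.+2%:R)) *: (v + beta *: (z - xt) + grad (p \o g) z)).

(* The iterates are numbered from 0 here; the first call has number [n]. *)
Fixpoint psm_point (n : nat) (xt : V) (s : nat) : V :=
  if s is s'.+1 then
    let z := psm_point n xt s' in psm_step xt s' z (answer (n + s') z)
  else xt.

Fixpoint outer_point (x0 : V) (t : nat) : V :=
  if t is t'.+1 then
    K%:R^-1 *: \sum_(s < K) psm_point (t' * K) (outer_point x0 t') s
  else x0.

Lemma psm_iteratesE xt s c :
  psm_iterates g p beta m answer xt s c =
  (mkseq (psm_point (oracle_calls c) xt) s.+1,
   Cost (oracle_calls c + s) (projections c)).
Proof.
elim: s => [|s IHs]; first by case: c => a b; rewrite addn0.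
rewrite [in RHS]mkseqS addnS.
have : last xt (mkseq (psm_point (oracle_calls c) xt) s.+1) = psm_point (oracle_calls c) xt s.
  by rewrite mkseqS last_rcons.
move: (mkseq _ _) IHs => zs IHs lastE.
by rewrite /= /bind IHs /query /ret /= lastE.
Qed.

Lemma PSME xt c : PSM g p beta m K answer xt c =
  (K%:R^-1 *: \sum_(s < K) psm_point (oracle_calls c) xt s,
   Cost (oracle_calls c + K) (projections c)).
Proof.
rewrite /PSM /bind psm_iteratesE /ret big_add1 big_mkord; congr (_ *: _, _).
rewrite [K.+1.-1]/=.
by apply: eq_bigr => s _; rewrite [_.-1]/= nth_mkseq// ltnS ltnW.
Qed.

Lemma outer_iteratesE x0 t :
  outer_iterates g p beta m K answer x0 t (Cost 0 0) =
  (mkseq (outer_point x0) t.+1, Cost (t * K) 0).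
Proof.
elim: t => [//|t IHt].
rewrite [in RHS]mkseqS mulSn addnC.
have : last x0 (mkseq (outer_point x0) t.+1) = outer_point x0 t.
  by rewrite mkseqS last_rcons.
move: (mkseq _ _) IHt => xs IHt lastE.
by rewrite /= /bind IHt PSME lastE.
Qed.

Lemma penalized_psmE T projC x0 j :
  penalized_psm g p beta m K T answer projC x0 j (Cost 0 0) =
  (projC (mkseq (outer_point x0) T.+1)`_j, Cost (T * K) 1).
Proof. by rewrite /penalized_psm /bind outer_iteratesE. Qed.

End Semantics.

(** * Deterministic analysis of the inner loop *)

Section InnerLoop.
Context {R : realType} {d : nat}.
Local Notation V := 'rV[R]_d.

Lemma weakly_convex_le (D : set V) (a b : R) (h : V -> R) :
  a <= b -> weakly_convex_on D a h -> weakly_convex_on D b h.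
Proof.
move=> ab /weakly_convexP ch; apply/weakly_convexP => t x y t0 t1 Dx Dy.
apply: le_trans (ch t x y t0 t1 Dx Dy) _; rewrite lerD2l; apply: ler_wpM2r.
  exact: sqr_ge0.
by apply: ler_wpM2r; [rewrite mulr_ge0// subr_ge0|rewrite ler_pM2r].
Qed.

Lemma convex_average (D : set V) (h : V -> R) (K : nat) (z : nat -> V) :
  convex_set (M := V) D -> weakly_convex_on D 0 h -> (forall k, D (z k)) ->
  D (K.+1%:R^-1 *: \sum_(k < K.+1) z k) /\
  h (K.+1%:R^-1 *: \sum_(k < K.+1) z k) <= K.+1%:R^-1 * \sum_(k < K.+1) h (z k).
Proof.
move=> /convex_setP cD /weakly_convexP ch Dz; elim: K => [|K [IH1 IH2]].
  by rewrite !big_ord_recr !big_ord0/= !add0r invr1 scale1r mul1r.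
rewrite !(big_ord_recr K.+1)/=; set S := \sum_(k < K.+1) z k in IH1 IH2 *.
set H := \sum_(k < K.+1) h (z k) in IH2 *.
pose a : R := K.+1%:R; pose b : R := K.+2%:R.
have a0 : 0 < a by rewrite ltr0n.
have bE : b = a + 1 by rewrite /b -natr1.
have b0 : 0 < b by rewrite ltr0n.
rewrite -/b; rewrite -/a in IH1 IH2.
pose t := a / b.
have t0 : 0 <= t by rewrite divr_ge0// ltW.
have t1 : t <= 1 by rewrite /t ler_pdivrMr//; lra.
have tb : 1 - t = b^-1 by rewrite /t bE; field; apply/lt0r_neq0; lra.
have E : b^-1 *: (S + z K.+1) = t *: (a^-1 *: S) + (1 - t) *: z K.+1.
  by rewrite tb scalerA scalerDr /t mulrAC mulfV ?mul1r// gt_eqF.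
rewrite E; split; first exact: cD.
have := ch t _ _ t0 t1 IH1 (Dz K.+1); rewrite mul0r !mul0r addr0 => /le_trans; apply.
rewrite tb mulrDr lerD2r; apply: le_trans (ler_wpM2l t0 IH2) _.
by rewrite le_eqVlt /t; apply/orP; left; apply/eqP; field; rewrite !gt_eqF.
Qed.

Lemma sum_inv_le_ln (K : nat) : \sum_(k < K) (k.+2%:R^-1 : R) <= ln K.+1%:R.
Proof.
elim: K => [|K IH]; first by rewrite big_ord0 ln1.
rewrite big_ord_recr/=; apply: (@le_trans _ _ (ln K.+1%:R + K.+2%:R^-1)).
  by rewrite lerD2r.
have -> : (K.+1%:R : R) = K.+2%:R * (1 + - K.+2%:R^-1).
  by rewrite mulrDr mulr1 mulrN mulfV ?pnatr_eq0// -[K.+2%:R]natr1 addrK.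
have i1 : (K.+2%:R^-1 : R) < 1 by rewrite invf_lt1 ?ltr0n// ltr1n.
rewrite lnM ?posrE ?ltr0n ?subr_gt0// -addrA gerDl.
move: (K.+2%:R^-1) i1 => x x1; have := @le_ln1Dx R (- x); rewrite ltrN2 => /(_ x1).
by rewrite -[leRHS]add0r -lerBrDr sub0r.
Qed.

(** Regret of the projected subgradient iteration with steps [2 / (m (k + 2))].
    Strong convexity is spent twice: half of [m / 2 * a k] makes the weighted
    distances telescope, the other half is kept to absorb the noise. *)
Lemma psm_regret (m G : R) (K : nat) (a gap noise A : nat -> R) : 0 < m ->
  (forall k, (k < K)%N -> a k.+1 <= a k - 2 * (2 / (m * k.+2%:R)) * A k
                    + (2 / (m * k.+2%:R)) ^+ 2 * G ^+ 2) ->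
  (forall k, (k < K)%N -> gap k + m / 2 * a k <= A k + noise k) ->
  0 <= a K ->
  \sum_(k < K) gap k <=
    m / 4 * a 0%N + G ^+ 2 / m * ln K.+1%:R + \sum_(k < K) (noise k - m / 4 * a k).
Proof.
move=> m0 ha hgap aK0.
suff : \sum_(k < K) gap k <= m / 4 * a 0%N + G ^+ 2 / m * \sum_(k < K) k.+2%:R^-1
    + \sum_(k < K) (noise k - m / 4 * a k) - m * K.+1%:R / 4 * a K.
  have h1 : G ^+ 2 / m * \sum_(k < K) k.+2%:R^-1 <= G ^+ 2 / m * ln K.+1%:R.
    by apply: ler_wpM2l (sum_inv_le_ln K); rewrite divr_ge0 ?sqr_ge0// ltW.
  have h2 : 0 <= m * K.+1%:R / 4 * a K by rewrite mulr_ge0// divr_ge0// mulr_ge0// ltW.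
  lra.
elim: K ha hgap {aK0} => [|K IH] ha hgap.
  by rewrite !big_ord0; lra.
have := IH (fun k kK => ha k (ltnW kK)) (fun k kK => hgap k (ltnW kK)).
rewrite !big_ord_recr/=.
set S1 := \sum_(k < K) gap k; set S2 := \sum_(k < K) _^-1; set S3 := \sum_(k < K) (_ - _).
have := ha K (ltnSn K); have := hgap K (ltnSn K).
have -> : (K.+2%:R : R) = K.+1%:R + 1 by rewrite natr1.
set n : R := K.+1%:R; have n0 : 0 < n by rewrite ltr0n.
move=> hg hA IHK.
have c0 : 0 < m * (n + 1) / 4 by rewrite divr_gt0// mulr_gt0// ltr_wpDl// ltW.
have := ler_wpM2l (ltW c0) hA.
have -> : m * (n + 1) / 4 * (a K - 2 * (2 / (m * (n + 1))) * A K
    + (2 / (m * (n + 1))) ^+ 2 * G ^+ 2) =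
    m * (n + 1) / 4 * a K - A K + G ^+ 2 / m * (n + 1)^-1.
  by field; rewrite !gt_eqF// ltr_wpDl// ltW.
move: IHK; set Y := G ^+ 2 / m; set i := (n + 1)^-1; lra.
Qed.

End InnerLoop.

(** * High-probability guarantee of the inner loop *)

Section StochasticInner.
Context {R : realType} {d : nat} {dOm dXi : measure_display}.
Context {Om : measurableType dOm} {Xi : measurableType dXi}.
Local Notation V := 'rV[R]_d.
Variables (P : probability Om R) (xi : nat -> {mfun Om >-> Xi}).
Variables (vt : V -> Xi -> V) (v : V -> V).
Variables (f g : V -> R) (U : set V) (l Gf Gg sigma lam gam : R) (K : nat).
Hypothesis cp : constrained_problem f g U l Gf Gg sigma.
Hypothesis oracle : stochastic_oracle P f Gf (fun n => xi n) vt v.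
Hypotheses (lam_ge0 : 0 <= lam) (gam_gt0 : 0 < gam) (K_gt0 : (0 < K)%N).

Let p := softplus lam gam.
Let answer (w : Om) (n : nat) (z : V) : V := vt z (xi n w).

Definition past (n : nat) : set (set Om) :=
  \bigcup_(k in `I_n) preimage_set_system setT (xi k) measurable.

Definition adapted (n : nat) (X : Om -> V) : Prop :=
  mvect (X : g_sigma_algebraType (past n) -> V).

Lemma past_measurable n : past n `<=` measurable.
Proof. by move=> A [k _ [B mB <-]]; exact: measurable_funP. Qed.

Lemma past_mono n n' : (n <= n')%N -> <<s past n >> `<=` <<s past n' >>.
Proof.
move=> nn'; apply: sub_sigma_algebra2 => A [k kn kA]; exists k => //=.
exact: leq_trans kn nn'.
Qed.

Lemma adapted_mono n n' X : (n <= n')%N -> adapted n X -> adapted n' X.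
Proof. by move=> nn' aX i _ S mS; apply: (past_mono nn'); exact: aX. Qed.

Lemma measurable_past_mono n n' (h : Om -> R) : (n <= n')%N ->
  measurable_fun setT (h : g_sigma_algebraType (past n) -> R) ->
  measurable_fun setT (h : g_sigma_algebraType (past n') -> R).
Proof. by move=> nn' mh _ S mS; apply: (past_mono nn'); exact: mh. Qed.

Lemma adapted_wrt n X : adapted n X <-> measurable_wrt (history (fun n => xi n) n) X.
Proof. by apply: iff_sym; exact: measurable_wrtP. Qed.

Lemma adapted_mvect n X : adapted n X -> mvect X.
Proof. exact/sub_mvect/past_measurable. Qed.

Lemma adapted_continuous n (h : V -> R) X : adapted n X -> continuous h ->
  measurable_fun setT (h \o X : g_sigma_algebraType (past n) -> R).
Proof. exact: measurable_continuous_comp. Qed.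

Lemma adapted_prox n D (h : V -> R) a c X : prox_problem D h a c -> adapted n X ->
  adapted n (fun w => prox D h c (X w)).
Proof.
move=> pp aX i; apply: (adapted_continuous (h := fun x => prox D h c x 0 i)) => //.
move=> x; apply: (@continuous_comp _ _ _ (prox D h c) (fun M : V => M 0 i)).
  exact: (prox_is_continuous pp).
exact: coord_continuous.
Qed.

Lemma adapted_grad n X : adapted n X -> (forall w, unit_ball (X w)) ->
  adapted n (fun w => grad (p \o g) (X w)).
Proof.
move=> aX BX i.
rewrite (_ : (fun w => _) = (fun z => grad (p \o g) (proj_ball z) 0 i) \o X).
  apply: adapted_continuous => //.
  rewrite (_ : (fun z => _) = (fun z => grad (p \o g) z 0 i) \o prox unit_ball (fun=> 0) 1).
    move=> x; apply: continuous_comp; first exact: (prox_is_continuous ball_proj_problem).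
    apply: (grad_softplus_comp_continuous cp gam_gt0); apply: (cp_ball_sub cp).
    by rewrite -proj_ballE; exact: proj_ball_in.
  by apply/funext => z; rewrite /= proj_ballE.
by apply/funext => w; rewrite /= (proj_fixed (proj_ballP _)).
Qed.

Lemma psm_adapted n X : adapted n X -> (forall w, unit_ball (X w)) -> forall k,
  adapted (n + k) (fun w => psm_point g p (2 * l) l (answer w) n (X w) k) /\
  forall w, unit_ball (psm_point g p (2 * l) l (answer w) n (X w) k).
Proof.
move=> aX BX; elim=> [|k [IH1 IH2]]; first by rewrite addn0.
split=> [|w]; last exact: proj_ball_in.
have [/adapted_wrt aY _ _] := (proj2 oracle) _ _ (proj1 (adapted_wrt _ _) IH1) IH2.
rewrite addnS /= /psm_step.
under eq_fun do rewrite proj_ballE.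
apply: (adapted_prox ball_proj_problem).
have aZ := adapted_mono (leqnSn _) IH1.
apply: mvectB => //; apply: mvectZ; apply: mvectD.
  apply: mvectD => //; apply: mvectZ; apply: mvectB => //.
  by apply: adapted_mono aX; rewrite -addnS leq_addr.
by apply: (adapted_mono (leqnSn _)); exact: adapted_grad.
Qed.

Unset Implicit Arguments.

Section OneCall.
Variables (n : nat) (X : Om -> V).
Hypotheses (aX : adapted n X) (BX : forall w, unit_ball (X w)).

Let F z := f z + p (g z).
Let pp : prox_problem unit_ball F l l := penalized_prox_problem cp lam_ge0 gam_gt0.
Let H w z := prox_obj F l (X w) z.
Let Z k w := psm_point g p (2 * l) l (answer w) n (X w) k.
Let zs w := prox unit_ball F l (X w).
Let u k w := zs w - Z k w.
Let Y k w := answer w (n + k) (Z k w).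

Let aZ k : adapted (n + k) (Z k). Proof. exact: (psm_adapted aX BX k).1. Qed.
Let BZ k w : unit_ball (Z k w). Proof. exact: (psm_adapted aX BX k).2. Qed.
Let Bzs w : unit_ball (zs w). Proof. exact: (prox_in pp). Qed.
Let oracleZ k := (proj2 oracle) _ _ (proj1 (adapted_wrt _ _) (aZ k)) (BZ k).
Let aY k : adapted (n + k).+1 (Y k).
Proof. by apply/adapted_wrt; have [] := oracleZ k. Qed.
Let avZ k : adapted (n + k) (fun w => v (Z k w)).
Proof. by apply/adapted_wrt; have [_ []] := oracleZ k. Qed.
Let au k : adapted (n + k) (u k).
Proof.
apply: mvectB; last exact: aZ.
by apply: (adapted_mono (leq_addr _ _)); exact: (adapted_prox pp aX).
Qed.
Let u2 k w : enorm (u k w) <= 2. Proof. exact: unit_ball_diam. Qed.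

Let vZ_le k w : enorm (v (Z k w)) <= Gf.
Proof.
apply: (limiting_subdiff_norm_le (cp_open cp) _ (cp_f_lipschitz cp)).
- exact: ltW (cp_Gf cp).
- exact: cp_ball_sub cp _ (BZ k w).
- by apply: (proj1 oracle); exact: BZ.
Qed.

(* The answers are bounded only almost surely; they are replaced by 0 outside of
   the event [good], so that all the variables below are bounded everywhere. *)
Let good k := [set w | enorm (Y k w) <= Gf].
Let Y' k w := (\1_(good k) w : R) *: Y k w.

Let past_good k : <<s past (n + k).+1 >> (good k).
Proof.
have := adapted_continuous (aY k) (@continuous_enorm R d).
move=> /(preimage_sub_measurable (S := `]-oo, Gf]%classic)) => /(_ (measurable_itv _)).
congr (<<s _ >> _); apply/seteqP; split=> w /=; by rewrite in_itv.
Qed.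

Let aY' k : adapted (n + k).+1 (Y' k).
Proof.
move=> i; under eq_fun do rewrite mxE.
apply: measurable_funM; last exact: aY.
apply: measurable_indic; exact: past_good.
Qed.

Let Y'_le k w : enorm (Y' k w) <= Gf.
Proof.
rewrite enormZ indicE; case: (boolP (w \in good k)) => [/set_mem|_] /=.
  by rewrite normr1 mul1r.
by rewrite normr0 mul0r ltW// (cp_Gf cp).
Qed.

Let Y'_mean k i A : <<s past (n + k) >> A ->
  \int[P]_(w in A) Y' k w 0 i = \int[P]_(w in A) v (Z k w) 0 i.
Proof.
move=> FA; have [_ [_ /(_ i)[_ _ /(_ A FA) E]] aeY] := oracleZ k.
rewrite /Rintegral [in RHS]E; congr fine.
have mA := sub_sigma_measurable (@past_measurable _) FA.
apply: ae_eq_integral => //.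
- apply/measurable_EFinP; apply: measurable_funTS; exact: (adapted_mvect (aY' k)).
- apply/measurable_EFinP; apply: measurable_funTS; exact: (adapted_mvect (aY k)).
apply: filterS aeY => w Yw _.
by rewrite /Y' indicE mem_set// scale1r.
Qed.

Variable t : R.
Hypothesis t_ge0 : 0 <= t.

Let L k w := \sum_(j < k)
  (t * dot (Y' j w - v (Z j w)) (u j w) - (t * (Gf * enorm (u j w))) ^+ 2 / 2).
Let M k w := expR (L k w).

Let past_L k : measurable_fun setT (L k : g_sigma_algebraType (past (n + k)) -> R).
Proof.
elim: k => [|k IHk].
  by rewrite /L; under eq_fun do rewrite big_ord0; exact: measurable_cst.
rewrite /L; under eq_fun do rewrite big_ord_recr/=.
have au' := adapted_mono (leqnSn _) (au k).
rewrite addnS; apply: measurable_funD; first exact: measurable_past_mono IHk.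
apply: measurable_funB.
  apply: measurable_funM => //; apply: measurable_dot => //.
  apply: mvectB; first exact: aY'.
  exact: adapted_mono (avZ k).
apply: measurable_funM => //; apply: measurable_funX; apply: measurable_funM => //.
by apply: measurable_funM => //; exact: adapted_continuous au' (@continuous_enorm R d).
Qed.

Let past_M k : measurable_fun setT (M k : g_sigma_algebraType (past (n + k)) -> R).
Proof. exact: measurableT_comp (@measurable_expR R) (past_L k). Qed.

Let L_le k w : L k w <= k%:R * (t * (2 * Gf * 2)).
Proof.
rewrite mulr_natl -[X in _ *+ X]card_ord -sumr_const; apply: ler_sum => j _.
apply: (@le_trans _ _ (t * dot (Y' j w - v (Z j w)) (u j w))).
  by rewrite gerBl divr_ge0// sqr_ge0.
apply: ler_wpM2l => //; apply: le_trans (dot_le_enorm _ _) _.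
apply: ler_pM; rewrite ?enorm_ge0//.
apply: le_trans (enormB_le _ _) _.
by rewrite mulr_natl mulr2n; exact: lerD (Y'_le _ _) (vZ_le _ _).
Qed.

Let Ex_M_le1 k : Ex P (M k) <= 1.
Proof.
elim: k => [|k IHk].
  rewrite (_ : M 0%N = fun=> 1) ?Ex_cst//.
  by apply/funext => w; rewrite /M /L big_ord0 expR0.
apply: le_trans IHk.
have -> : M k.+1 = fun w => M k w * expR (t * dot (Y' k w - v (Z k w)) (u k w)
    - (t * (Gf * enorm (u k w))) ^+ 2 / 2).
  by apply/funext => w; rewrite /M /L big_ord_recr/= expRD.
apply: (@exp_supermartingale_step _ _ _ _ P (past (n + k)) (@past_measurable _)
  (M k) (u k) (Y' k) (fun w => v (Z k w)) (expR (k%:R * (t * (2 * Gf * 2)))) 2) => //.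
- by move=> w; rewrite expR_ge0 ler_expR L_le.
- exact: au.
- exact: adapted_mvect (aY' k).
- exact: avZ.
- exact: cp_Gf cp.
- by move=> i A; exact: Y'_mean.
Qed.

Let bad_event (r : R) := (M K @^-1` `[r, +oo[) `|` \bigcup_(k in `I_K) ~` good k.

Let past_bad r : <<s past (n + K) >> (bad_event r).
Proof.
apply: (@measurableU _ (g_sigma_algebraType (past (n + K)))).
  by apply: preimage_sub_measurable => //; exact: measurable_itv.
apply: (@bigcup_measurable _ (g_sigma_algebraType (past (n + K)))) => k kK.
apply: (@measurableC _ (g_sigma_algebraType (past (n + K)))).
have : (n + k < n + K)%N by rewrite ltn_add2l.
by move=> /past_mono; apply; exact: past_good.
Qed.

(* Markov's inequality for the supermartingale. *)
Let bad_le (r : R) : 0 < r -> (P (bad_event r) <= (r^-1)%:E)%E.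
Proof.
move=> r0; have mM : measurable (M K @^-1` `[r, +oo[).
  apply: (sub_sigma_measurable (@past_measurable (n + K))).
  by apply: preimage_sub_measurable => //; exact: measurable_itv.
have mN : measurable (\bigcup_(k in `I_K) ~` good k).
  apply: bigcup_measurable => k _; apply: measurableC.
  exact: (sub_sigma_measurable (@past_measurable _) (past_good k)).
have N0 : P (\bigcup_(k in `I_K) ~` good k) = 0%E.
  apply/(negligibleP _ mN).
  apply: (@negligibleS _ _ _ _ (\bigcup_k ~` good k)).
    by apply: bigcup_subset.
  by apply: negligible_bigcup => k; have [_ _] := oracleZ k.
apply: le_trans (measureU2 _ mM mN) _; rewrite -[leRHS]adde0.
apply: leeD; last by rewrite le_eqVlt; apply/orP; left; apply/eqP; exact: N0.
apply: (@le_trans _ _ (Ex P \1_(M K @^-1` `[r, +oo[))%:E).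
  by rewrite (Ex_indic P mM); exact: lexx.
rewrite lee_fin -[leRHS]mulr1 ler_pdivlMl//.
apply: le_trans (Ex_M_le1 K).
have mMO : measurable_fun setT (M K) := sub_measurable_fun (@past_measurable (n + K)) (past_M K).
have bM : bounded_rv (M K).
  split=> //; exists (expR (K%:R * (t * (2 * Gf * 2)))) => w.
  by rewrite ger0_norm ?expR_ge0// ler_expR L_le.
rewrite -ExZ; last exact: bounded_rv_indic.
apply: Ex_le => // [|w]; first by apply: bounded_rvZ; exact: bounded_rv_indic.
rewrite indicE; case: (boolP (w \in _)) => [/set_mem|_]; last by rewrite mulr0 expR_ge0.
by rewrite /= in_itv/= andbT mulr1.
Qed.

Let GH := Gf + 4 * l + lam * Gg.
Let h k w := Y k w + (2 * l) *: (Z k w - X w) + grad (p \o g) (Z k w).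

Let h_le k w : enorm (Y k w) <= Gf -> enorm (h k w) <= GH.
Proof.
move=> Yk; apply: le_trans (enorm_triangle _ _) _; apply: lerD; last first.
  exact: (grad_softplus_comp_le cp lam_ge0 gam_gt0 (BZ k w)).
apply: le_trans (enorm_triangle _ _) _; apply: lerD => //.
have l0 := cp_l cp; rewrite enormZ ger0_norm; last by rewrite mulr_ge0// ltW.
have := unit_ball_diam (BZ k w) (BX w).
by move=> /(ler_wpM2l (ltW l0)); lra.
Qed.

Let distance_step k w : enorm (Y k w) <= Gf ->
  enorm (Z k.+1 w - zs w) ^+ 2 <= enorm (Z k w - zs w) ^+ 2
    - 2 * (2 / (l * k.+2%:R)) * dot (h k w) (Z k w - zs w)
    + (2 / (l * k.+2%:R)) ^+ 2 * GH ^+ 2.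
Proof.
move=> Yk; set eta := 2 / _.
have le1 : enorm (Z k.+1 w - zs w) <= enorm (Z k w - eta *: h k w - zs w).
  exact: (proj_nonexpansive ball_proj_problem (proj_ballP _) (proj_in_fixed (Bzs w))).
have le2 : enorm (Z k.+1 w - zs w) ^+ 2 <= enorm (Z k w - eta *: h k w - zs w) ^+ 2.
  by rewrite ler_pXn2r ?nnegrE ?enorm_ge0.
apply: le_trans le2 _.
rewrite [Z k w - _ - zs w]addrAC (enorm_sqrB (Z k w - zs w)) enormZ exprMn.
rewrite real_normK ?num_real// dotZr (dotC (_ - zs w)).
have : eta ^+ 2 * enorm (h k w) ^+ 2 <= eta ^+ 2 * GH ^+ 2.
  apply: ler_wpM2l; first exact: sqr_ge0.
  rewrite ler_pXn2r ?nnegrE ?enorm_ge0//; first exact: h_le.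
  exact: le_trans (enorm_ge0 _) (h_le k w Yk).
lra.
Qed.

Let gap_le k w :
  (H w (Z k w) - H w (zs w)) + l / 2 * enorm (Z k w - zs w) ^+ 2 <=
  dot (h k w) (Z k w - zs w) + dot (Y k w - v (Z k w)) (u k w).
Proof.
have := prox_objective_minorant cp lam_ge0 gam_gt0 (X w) (BZ k w) (Bzs w)
  (proj1 oracle _ (BZ k w)).
rewrite !prox_objectiveE -/F -/(H w (Z k w)) -/(H w (zs w)).
set hb := v _ + _ + _.
have -> : h k w = hb + (Y k w - v (Z k w)).
  by rewrite /h /hb [in RHS]addrC !addrA subrK.
have -> : dot (hb + (Y k w - v (Z k w))) (Z k w - zs w) =
    - dot hb (zs w - Z k w) - dot (Y k w - v (Z k w)) (zs w - Z k w).
  by rewrite dotDl -(opprB (zs w)) !dotNr.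
rewrite (enormBC (zs w)) -/(u k w); lra.
Qed.

(* The compensator of the supermartingale is [t] times the strong convexity kept
   aside in the regret. *)
Let log_bound (r : R) w : 0 < r -> t * Gf ^+ 2 = l / 2 -> ~ bad_event r w ->
  (forall k, (k < K)%N -> enorm (Y k w) <= Gf) /\
  t * \sum_(k < K) (dot (Y k w - v (Z k w)) (u k w) - l / 4 * enorm (Z k w - zs w) ^+ 2)
    <= ln r.
Proof.
move=> r0 tE nbad.
have Yk k : (k < K)%N -> enorm (Y k w) <= Gf.
  by move=> kK; apply: contrapT => nk; apply: nbad; right; exists k.
split=> //.
have Mr : M K w < r.
  by rewrite ltNge; apply/negP => Mr; apply: nbad; left; rewrite /= in_itv/= Mr.
rewrite -ler_expR lnK ?posrE//; apply: ltW; apply: le_lt_trans Mr.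
rewrite ler_expR big_distrr le_eqVlt; apply/orP; left; apply/eqP.
apply: eq_bigr => k _ /=.
have -> : Y' k w = Y k w by rewrite /Y' indicE mem_set ?scale1r//; exact: Yk.
have -> : (t * (Gf * enorm (u k w))) ^+ 2 = t * (t * Gf ^+ 2) * enorm (u k w) ^+ 2 by ring.
by rewrite tE (enormBC (Z k w)) -/(u k w); field.
Qed.

Let average_gap (r : R) w : 1 <= r -> 0 < t -> t * Gf ^+ 2 = l / 2 -> ~ bad_event r w ->
  H w (K%:R^-1 *: \sum_(k < K) Z k w) <= H w (zs w) +
  (l + GH ^+ 2 / l * (ln K.+1%:R + 2 * ln r)) / K%:R.
Proof.
move=> r1 t0 tE nbad.
have l0 := cp_l cp; have Gf0 := cp_Gf cp; have Gg0 := cp_Gg cp.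
have K0 : (0 : R) < K%:R by rewrite ltr0n.
have [Yk logr] := log_bound r w (lt_le_trans ltr01 r1) tE nbad.
have reg := @psm_regret R l GH K (fun k => enorm (Z k w - zs w) ^+ 2)
  (fun k => H w (Z k w) - H w (zs w)) (fun k => dot (Y k w - v (Z k w)) (u k w))
  (fun k => dot (h k w) (Z k w - zs w)) l0
  (fun k kK => distance_step k w (Yk k kK)) (fun k _ => gap_le k w) (sqr_ge0 _).
have a0 : enorm (Z 0 w - zs w) ^+ 2 <= 4.
  have := unit_ball_diam (BZ 0 w) (Bzs w); have := enorm_ge0 (Z 0 w - zs w); nra.
have cvxH : weakly_convex_on unit_ball 0 (H w).
  by apply: weakly_convex_le (prox_obj_weakly_convex pp (X w)); lra.
have [_] := convex_average K.-1 (z := fun k => Z k w) (@convex_unit_ball R d)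
  cvxH (fun k => BZ k w).
rewrite prednK// => /le_trans; apply.
rewrite mulrC ler_pdivrMr// mulrDl divfK ?gt_eqF//.
move: reg; rewrite sumrB sumr_const card_ord => reg.
have noise : \sum_(k < K) (dot (Y k w - v (Z k w)) (u k w) -
    l / 4 * enorm (Z k w - zs w) ^+ 2) <= GH ^+ 2 / l * (2 * ln r).
  rewrite -(ler_pM2l t0); apply: le_trans logr _.
  have lr0 : 0 <= ln r by exact: ln_ge0.
  have GG : Gf ^+ 2 <= GH ^+ 2.
    rewrite ler_pXn2r ?nnegrE ?ltW//; rewrite /GH.
      by have := mulr_ge0 lam_ge0 (ltW Gg0); lra.
    by have := mulr_ge0 lam_ge0 (ltW Gg0); lra.
  have : t * Gf ^+ 2 * (2 / l) <= t * GH ^+ 2 * (2 / l).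
    by apply: ler_wpM2r; [exact/ltW/divr_gt0|rewrite ler_pM2l].
  rewrite tE (_ : l / 2 * (2 / l) = 1); last by field; rewrite gt_eqF.
  by move=> /(ler_wpM2r lr0); rewrite mul1r; lra.
move: reg noise a0; rewrite -[H w (zs w) *+ K]mulr_natr.
set S1 := \sum_(k < K) H w _; set S2 := \sum_(k < K) (_ - _).
set A0 := enorm _ ^+ 2; set Q := GH ^+ 2 / l.
move=> reg noise a0; have := ler_wpM2l (ltW l0) a0; lra.
Qed.

Lemma inner_event_of_tilt (r : R) : 1 <= r -> 0 < t -> t * Gf ^+ 2 = l / 2 ->
  exists E : set Om, [/\ <<s past (n + K) >> E, (P E <= (r^-1)%:E)%E &
    forall w, ~ E w -> H w (K%:R^-1 *: \sum_(k < K) Z k w) <= H w (zs w) +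
      (l + GH ^+ 2 / l * (ln K.+1%:R + 2 * ln r)) / K%:R].
Proof.
move=> r1 t0 tE; exists (bad_event r); split=> [||w]; first exact: past_bad.
  by apply: bad_le; exact: lt_le_trans r1.
exact: average_gap.
Qed.

End OneCall.

Set Implicit Arguments.

(** The tilt [l / (2 Gf^2)] makes the variance proxy of the noise equal to the
    part of strong convexity kept aside in the regret bound. *)
Lemma psm_high_probability n X (delta : R) :
  adapted n X -> (forall w, unit_ball (X w)) -> 0 < delta -> delta <= 1 ->
  exists E : set Om, [/\ <<s past (n + K) >> E, (P E <= delta%:E)%E &
    forall w, ~ E w ->
      prox_obj (fun z => f z + p (g z)) l (X w)
        (K%:R^-1 *: \sum_(k < K) psm_point g p (2 * l) l (answer w) n (X w) k) <=
      prox_obj (fun z => f z + p (g z)) l (X w)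
        (prox unit_ball (fun z => f z + p (g z)) l (X w)) +
      U_K K l (Gf + 4 * l + lam * Gg) delta].
Proof.
move=> aX BX d0 d1; have l0 := cp_l cp; have Gf0 := cp_Gf cp.
have t0 : 0 < l / (2 * Gf ^+ 2) by rewrite divr_gt0// mulr_gt0// exprn_gt0.
have tE : l / (2 * Gf ^+ 2) * Gf ^+ 2 = l / 2 by field; rewrite gt_eqF.
have r1 : 1 <= 1 / delta by rewrite ler_pdivlMr// mul1r.
have [E [FE PE HE]] := inner_event_of_tilt n X aX BX _ (ltW t0) _ r1 t0 tE.
by exists E; split=> //; rewrite -[delta]invrK -[delta^-1]mul1r.
Qed.

End StochasticInner.

(** * Descent of the exact penalty along the outer loop *)

Section OuterDescent.
Context {R : realType} {d : nat}.
Local Notation V := 'rV[R]_d.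
Variables (f g : V -> R) (U : set V) (l Gf Gg sigma lam gam : R).
Hypothesis cp : constrained_problem f g U l Gf Gg sigma.
Hypotheses (lam_ge0 : 0 <= lam) (gam_gt0 : 0 < gam).
Hypothesis lam_sigma : Gf + 4 * l <= lam * sigma.
Implicit Types (x y z q : V) (e : R).

Let C : set V := [set x | g x <= 0].
Let p := softplus lam gam.
Let pp : prox_problem unit_ball (fun z => f z + p (g z)) l l :=
  penalized_prox_problem cp lam_ge0 gam_gt0.

Definition exact_penalized z : R := f z + lam * Num.max 0 (g z).

Lemma exact_penalized_in z : C z -> exact_penalized z = f z.
Proof. by move=> Cz; rewrite /exact_penalized max_l// mulr0 addr0. Qed.

Lemma exact_penalized_ge z : f z <= exact_penalized z.
Proof. by rewrite lerDl mulr_ge0// le_max lexx. Qed.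

Lemma exact_penalized_weakly_convex : weakly_convex_on unit_ball l exact_penalized.
Proof.
rewrite -[X in weakly_convex_on _ X _]addr0; apply: weakly_convexD.
  exact: weakly_convex_sub (cp_ball_sub cp) (cp_f_weakly_convex cp).
apply: convex_weakly_convex0; apply/convex_functionP => t x y t0 t1 Bx By.
have /convex_functionP cg := cp_g_convex cp.
have := cg t x y t0 t1 (cp_ball_sub cp Bx) (cp_ball_sub cp By).
set gz := g _ => gle.
suff : Num.max 0 gz <= t * Num.max 0 (g x) + (1 - t) * Num.max 0 (g y).
  by move=> /(ler_wpM2l lam_ge0); lra.
have t2 : 0 <= 1 - t by rewrite subr_ge0.
have x0 : 0 <= Num.max 0 (g x) by rewrite le_max lexx.
have y0 : 0 <= Num.max 0 (g y) by rewrite le_max lexx.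
rewrite ge_max addr_ge0 ?mulr_ge0//=; apply: le_trans gle _.
by apply: lerD; apply: ler_wpM2l => //; rewrite le_max lexx orbT.
Qed.

Lemma stationary_point_in x : C (Q C f l x).
Proof. exact: prox_in (stationarity_prox_problem cp) x. Qed.

(** The stationary point of [x] also minimizes the exact penalty over the ball,
    which gives quadratic growth around it on the whole ball. *)
Lemma exact_penalized_growth x z : unit_ball x -> unit_ball z ->
  prox_obj f l x (Q C f l x) + l / 2 * enorm (z - Q C f l x) ^+ 2 <=
  prox_obj exact_penalized l x z.
Proof.
move=> Bx Bz; set q := Q C f l x; have Cq : C q := stationary_point_in x.
have Eq : prox_obj f l x q = prox_obj exact_penalized l x q.
  by rewrite /prox_obj exact_penalized_in.
rewrite Eq; apply: (argmin_growth (@convex_unit_ball R d)) => //.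
  have := weakly_convexD exact_penalized_weakly_convex (@weakly_convex_sqr R d unit_ball l x).
  by rewrite (_ : l + - (2 * l) = - l)//; ring.
split; first exact: (cp_sub_ball cp).
by move=> y By; rewrite -Eq; exact: exact_penalty cp _ _ _ Bx By lam_sigma.
Qed.

(** An approximate minimizer of the smoothed objective is one of the exact
    penalty, up to the smoothing error [gam * ln 2]. *)
Lemma approximate_prox_step x x' e : unit_ball x -> unit_ball x' ->
  prox_obj (fun z => f z + p (g z)) l x x' <=
    prox_obj (fun z => f z + p (g z)) l x (prox unit_ball (fun z => f z + p (g z)) l x) + e ->
  l / 2 * enorm (x' - Q C f l x) ^+ 2 <= e + gam * ln 2 /\
  l / 2 * enorm (x - Q C f l x) ^+ 2 <=
    exact_penalized x - exact_penalized x' + (e + gam * ln 2).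
Proof.
move=> Bx Bx' ale; set q := Q C f l x; have Cq : C q := stationary_point_in x.
have l0 := cp_l cp.
have h1 : prox_obj exact_penalized l x x' <= prox_obj f l x q + (e + gam * ln 2).
  apply: (@le_trans _ _ (prox_obj (fun z => f z + p (g z)) l x x')).
    by rewrite lerD2r lerD2l; exact: softplus_ge.
  apply: le_trans ale _.
  have := proj2 (proxP pp x) q (cp_sub_ball cp Cq).
  have := softplus_le (g q) gam_gt0 lam_ge0; rewrite -/p (max_l Cq) mulr0 add0r.
  by rewrite /prox_obj => h2 h3; lra.
have h2 := exact_penalized_growth Bx Bx'; have h3 := exact_penalized_growth Bx Bx.
rewrite -/q in h2 h3; split; first lra.
have h4 : 0 <= l * enorm (x' - x) ^+ 2 by rewrite mulr_ge0 ?sqr_ge0// ltW.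
move: h1 h3; rewrite /prox_obj subrr enorm0 expr0n mulr0; lra.
Qed.

Lemma min_on_ball_le x : unit_ball x -> min_on unit_ball f <= f x.
Proof.
move=> Bx; apply: ge_inf; last by exists x.
exists (f x - Gf * 2) => _ [y By <-].
have := cp_f_lipschitz cp (cp_ball_sub cp Bx) (cp_ball_sub cp By).
have := ler_wpM2l (ltW (cp_Gf cp)) (unit_ball_diam Bx By).
by rewrite ler_norml => h /andP[_ h2]; lra.
Qed.

Lemma outer_telescope (X : nat -> V) (T : nat) e : (forall t, unit_ball (X t)) ->
  C (X 0%N) ->
  (forall t, (t < T)%N -> prox_obj (fun z => f z + p (g z)) l (X t) (X t.+1) <=
    prox_obj (fun z => f z + p (g z)) l (X t)
      (prox unit_ball (fun z => f z + p (g z)) l (X t)) + e) ->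
  l / 2 * \sum_(t < T) enorm (X t - Q C f l (X t)) ^+ 2 <=
    f (X 0%N) - min_on unit_ball f + T%:R * (e + gam * ln 2).
Proof.
move=> BX C0 step.
suff : l / 2 * \sum_(t < T) enorm (X t - Q C f l (X t)) ^+ 2 <=
    exact_penalized (X 0%N) - exact_penalized (X T) + T%:R * (e + gam * ln 2).
  have := exact_penalized_ge (X T); have := min_on_ball_le (BX T).
  rewrite (exact_penalized_in C0); set Te := _%:R * _; lra.
elim: T step => [|T IH] step; first by rewrite big_ord0 mulr0 mul0r subrr addr0.
have := IH (fun t tT => step t (ltnW tT)).
have [_] := approximate_prox_step (BX T) (BX T.+1) (step T (ltnSn T)).
rewrite big_ord_recr/= -natr1; lra.
Qed.

(** ** Stationarity of the output *)

Lemma stationarityE x : stationarity C f l x = 2 * l * enorm (x - Q C f l x).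
Proof.
have [_ gE] := envelope_differentiable (stationarity_prox_problem cp) x.
rewrite /stationarity (_ : grad _ x = (2 * l) *: (x - Q C f l x)); last exact: gE.
by rewrite enormZ ger0_norm// mulr_ge0// ltW// (cp_l cp).
Qed.

Lemma stationary_lipschitz x y : enorm (Q C f l x - Q C f l y) <= 2 * enorm (x - y).
Proof.
have l0 := cp_l cp; have := prox_lipschitz (stationarity_prox_problem cp) x y.
rewrite -/(Q C f l x) -/(Q C f l y) (_ : 2 * l - l = l); last by ring.
by rewrite [2 * l]mulrC -mulrA ler_pM2l.
Qed.

Lemma stationarity_continuous : continuous (stationarity C f l).
Proof.
have l0 := cp_l cp.
have half (x y q r : V) : enorm (q - r) <= 2 * enorm (x - y) ->
    enorm (x - q) - enorm (y - r) <= 3 * enorm (x - y).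
  move=> qr; have -> : x - q = (y - r) + ((x - y) - (q - r)).
    by apply/rowP => i; rewrite !mxE; ring.
  have h1 := enorm_triangle (y - r) ((x - y) - (q - r)).
  by have h2 := enormB_le (x - y) (q - r); lra.
move=> x; apply: (@continuous_enorm_lip _ _ _ (6 * l)); near=> y.
rewrite !stationarityE -mulrBr normrM (ger0_norm (mulr_ge0 _ (ltW l0)))//.
have h1 := half _ _ _ _ (stationary_lipschitz y x).
have h2 := half _ _ _ _ (stationary_lipschitz x y).
rewrite (enormBC x y) in h2.
move: (Q C f l y) (Q C f l x) h1 h2 => q r h1 h2.
have h3 : `|enorm (x - r) - enorm (y - q)| <= 3 * enorm (y - x).
  by rewrite ler_norml; apply/andP; split; lra.
by rewrite distrC; have := ler_wpM2l (ltW l0) h3; lra.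
Unshelve. all: by end_near. Qed.

(** The output [y] is close to the stationary point [q] of the last prox center
    [x], since projecting the inner solution [x'] does not increase its distance
    to [q]; and [q] is nearly its own stationary point when [x] is close to it. *)
Lemma stationarity_output_le x x' y : proj_set C x' y ->
  stationarity C f l y <=
  6 * l * enorm (x' - Q C f l x) + 4 * l * enorm (x - Q C f l x).
Proof.
move=> Py; set q := Q C f l x; have l0 := cp_l cp.
have yq : enorm (y - q) <= enorm (x' - q).
  exact: (proj_nonexpansive (sublevel_proj_problem cp) Py (proj_in_fixed (stationary_point_in x))).
have h1 := enorm_triangleB y q (Q C f l y).
have h2 := stationary_lipschitz x y; rewrite -/q in h2.
have h3 := enorm_triangleB x q y; rewrite (enormBC q y) in h3.
rewrite stationarityE.
clearbody q; move: (Q C f l y) h1 h2 => r h1 h2.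
have : enorm (y - r) <= 3 * enorm (x' - q) + 2 * enorm (x - q) by lra.
by move=> /(ler_wpM2l (ltW l0)); lra.
Qed.

End OuterDescent.

(** * The random output index *)

Section RandomIndex.
Context {R : realType} {dOm : measure_display} {Om : measurableType dOm}.
Variables (P : probability Om R) (J : {mfun Om >-> nat}) (T : nat).
Variable G : set (set Om).
Hypothesis G_measurable : G `<=` measurable.
Hypothesis J_uniform : uniform_on P J (iota 1 T).
Hypothesis J_independent : independent_of P J <<s G >>.

Lemma measurable_index j : measurable (J @^-1` [set j]).
Proof. by rewrite -[X in measurable X]setTI; exact: measurable_funP. Qed.

Lemma measurable_indexed_event (d : nat) (Y : nat -> Om -> 'rV[R]_d)
    (h : 'rV[R]_d -> R) (c : R) :
  (forall j, mvect (Y j)) -> continuous h -> measurable [set w | h (Y (J w) w) <= c].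
Proof.
move=> mY ch.
rewrite (_ : [set w | _] = \bigcup_j (J @^-1` [set j] `&` [set w | h (Y j w) <= c])).
  apply: bigcup_measurable => j _; apply: measurableI; first exact: measurable_index.
  have := measurable_continuous_comp (mY j) ch measurableT (measurable_itv `]-oo, c]).
  by rewrite setTI; congr measurable; apply/funext => w; rewrite /= in_itv.
by apply/seteqP; split=> [w hw|w [j _ [<-]]//]; exists (J w).
Qed.

(** If outside of an event of probability at most 1/6 at most a sixth of the
    indices is bad, then a uniform independent index is good with probability at
    least 25/36. *)
Lemma uniform_index_success (E : set Om) (B : nat -> set Om) (S : set Om) :
  (0 < T)%N -> <<s G >> E -> (forall t, <<s G >> (B t)) -> measurable S ->
  (P E <= (6^-1)%:E)%E ->
  (forall w, ~ E w -> \sum_(t < T) \1_(B t) w <= T%:R / 6 :> R) ->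
  (forall t w, (t < T)%N -> J w = t.+1 -> ~ E w -> ~ B t w -> S w) ->
  ((2 / 3)%:E <= P S)%E.
Proof.
move=> T0 GE GB mS PE fewB succ.
have GC A : <<s G >> A -> <<s G >> (~` A).
  exact: (@measurableC _ (g_sigma_algebraType G)).
pose A t := ~` E `&` ~` B t.
have GA t : <<s G >> (A t).
  by apply: (@measurableI _ (g_sigma_algebraType G)); exact: GC.
have mG D : <<s G >> D -> measurable D := @sub_sigma_measurable _ _ G G_measurable D.
have T0R : (0 : R) < T%:R by rewrite ltr0n.
pose H t := J @^-1` [set t.+1] `&` A t.
have mH t : measurable (H t) by apply: measurableI; [exact: measurable_index|exact: mG].
have PH (t : 'I_T) : Ex P \1_(H t) = T%:R^-1 * Ex P \1_(A t).
  apply: EFin_inj; rewrite EFinM (Ex_indic P (mH t)) (Ex_indic P (mG _ (GA t))).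
  have := J_independent t.+1 (GA t); rewrite J_uniform ?size_iota//.
  by rewrite mem_iota/= add1n ltnS.
have sumH : \sum_(t < T) Ex P \1_(H t) <= Ex P \1_S.
  rewrite -Ex_sum; last by move=> t; exact: bounded_rv_indic.
  apply: Ex_le => [||w]; [|exact: bounded_rv_indic|].
    by apply: bounded_rv_sum => t; exact: bounded_rv_indic.
  have H0 (t : 'I_T) : J w != t.+1 -> \1_(H t) w = 0 :> R.
    by move=> /eqP Jt; rewrite indicE memNset// => -[].
  have [[t Jt]|noJ] := pselect (exists t : 'I_T, J w = t.+1).
    rewrite (bigD1 t)//= big1 ?addr0 => [|s st].
      rewrite !indicE ler_nat; case: (boolP (w \in H t)) => // /set_mem [_ [nE nB]].
      by rewrite mem_set//; apply: (succ t).
    by apply: H0; rewrite Jt eqSS; apply: contra st => /eqP E'; apply/eqP/val_inj.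
  rewrite big1 ?indicE// => t _; apply: H0; apply/eqP => Jt.
  by apply: noJ; exists t.
have sumA : 5 / 6 * T%:R * Ex P \1_(~` E) <= \sum_(t < T) Ex P \1_(A t).
  have mE := mG _ (GC _ GE).
  rewrite -Ex_sum; last by move=> t; apply: bounded_rv_indic; exact: mG.
  rewrite -ExZ; last exact: bounded_rv_indic.
  apply: Ex_le => [||w]; first by apply: bounded_rvZ; exact: bounded_rv_indic.
    by apply: bounded_rv_sum => t; apply: bounded_rv_indic; exact: mG.
  have [nE|nE] := boolP (w \in ~` E); rewrite indicE; last first.
    rewrite (negbTE nE) mulr0; apply: sumr_ge0 => t _.
    by rewrite indicE ler0n.
  rewrite nE mulr1; have {}nE : ~ E w by move/set_mem: nE.
  have := fewB w nE.
  suff -> : \sum_(t < T) \1_(A t) w = T%:R - \sum_(t < T) \1_(B t) w :> R by lra.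
  rewrite -[T%:R](_ : \sum_(t < T) 1 = T%:R); last by rewrite sumr_const card_ord.
  rewrite -sumrB; apply: eq_bigr => t _; rewrite !indicE.
  have [wB|wB] := boolP (w \in B t).
    by rewrite subrr memNset// => -[_]; apply; exact: set_mem.
  by rewrite subr0 mem_set//; split=> //; move/negP: wB => wB /mem_set.
have EC : 5 / 6 <= Ex P \1_(~` E).
  rewrite -lee_fin (Ex_indic P (mG _ (GC _ GE))) (probability_setC P (mG _ GE)).
  have /fineK fE := fin_num_measure P E (mG _ GE).
  move: PE; rewrite -fE -EFinB !lee_fin => PE; lra.
rewrite -(Ex_indic P mS) lee_fin; apply: le_trans sumH.
under eq_bigr do rewrite PH.
rewrite -big_distrr/= ler_pdivlMl//; apply: le_trans sumA.
have := ler_wpM2l (ltW T0R) EC; lra.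
Qed.

End RandomIndex.

(** * Choice of the parameters *)

Section ParameterChoice.
Context {R : realType}.
Implicit Types (l Gf Gg sigma Delta eps : R).

Lemma num_outer_gt0 l Delta eps : (0 < num_outer l Delta eps)%N.
Proof. by rewrite /num_outer leq_max. Qed.

Lemma natr_absz_ceil_ge (x : R) : x <= `|Num.ceil x|%N%:R.
Proof. by rewrite natr_absz (le_trans (ceil_ge _))// ler_int ler_norm. Qed.

Lemma natr_absz_ceil_lt (x : R) : 0 <= x -> `|Num.ceil x|%N%:R < x + 1.
Proof.
move=> x0; have c0 : 0 <= Num.ceil x by rewrite ceil_ge0 (lt_le_trans _ x0)// ltrN10.
by rewrite natr_absz ger0_norm//; have := ceil_itv x; rewrite intrD => /andP[]; lra.
Qed.

Lemma num_outer_ge l Delta eps :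
  1000 * l * Delta / eps ^+ 2 <= (num_outer l Delta eps)%:R.
Proof.
apply: (@le_trans _ _ (`|Num.ceil (1000 * l * Delta / eps ^+ 2)|%N)%:R).
  exact: natr_absz_ceil_ge.
by rewrite ler_nat leq_maxr.
Qed.

Lemma num_outer_le l Delta eps : 0 <= l * Delta / eps ^+ 2 ->
  (num_outer l Delta eps)%:R <= 1003 * (1 + l * Delta / eps ^+ 2).
Proof.
rewrite /num_outer (_ : 1000 * l * Delta / eps ^+ 2 = 1000 * (l * Delta / eps ^+ 2)); last first.
  by rewrite !mulrA.
set r := l * Delta / eps ^+ 2 => r0.
have r1 : 0 <= 1000 * r by exact: mulr_ge0 (ler0n _ _) r0.
have cle := natr_absz_ceil_lt r1.
have : (maxn 2 `|Num.ceil (1000 * r)|)%:R <= 2 + `|Num.ceil (1000 * r)|%N%:R :> R.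
  by rewrite -natrD ler_nat geq_max leq_addr leq_addl.
by move: cle; set c : R := `|_|%N%:R; lra.
Qed.

Lemma ln_le_div (x N : R) : 0 < x -> 0 < N -> ln x <= x / N + ln N.
Proof.
move=> x0 N0; have xN0 : 0 < x / N by rewrite divr_gt0.
have : ln (x / N) <= x / N by exact/ltW/ln_sublinear.
by rewrite ln_div ?posrE//; lra.
Qed.

Lemma linear_beats_log (B D c : R) : 0 < D -> 0 < c ->
  exists M, 2 <= M /\ B + D * ln (M + 2) <= c * M.
Proof.
move=> D0 c0; have cn : c != 0 by rewrite gt_eqF.
have Dn : D != 0 by rewrite gt_eqF.
(* the tangent of ln at N has slope c / (2 D) *)
pose N := 2 * D / c; have N0 : 0 < N by rewrite /N divr_gt0// mulr_gt0.
pose M := 2 * (`|B| + D * `|ln N| + c) / c.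
have cM : c * M = 2 * (`|B| + D * `|ln N| + c) by rewrite /M; field.
have b0 : 0 <= `|B| by [].
have d0 : 0 <= D * `|ln N| by rewrite mulr_ge0// ltW.
have M2 : 2 <= M by rewrite -(ler_pM2l c0) cM; lra.
exists M; split=> //; clearbody M.
have M20 : 0 < M + 2 by lra.
have := ler_wpM2l (ltW D0) (ln_le_div M20 N0).
have -> : D * ((M + 2) / N + ln N) = c * M / 2 + c + D * ln N.
  by rewrite mulrDr; congr (_ + _); rewrite /N; field; rewrite Dn cn.
have := ler_wpM2l (ltW D0) (ler_norm (ln N)).
have := ler_norm B; lra.
Qed.

Lemma e_star_ge l Gf : 0 < l -> 0 < Gf -> exists c, 0 < c /\
  forall eps, 0 < eps -> eps <= 1 -> c * eps ^+ 2 <= e_star l Gf eps.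
Proof.
move=> l0 Gf0; rewrite /e_star.
have : 0 < 4000 * l by apply: mulr_gt0 l0; rewrite ltr0n.
have : 0 < 60 * l by apply: mulr_gt0 l0; rewrite ltr0n.
have GF0 : 0 < G_F l Gf by apply: addr_gt0 Gf0 (mulr_gt0 _ l0); rewrite ltr0n.
move: (4000 * l) (60 * l) (G_F l Gf) GF0 => a b G GF0 b0 a0.
exists (Num.min a^-1 (G / b)); split=> [|eps eps0 eps1].
  by rewrite lt_min invr_gt0 a0 divr_gt0.
have e20 : 0 <= eps ^+ 2 := sqr_ge0 eps.
have ee : eps ^+ 2 <= eps by rewrite expr2 ler_piMl// ltW.
have Gb : 0 <= G / b by rewrite divr_ge0// ltW.
rewrite le_min; apply/andP; split.
  by rewrite [leRHS]mulrC ler_wpM2r// ge_min lexx.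
apply: (@le_trans _ _ (G / b * eps)); last by rewrite mulrAC.
apply: (@le_trans _ _ (G / b * eps ^+ 2)); last by rewrite ler_wpM2l.
by rewrite ler_wpM2r// ge_min lexx orbT.
Qed.

Section Accuracy.
Variables (eps : R).
Hypotheses (eps0 : 0 < eps) (eps1 : eps <= 1).

Let L := 1 + ln (1 / eps).

Lemma invr_sqr_ge1 : 1 <= eps ^- 2.
Proof. by rewrite invf_ge1 ?exprn_gt0// expr_le1// ltW. Qed.

Lemma log_factor_ge1 : 1 <= L.
Proof. by rewrite lerDl ln_ge0// ler_pdivlMr// mul1r. Qed.

Lemma soft_factor_ge1 : 1 <= L * eps ^- 2.
Proof. by rewrite -[1]mulr1; apply: ler_pM => //; [exact: log_factor_ge1|exact: invr_sqr_ge1]. Qed.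

Lemma ln_inv_sqr : ln (eps ^- 2) = 2 * (L - 1).
Proof. by rewrite -exprVn lnXn ?invr_gt0// /L div1r mulr_natl addrAC subrr add0r. Qed.

Lemma inner_bound_ge2 (M : R) : 2 <= M -> 2 <= M * L * eps ^- 2.
Proof. by move=> M2; rewrite -[2]mulr1 -mulrA; apply: ler_pM => //; exact: soft_factor_ge1. Qed.

Lemma log_outer_le (A t : R) : 1 <= A -> 0 < t -> t <= A * eps ^- 2 ->
  ln (6 * t) <= (ln (6 * A) + 2) * L.
Proof.
move=> A1 t0 tA; have A0 : 0 < A by apply: lt_le_trans A1.
have V0 : 0 < eps ^- 2 by rewrite invr_gt0 exprn_gt0.
have A6 : 0 < 6 * A by rewrite mulr_gt0.
apply: (@le_trans _ _ (ln (6 * A * eps ^- 2))).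
  by rewrite ler_ln ?posrE ?mulr_gt0// -mulrA ler_pM2l.
rewrite lnM ?posrE// ln_inv_sqr.
have a0 : 0 <= ln (6 * A) by rewrite ln_ge0//; lra.
have := ler_wpM2l a0 log_factor_ge1.
by move: (ln (6 * A)) => a; clear; lra.
Qed.

Lemma log_inner_le (M k : R) : 2 <= M -> 0 <= k -> k <= M * L * eps ^- 2 + 1 ->
  ln (k + 1) <= (ln (M + 2) + 3) * L.
Proof.
move=> M2 k0 kx; have L1 := log_factor_ge1.
have V0 : 0 < eps ^- 2 by rewrite invr_gt0 exprn_gt0.
have L0 : 0 < L by lra.
have M20 : 0 < M + 2 by lra.
apply: (@le_trans _ _ (ln ((M + 2) * L * eps ^- 2))).
  rewrite ler_ln ?posrE ?mulr_gt0//; last by lra.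
  have := soft_factor_ge1; move: kx; rewrite -!mulrA [(M + 2) * _]mulrDl.
  by move: (L * eps ^- 2) => u; move: (M * u) => w; lra.
rewrite !lnM ?posrE ?mulr_gt0// ln_inv_sqr.
have lL : ln L <= L by exact/ltW/ln_sublinear.
have a0 : 0 <= ln (M + 2) by rewrite ln_ge0//; lra.
by have := ler_wpM2l a0 L1; move: (ln L) L lL L1 (ln _) a0 => a b ? ? c ? ?; lra.
Qed.

End Accuracy.

Lemma num_outer_fixed_le l Delta eps : 0 < l -> 0 <= Delta -> 0 < eps -> eps <= 1 ->
  (num_outer l Delta eps)%:R <= 1003 * (1 + l * Delta) * eps ^- 2.
Proof.
move=> l0 Delta0 eps0 eps1; have e2 := invr_sqr_ge1 eps0 eps1.
have h : 0 <= l * Delta by rewrite mulr_ge0// ltW.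
apply: le_trans (num_outer_le _) _; first by rewrite mulr_ge0// (le_trans ler01).
rewrite -[leRHS]mulrA; apply: ler_wpM2l; first exact: ler0n.
by rewrite mulrDl mul1r lerD2r.
Qed.

(** With [L = 1 + ln (1 / eps)], both logarithms in the inner accuracy are
    [O(L)] for [K] close to [M * L / eps ^ 2], so that the accuracy of order
    [eps ^ 2] is reached once the constant [M] is large enough. *)
Lemma parameter_choice l Gf Gg sigma Delta :
  0 < l -> 0 < Gf -> 0 < Gg -> 0 < sigma -> 0 <= Delta ->
  exists (cK cTK : R) (aK aTK : nat),
  forall eps, 0 < eps -> eps <= 1 -> exists K : nat,
    [/\ inner_ok l Gf Gg sigma Delta eps K,
        K%:R <= soft_bound cK aK 2 eps
      & (num_outer l Delta eps * K)%:R <= soft_bound cTK aTK 4 eps].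
Proof.
move=> l0 Gf0 Gg0 sigma0 Delta0.
have [c [c0 star]] := e_star_ge l0 Gf0.
have D0 : 0 < G_H l Gf Gg sigma ^+ 2 / l.
  rewrite divr_gt0// exprn_gt0// /G_H ltr_wpDr//; last first.
    by apply: addr_gt0 Gf0 (mulr_gt0 _ l0); rewrite ltr0n.
  apply: mulr_ge0; last exact: ltW.
  apply: divr_ge0; last exact: ltW.
  by apply: mulr_ge0 => //; rewrite addr_ge0 ?mulr_ge0// ltW.
set D := G_H l Gf Gg sigma ^+ 2 / l in D0.
have A1 : 1 <= 1003 * (1 + l * Delta) by have := mulr_ge0 (ltW l0) Delta0; lra.
set A := 1003 * (1 + l * Delta) in A1.
have [M [M2 Mc]] := linear_beats_log (l + ln 2 + 3 * D + 2 * D * (ln (6 * A) + 2)) D0 c0.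
exists (M + 1), (A * (M + 1)), 1%N, 1%N => eps eps0 eps1.
have TA : (num_outer l Delta eps)%:R <= A * eps ^- 2 by exact: num_outer_fixed_le.
have T0 : (0 : R) < (num_outer l Delta eps)%:R by rewrite ltr0n num_outer_gt0.
have x2 := inner_bound_ge2 eps0 eps1 M2.
have L1 := log_factor_ge1 eps0 eps1.
have V1 := soft_factor_ge1 eps0 eps1.
have lT := log_outer_le eps0 eps1 A1 T0 TA.
have e0 : 0 < eps ^+ 2 by rewrite exprn_gt0.
pose x := M * (1 + ln (1 / eps)) * eps ^- 2; rewrite -/x in x2.
have Kx := natr_absz_ceil_ge x.
have x0 : 0 <= x by lra.
have K1 := ltW (natr_absz_ceil_lt x0).
exists `|Num.ceil x|%N; move: `|Num.ceil x|%N Kx K1 => K Kx K1.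
have K0 : 0 < K%:R :> R by lra.
have lK := log_inner_le eps0 eps1 M2 (ltW K0) K1; rewrite natr1 in lK.
have Kle : K%:R <= soft_bound (M + 1) 1 2 eps.
  apply: le_trans K1 _; rewrite /soft_bound expr1 /x.
  have -> : (M + 1) * eps ^- 2 * (1 + ln (1 / eps)) =
      M * (1 + ln (1 / eps)) * eps ^- 2 + (1 + ln (1 / eps)) * eps ^- 2 by ring.
  by rewrite lerD2l.
split=> //; last first.
  rewrite natrM; apply: le_trans (ler_pM _ _ TA Kle) _ => //.
  rewrite /soft_bound [in leRHS](_ : eps ^- 4 = eps ^- 2 * eps ^- 2).
    by rewrite le_eqVlt; apply/orP; left; apply/eqP; ring.
  by rewrite -!exprVn -exprD.
split; first by rewrite -(ler_nat R); lra.
apply: le_trans (star _ eps0 eps1).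
rewrite /e_K /U_K -mulrDl ler_pdivrMr//.
have -> : 1 / (1 / (6 * (num_outer l Delta eps)%:R)) = 6 * (num_outer l Delta eps)%:R :> R.
  by rewrite !div1r invrK.
rewrite -/D.
apply: (@le_trans _ _ (c * eps ^+ 2 * x)); last by rewrite ler_wpM2l// mulr_ge0// ltW.
have -> : c * eps ^+ 2 * x = c * M * (1 + ln (1 / eps)).
  by rewrite /x; field; rewrite gt_eqF.
have h1 := ler_wpM2l (ltW D0) lT; have h2 := ler_wpM2l (ltW D0) lK.
have ln20 : 0 <= ln 2 :> R by rewrite ln_ge0// ler1n.
have h3 := ler_wpM2l ln20 L1; have h4 := ler_wpM2l (ltW l0) L1.
have L0 : 0 <= 1 + ln (1 / eps) by lra.
move: (ler_wpM2r L0 Mc); move: h1 h2 h3 h4.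
move: (ln K.+1%:R) (ln (6 * (num_outer _ _ _)%:R)) (1 + ln (1 / eps)).
move: (ln (M + 2)) (ln (6 * A)) (ln 2).
move=> m t n a b L; lra.
Qed.

End ParameterChoice.

(** * The output of the algorithm *)

Section Guarantee.
Context {R : realType} {d : nat} {dOm dXi : measure_display}.
Context {Om : measurableType dOm} {Xi : measurableType dXi}.
Local Notation V := 'rV[R]_d.
Variables (P : probability Om R) (xi : nat -> {mfun Om >-> Xi}).
Variables (vt : V -> Xi -> V) (v : V -> V).
Variables (f g : V -> R) (U : set V) (l Gf Gg sigma : R).
Hypothesis cp : constrained_problem f g U l Gf Gg sigma.
Hypothesis oracle : stochastic_oracle P f Gf (fun n => xi n) vt v.
Variables (x0 : V) (eps : R) (K : nat).

Let C : set V := [set x | g x <= 0].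
Let Delta := f x0 - min_on unit_ball f.

Hypotheses (Cx0 : C x0) (eps_gt0 : 0 < eps).
Hypothesis K_ok : inner_ok l Gf Gg sigma Delta eps K.

Let T := num_outer l Delta eps.
Let lam := lambda_0 l Gf sigma.
Let gam : R := 1 / K%:R.
Let p := softplus lam gam.
Let answer w n z := vt z (xi n w).
Let X t w := outer_point g p (2 * l) l K (answer w) x0 t.
Let inner_error := U_K K l (Gf + 4 * l + lam * Gg) (1 / (6 * T%:R)).
(* The accuracy in terms of distances between points. *)
Let u := eps / (20 * l).

Let l_gt0 : 0 < l := cp_l cp.
Let K_gt0 : (0 < K)%N. Proof. exact: leq_trans (proj1 K_ok). Qed.
Let gam_gt0 : 0 < gam. Proof. by rewrite /gam divr_gt0// ltr0n. Qed.
Let T_gt0 : 0 < T%:R :> R. Proof. by rewrite ltr0n num_outer_gt0. Qed.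
Let u_gt0 : 0 < u. Proof. by apply: divr_gt0 => //; apply: mulr_gt0. Qed.
Let epsE : eps = 20 * (l * u).
Proof. by rewrite /u; field; rewrite gt_eqF. Qed.

Let lam_sigma : Gf + 4 * l <= lam * sigma.
Proof.
have Gf0 := cp_Gf cp.
by rewrite /lam /lambda_0 divfK ?gt_eqF ?(cp_sigma cp)//; have := l_gt0; lra.
Qed.

Let lam_ge0 : 0 <= lam.
Proof.
have Gf0 := cp_Gf cp; apply: divr_ge0; last exact/ltW/(cp_sigma cp).
by apply: mulr_ge0 => //; apply: addr_ge0; [exact: ltW|rewrite mulr_ge0// ltW].
Qed.

Lemma initial_gap_ge0 : 0 <= Delta.
Proof. by rewrite subr_ge0; apply: min_on_ball_le cp _ (cp_sub_ball cp Cx0). Qed.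

Let inner_budget : inner_error + gam * ln 2 <= l * u ^+ 2 / 10.
Proof.
have -> : gam * ln 2 = ln 2 / K%:R by rewrite mulrC /gam mul1r.
apply: le_trans (proj2 K_ok) _; apply: (@le_trans _ _ (eps ^+ 2 / (4000 * l))).
  by rewrite /e_star ge_min lexx.
suff -> : eps ^+ 2 / (4000 * l) = l * u ^+ 2 / 10 by [].
by rewrite epsE; field; rewrite gt_eqF.
Qed.

Let initial_budget : Delta <= T%:R * (2 * l * u ^+ 2 / 5).
Proof.
have := num_outer_ge l Delta eps; rewrite -/T.
have -> : 1000 * l * Delta / eps ^+ 2 = Delta / (2 * l * u ^+ 2 / 5).
  by rewrite epsE; field; rewrite !gt_eqF.
by rewrite ler_pdivrMr// divr_gt0// mulr_gt0 ?exprn_gt0// mulr_gt0.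
Qed.

Let outer_adapted t :
  adapted xi (t * K) (X t) /\ forall w, unit_ball (X t w).
Proof.
elim: t => [|t [aX BX]].
  by split=> [|w]; [exact: mvect_cst|exact: (cp_sub_ball cp)].
have h := psm_adapted lam cp oracle gam_gt0 aX BX.
split=> [|w]; last first.
  have c0 : weakly_convex_on (@unit_ball R d) 0 (fun=> 0).
    by apply: convex_weakly_convex0; apply/convex_functionP => *; rewrite !mulr0 addr0.
  have := convex_average K.-1 (@convex_unit_ball R d) c0 (fun k => (h k).2 w).
  by rewrite prednK// => -[].
apply: mvectZ; apply: mvect_sum => k; apply: adapted_mono (h k).1.
by rewrite mulSn addnC leq_add2r ltnW.
Qed.

Let Xi_generator := \bigcup_k preimage_set_system setT (fun w => xi k w) measurable.

Let past_all n : <<s past xi n >> `<=` <<s Xi_generator >>.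
Proof. by apply: sub_sigma_algebra2 => A [k _ ?]; exists k. Qed.

Let generator_measurable : Xi_generator `<=` measurable.
Proof. by move=> _ [k _ [B mB <-]]; exact: measurable_funP. Qed.

(** The union bound over the outer iterations. *)
Let outer_event : exists E : set Om,
  [/\ <<s Xi_generator >> E, (P E <= (6^-1)%:E)%E &
    forall w t, ~ E w -> (t < T)%N ->
      prox_obj (fun z => f z + p (g z)) l (X t w) (X t.+1 w) <=
      prox_obj (fun z => f z + p (g z)) l (X t w)
        (prox unit_ball (fun z => f z + p (g z)) l (X t w)) + inner_error].
Proof.
have T60 : 0 < 6 * T%:R :> R by rewrite mulr_gt0.
have delta0 : 0 < 1 / (6 * T%:R) :> R by rewrite divr_gt0.
have delta1 : 1 / (6 * T%:R) <= 1 :> R.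
  have : 1 <= T%:R :> R by rewrite ler1n num_outer_gt0.
  by rewrite ler_pdivrMr// mul1r; lra.
have /choice [Ev EvP] := fun t => psm_high_probability cp oracle lam_ge0 gam_gt0 K_gt0
  (outer_adapted t).1 (outer_adapted t).2 delta0 delta1.
have mEv t : <<s Xi_generator >> (Ev t) by apply: (@past_all (t * K + K)); case: (EvP t).
exists (\big[setU/set0]_(t < T) Ev t); split=> [||w t nE tT].
- apply: (@bigsetU_measurable _ (g_sigma_algebraType Xi_generator)) => t _; exact: mEv.
- apply: (@le_trans _ _ (\sum_(t < T) P (Ev t))%E).
    apply: Boole_inequality => t _.
    exact: (sub_sigma_measurable generator_measurable (mEv t)).
  apply: (@le_trans _ _ (\sum_(t < T) (1 / (6 * T%:R))%:E)%E).
    by apply: lee_sum => t _; have [] := EvP t.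
  rewrite sumEFin sumr_const card_ord lee_fin -mulr_natl.
  rewrite le_eqVlt; apply/orP; left; apply/eqP.
  by field; rewrite gt_eqF.
- have [_ _ h] := EvP t; apply: h => Ew; apply: nE.
  by rewrite -bigcup_mkord; exists t.
Qed.

(** ** Counting the bad iterations *)

(* The squared distances add up to at most [T * u ^ 2], so that at most
   [4 / 25 * T <= T / 6] of them exceed [(5 / 2 * u) ^ 2]. *)
Let far t := [set w | 5 / 2 * u < enorm (X t w - Q C f l (X t w))].

Let far_event t : <<s Xi_generator >> (far t).
Proof.
apply: (@past_all (t * K)); have [aX _] := outer_adapted t.
have -> : far t =
    (stationarity C f l \o X t) @^-1` `]2 * l * (5 / 2 * u), +oo[.
  apply/seteqP; split=> w; rewrite /= in_itv/= andbT (stationarityE cp) ltr_pM2l//.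
    by rewrite mulr_gt0.
  by rewrite mulr_gt0.
apply: preimage_sub_measurable; last exact: measurable_itv.
by apply: adapted_continuous aX _; exact: stationarity_continuous cp.
Qed.

Let few_far w :
  (forall t, (t < T)%N ->
      prox_obj (fun z => f z + p (g z)) l (X t w) (X t.+1 w) <=
      prox_obj (fun z => f z + p (g z)) l (X t w)
        (prox unit_ball (fun z => f z + p (g z)) l (X t w)) + inner_error) ->
  \sum_(t < T) \1_(far t) w <= T%:R / 6 :> R.
Proof.
move=> step; have BX t : unit_ball (X t w) := (outer_adapted t).2 w.
have := outer_telescope cp lam_ge0 gam_gt0 lam_sigma BX Cx0 step.
have h1 := initial_budget; have h2 := ler_wpM2l (ltW T_gt0) inner_budget.
rewrite -/C -/Delta => h3.
have h4 : l * u ^+ 2 * (25 / 8 * \sum_(t < T) \1_(far t) w) <=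
    l / 2 * \sum_(t < T) enorm (X t w - Q C f l (X t w)) ^+ 2.
  have -> : l * u ^+ 2 * (25 / 8 * \sum_(t < T) \1_(far t) w) =
      l / 2 * \sum_(t < T) (25 / 4 * u ^+ 2) * \1_(far t) w.
    by rewrite -big_distrr/=; field.
  apply: ler_wpM2l; first by rewrite divr_ge0// ltW.
  apply: ler_sum => t _; rewrite indicE.
  have [/set_mem|_] := boolP (w \in far t); last by rewrite mulr0 sqr_ge0.
  rewrite /far/= mulr1 => /ltW ft.
  have -> : 25 / 4 * u ^+ 2 = (5 / 2 * u) ^+ 2 by field.
  by rewrite ler_sqr ?nnegrE ?enorm_ge0// mulr_ge0// ltW.
have lu : 0 < l * u ^+ 2 by rewrite mulr_gt0// exprn_gt0.
have : l * u ^+ 2 * (25 / 8 * \sum_(t < T) \1_(far t) w) <= l * u ^+ 2 * (T%:R / 2).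
  by move: h1 h2 h3 h4; set s := \sum_(t < T) \1_(far t) w; set q := \sum_(t < T) _; lra.
by rewrite ler_pM2l//; have := T_gt0; lra.
Qed.

Let near_stationary w t y : ~ far t w -> proj_set C (X t.+1 w) y ->
  prox_obj (fun z => f z + p (g z)) l (X t w) (X t.+1 w) <=
    prox_obj (fun z => f z + p (g z)) l (X t w)
      (prox unit_ball (fun z => f z + p (g z)) l (X t w)) + inner_error ->
  stationarity C f l y <= eps.
Proof.
move=> /negP; rewrite -leNgt => sle Py step.
apply: le_trans (stationarity_output_le cp (X t w) Py) _.
have [+ _] := approximate_prox_step cp lam_ge0 gam_gt0 lam_sigma
  ((outer_adapted t).2 w) ((outer_adapted t.+1).2 w) step.
have h1 := inner_budget; rewrite -/C.
move: sle; set s := enorm (X t w - _); set r := enorm (_ - _) => sle r2.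
have rle : r <= u / 2.
  have u2 : 0 <= u / 2 by rewrite divr_ge0// ltW.
  have l2 : 0 < l / 2 by rewrite divr_gt0.
  have lu : 0 <= l * u ^+ 2 by rewrite mulr_ge0 ?sqr_ge0// ltW.
  by rewrite -ler_sqr ?nnegrE ?enorm_ge0// -(ler_pM2l l2) [(u / 2) ^+ 2]expr_div_n; lra.
rewrite epsE.
have := ler_wpM2l (ltW l_gt0) sle; have := ler_wpM2l (ltW l_gt0) rle.
have := mulr_gt0 l_gt0 u_gt0; lra.
Qed.

(** ** The random output *)

Variables (J : {mfun Om >-> nat}) (projC : V -> V).
Hypothesis J_uniform : uniform_on P J (iota 1 T).
Hypothesis J_independent : independent_of P J (all_randomness (fun n => xi n)).
Hypothesis projCP : forall x, proj_set C x (projC x).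

Let xhat w := projC (mkseq (X^~ w) T.+1)`_(J w).
Let success := [set w | stationarity C f l (xhat w) <= eps].

Lemma output_success_measurable : measurable success.
Proof.
have cstat : continuous (stationarity C f l \o projC).
  rewrite (_ : projC = prox C (fun=> 0) 1).
    move=> x; apply: continuous_comp.
      exact: (prox_is_continuous (sublevel_proj_problem cp)).
    exact: stationarity_continuous cp _.
  apply/funext => x; apply: (prox_unique (sublevel_proj_problem cp)).
  by rewrite -proj_setE.
have mX j : mvect (fun w => (mkseq (X^~ w) T.+1)`_j).
  have [jT|Tj] := ltnP j T.+1; last first.
    by under eq_fun do rewrite nth_default ?size_mkseq//; exact: mvect_cst.
  by under eq_fun do rewrite nth_mkseq//; exact: adapted_mvect (outer_adapted j).1.
exact: (measurable_indexed_event J eps mX cstat).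
Qed.

Lemma output_success_probability : ((2 / 3)%:E <= P success)%E.
Proof.
have [E [GE PE step]] := outer_event.
apply: (uniform_index_success generator_measurable J_uniform J_independent
  (num_outer_gt0 _ _ _) GE far_event output_success_measurable PE).
  by move=> w nE; apply: few_far => t; exact: step.
move=> t w tT Jw nE nfar; rewrite /success/= /xhat Jw nth_mkseq ?ltnS//.
exact: near_stationary nfar (projCP _) (step w t nE tT).
Qed.

End Guarantee.

Theorem theorem2 (R : realType) :
  exists cT : R,
  forall l Gf Gg sigma Delta : R,
  exists (cK cTK : R) (aK aTK : nat),
  forall (d : nat) (f g : 'rV[R]_d -> R) (U : set 'rV[R]_d) (x0 : 'rV[R]_d)
    (dOm dXi : measure_display) (Om : measurableType dOm)
    (Xi : measurableType dXi) (P : probability Om R)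
    (xi : nat -> {mfun Om >-> Xi}) (vt : 'rV[R]_d -> Xi -> 'rV[R]_d)
    (v : 'rV[R]_d -> 'rV[R]_d),
  let C := [set x | g x <= 0] in
  (* (i) *)
  C !=set0 -> closed C -> C `<=` unit_ball -> C x0 ->
  (* (ii) *)
  open U -> convex_set (M := 'rV[R]_d) U -> unit_ball `<=` U ->
  0 < l -> 0 < Gf -> weakly_convex_on U l f -> elipschitz_on U Gf f ->
  stochastic_oracle P f Gf (fun n => xi n) vt v ->
  (* (iii) *)
  0 < Gg -> 0 < sigma -> convex_function (E := 'rV[R]_d) U g -> C1_on U g ->
  (forall x, unit_ball x -> enorm (grad g x) <= Gg) ->
  (forall z, unit_ball z -> g z = 0 -> sigma <= enorm (grad g z)) ->
  Delta = f x0 - min_on unit_ball f ->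
  forall eps : R, 0 < eps -> eps <= 1 ->
  let T := num_outer l Delta eps in
  [/\ (* order of T *)
      T%:R <= cT * (1 + l * Delta / eps ^+ 2),
      (* possible choice of K, and resulting number of oracle calls *)
      exists K : nat,
        [/\ inner_ok l Gf Gg sigma Delta eps K,
            K%:R <= soft_bound cK aK 2 eps
          & (T * K)%:R <= soft_bound cTK aTK 4 eps],
      (* the stationarity measure *)
      forall x : 'rV[R]_d,
        [/\ Qset C f l x = [set Q C f l x],
            differentiable (Phi C f l : 'rV[R]_d -> R^o) x
          & stationarity C f l x = 2 * l * enorm (x - Q C f l x)]
    & (* guarantee for every admissible K *)
      forall K : nat, inner_ok l Gf Gg sigma Delta eps K ->
      let p := softplus (lambda_0 l Gf sigma) (1 / K%:R) in
      let beta := 2 * l in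
      let m := l in
      (forall xt, strongly_convex_on unit_ball m (prox_objective f g p beta xt)) /\
      forall (J : {mfun Om >-> nat}) (projC : 'rV[R]_d -> 'rV[R]_d),
        uniform_on P J (iota 1 T) ->
        independent_of P J (all_randomness (fun n => xi n)) ->
        (forall x, proj_set C x (projC x)) ->
        let run w :=
          penalized_psm g p beta m K T (fun n z => vt z (xi n w)) projC
            x0 (J w) (Cost 0 0) in
        let xhat w := (run w).1 in
        let success := [set w | stationarity C f l (xhat w) <= eps] in
        [/\ forall w, C (xhat w),
            forall w, (run w).2 = Cost (T * K) 1,
            measurable success
          & ((2 / 3)%:E <= P success)%E]].
Proof.
exists 1003 => l Gf Gg sigma Delta.
have [[l0 [Gf0 [Gg0 [sigma0 Delta0]]]]|bad] :=
    pselect (0 < l /\ 0 < Gf /\ 0 < Gg /\ 0 < sigma /\ 0 <= Delta); last first.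
  exists 0, 0, 0%N, 0%N => d f g U x0 dOm dXi Om Xi P xi vt v C C0 clC CB Cx0 oU cU BU
    l0 Gf0 wf lf oracle Gg0 sigma0 cg C1g gle gge DeltaE.
  have cp : constrained_problem f g U l Gf Gg sigma by [].
  exfalso; apply: bad; do 4 split=> //.
  by rewrite DeltaE; exact: initial_gap_ge0 cp _ Cx0.
have [cK [cTK [aK [aTK choice_ok]]]] := parameter_choice l0 Gf0 Gg0 sigma0 Delta0.
exists cK, cTK, aK, aTK => d f g U x0 dOm dXi Om Xi P xi vt v C C0 clC CB Cx0 oU cU BU
  _ _ wf lf oracle _ _ cg C1g gle gge DeltaE eps eps0 eps1 T.
have cp : constrained_problem f g U l Gf Gg sigma by [].
split.
- apply: num_outer_le; apply: divr_ge0; last exact: sqr_ge0.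
  by apply: mulr_ge0 => //; exact: ltW.
- exact: choice_ok.
- move=> x; have pp := stationarity_prox_problem cp.
  split; [exact: (argmin_prox_obj pp)|exact: (envelope_differentiable pp x).1|].
  exact: stationarityE cp x.
- move=> K K_ok p beta m.
  have K0 : (0 < K)%N := leq_trans (isT : (0 < 2)%N) (proj1 K_ok).
  have gam0 : 0 < 1 / K%:R :> R by rewrite divr_gt0// ltr0n.
  have lam0 : 0 <= lambda_0 l Gf sigma.
    apply: divr_ge0; last exact: ltW.
    by apply: mulr_ge0 => //; apply: addr_ge0; [|apply: mulr_ge0]; rewrite // ltW.
  split=> [xt|J projC J_uniform J_independent projCP run xhat success].
    exact (prox_objective_strongly_convex cp lam0 gam0 xt).
  rewrite /T DeltaE in J_uniform *; rewrite DeltaE in K_ok.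
  have runE w : run w = (projC (mkseq (outer_point g p beta m K
      (fun n z => vt z (xi n w)) x0) T.+1)`_(J w), Cost (T * K) 1).
    exact: penalized_psmE.
  rewrite (_ : success = [set w | stationarity C f l (projC (mkseq (outer_point g p beta m K
      (fun n z => vt z (xi n w)) x0) T.+1)`_(J w)) <= eps]); last first.
    by apply/funext => w; rewrite /success/= /xhat runE.
  rewrite /T DeltaE; split=> [w|w||].
  + rewrite /xhat runE; exact: (proj1 (projCP _)).
  + by rewrite runE /T DeltaE.
  + exact: (output_success_measurable cp oracle Cx0 K_ok J projCP).
  + exact: (output_success_probability cp oracle Cx0 eps0 K_ok J_uniform J_independent projCP).
Qed.
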